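(* Every proper Fraïssé subclass of $\mathfrak{P}$ (the class of finite posets) occurs as the support of a measure on $\mathfrak{P}$ valued in a field of characteristic $0$.
   Context: All posets are finite; the empty poset is allowed. An embedding of posets is an injective map $\alpha\colon P\to Q$ with $x\le y\iff\alpha(x)\le\alpha(y)$. Given embeddings $\alpha\colon P\to Q$ and $\beta\colon P\to P'$, an amalgamation of $Q$ and $P'$ over $P$ is a triple $(Q',\alpha',\beta')$ where $Q'$ is a poset and $\alpha'\colon P'\to Q'$, $\beta'\colon Q\to Q'$ are embeddings with $\beta'\circ\alpha=\alpha'\circ\beta$ and $Q'=\mathrm{im}(\alpha')\cup\mathrm{im}(\beta')$; amalgamations are considered up to the evident notion of isomorphism. A measure on $\mathfrak{P}$ valued in a field $k$ is a rule $\nu$ assigning to each embedding $\alpha\colon P\to Q$ of finite posets a value $\nu(\alpha)\in k$ such that: (a) $\nu(\alpha)=1$ if $\alpha$ is an isomorphism; (b) $\nu(\beta\circ\alpha)=\nu(\beta)\nu(\alpha)$ when the composition is defined; (c) given embeddings $\alpha\colon P\to Q$ and $\beta\colon P\to P'$, with $(Q'_i,\alpha'_i,\beta'_i)$, $1\le i\le r$, the various amalgamations up to isomorphism, $\nu(\alpha)=\sum_{i=1}^r\nu(\alpha'_i)$. The support of $\nu$ is the class of finite posets $P$ such that $\nu(\emptyset\to P)\ne0$. A Fraïssé subclass of $\mathfrak{P}$ is a class $\mathfrak{F}$ of finite posets that is non-empty; hereditary (if $P\to Q$ is an embedding and $Q\in\mathfrak{F}$ then $P\in\mathfrak{F}$;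 in particular closed under isomorphism); and satisfies the amalgamation property: for embeddings $P\to Q$ and $P\to P'$ with $P,Q,P'\in\mathfrak{F}$, there is at least one amalgamation $Q'$ of $Q$ and $P'$ over $P$ with $Q'\in\mathfrak{F}$. It is proper if $\mathfrak{F}\ne\mathfrak{P}$. *)

(* Defs.v *)
From HB Require Import structures.
From mathcomp Require Import all_boot all_order all_algebra.
Set Implicit Arguments.
Unset Strict Implicit.
Unset Printing Implicit Defensive.
Import Order.TTheory GRing.Theory.
Local Open Scope order_scope.

(* The display is bundled with the poset: it has no mathematical content, and
   every class and measure below is automatically insensitive to it, because
   identity maps between differently displayed copies are isomorphisms. *)
Record finPoset := FinPoset {
  fp_disp : Order.disp_t;
  fp_sort :> finPOrderType fp_disp
}.

Definition is_embedding (P Q : finPoset) (f : {ffun P -> Q}) : bool :=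
  injectiveb f && [forall x, forall y, (x <= y) == (f x <= f y)].

(* Finite functions with a boolean side condition, so that two embeddings with
   the same values are equal and a measure cannot distinguish them. *)
Record embedding (P Q : finPoset) := Embedding {
  emb_fun :> {ffun P -> Q};
  emb_ok : is_embedding emb_fun
}.

Lemma is_embeddingP (P Q : finPoset) (f : {ffun P -> Q}) :
  reflect (injective f /\ {mono f : x y / x <= y}) (is_embedding f).
Proof.
apply: (iffP andP) => [[/injectiveP fi /forallP fm]|[fi fm]]; split=> //.
- by move=> x y; have /forallP/(_ y)/eqP -> := fm x.
- exact/injectiveP.
- by apply/forallP => x; apply/forallP => y; rewrite fm.
Qed.

Lemma comp_embedding_ok (P Q R : finPoset)
    (b : embedding Q R) (a : embedding P Q) :
  is_embedding [ffun x => b (a x)].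
Proof.
have /is_embeddingP[bi bm] := emb_ok b; have /is_embeddingP[ai am] := emb_ok a.
apply/is_embeddingP; split=> [x y|x y]; rewrite !ffunE; first by move/bi/ai.
by rewrite bm am.
Qed.

Definition comp_embedding (P Q R : finPoset)
    (b : embedding Q R) (a : embedding P Q) : embedding P R :=
  Embedding (comp_embedding_ok b a).

Definition empty_poset : finPoset := @FinPoset _ 'I_0.

Lemma empty_embedding_ok (P : finPoset) :
  @is_embedding empty_poset P (ffun0 (card_ord 0)).
Proof. by apply/is_embeddingP; split=> -[]. Qed.

Definition empty_embedding (P : finPoset) : embedding empty_poset P :=
  Embedding (empty_embedding_ok P).

Record amalgamation (P Q P' : finPoset)
    (a : embedding P Q) (b : embedding P P') := Amalgamation {
  am_poset :> finPoset;
  am_a : embedding P' am_poset;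
  am_b : embedding Q am_poset;
  am_comm : forall x : P, am_b (a x) = am_a (b x);
  am_cover : forall z : am_poset,
    (exists y : P', z = am_a y) \/ (exists y : Q, z = am_b y)
}.

Definition amalgamation_iso (P Q P' : finPoset)
    (a : embedding P Q) (b : embedding P P') (A B : amalgamation a b) : Prop :=
  exists h : embedding A B,
    [/\ bijective h, forall y : P', h (am_a A y) = am_a B y
      & forall y : Q, h (am_b A y) = am_b B y].

(* The family A lists each isomorphism class of amalgamations exactly once. *)
Definition amalgamation_reps (P Q P' : finPoset)
    (a : embedding P Q) (b : embedding P P')
    (r : nat) (A : 'I_r -> amalgamation a b) : Prop :=
  forall B : amalgamation a b, exists! i : 'I_r, amalgamation_iso B (A i).

Record measure (k : fieldType) := Measure {
  meas :> forall P Q : finPoset, embedding P Q -> k;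
  meas_iso : forall (P Q : finPoset) (a : embedding P Q),
    bijective a -> meas a = 1%R;
  meas_comp : forall (P Q R : finPoset)
      (b : embedding Q R) (a : embedding P Q),
    meas (comp_embedding b a) = (meas b * meas a)%R;
  meas_amalg : forall (P Q P' : finPoset)
      (a : embedding P Q) (b : embedding P P')
      (r : nat) (A : 'I_r -> amalgamation a b),
    amalgamation_reps A -> meas a = (\sum_(i < r) meas (am_a (A i)))%R
}.

Definition measure_support (k : fieldType) (nu : measure k) (P : finPoset) : Prop :=
  nu _ _ (empty_embedding P) <> 0%R.

Record fraisse_subclass (F : finPoset -> Prop) : Prop := FraisseSubclass {
  fraisse_nonempty : exists P : finPoset, F P;
  fraisse_hereditary : forall (P Q : finPoset) (a : embedding P Q), F Q -> F P;
  fraisse_amalgamation : forall (P Q P' : finPoset)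
      (a : embedding P Q) (b : embedding P P'),
    F P -> F Q -> F P' -> exists A : amalgamation a b, F A
}.

Definition proper_subclass (F : finPoset -> Prop) : Prop :=
  ~ (forall P : finPoset, F P).

(* Main.v *)
(* A measure amounts to a mass for every one-point extension of every finite
   poset, such that adding two points in either order gives the same product
   and masses add up when the base poset grows; the general amalgamation axiom
   then follows by adding the points of Q one at a time.

   Suitable masses come from signed sums of formal points over a poset P that
   are compatible with enlarging P. Next to every p in P one puts formal points
   cancelling it: a twin of p in the antichain and weak-order cases; a point
   just above p in the chain case, where moreover two formal minimal points,
   one below p and one below everything strictly above p, cancel each other.
   What remains has total mass +-t and carries the support: a point incomparable
   to P (antichains, disjoint unions of chains), or the functional giving every
   interval {x | A < x < B} the same value (weak orders). For t = n the supports
   consist of the antichains, disjoint unions of chains and weak orders without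
   antichains of size n + 1; for t = -1 there is no size restriction.

   Conversely these classes exhaust the proper Fraisse classes. Without a
   2-chain one has antichains, and without 2+1 one has weak orders. If V (a
   point below two incomparable ones) or its dual Lambda is missing then both
   are, and one has disjoint unions of chains. If V, Lambda and 2+1 all occur,
   the class is closed under adding a top, a bottom or an isolated point, and
   every poset is obtained from these by forced amalgamations, incomparabilities
   being forced by private minimal witnesses. *)
From HB Require Import structures.
Require Import Defs.
From mathcomp Require Import all_boot all_order all_algebra.
From mathcomp Require Import ring.
From Stdlib Require Import Classical.
Set Implicit Arguments.
Unset Strict Implicit.
Unset Printing Implicit Defensive.
Import Order.TTheory GRing.Theory.
Local Open Scope order_scope.

(** A measure has values on all finite posets, so the symmetry and refinement of the masses must
    hold for arbitrary configurations, not only inside the class; this is why the masses are closed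
    formulas. The cancelling points near [p] have total mass -1: when the base grows by a genuine
    point, the amalgam identified with that point contributes 1 and its formal partners contribute
    -1, so totals are preserved, and what remains is a functional that refines without any counting
    term. Over a nonempty antichain of m points, a further incomparable point gets mass +-(t - m).
    Hence t = n kills precisely the step from n to n + 1 points, while t = -1 is never a natural
    number in characteristic 0. Supports can be tested on single steps: the value on the embedding
    of the empty poset is a product along any order of adding the points, so it vanishes as soon as
    one step inside the poset does. *)

Section RelPoset.
Variables (T : finType) (r : rel T).
Hypothesis (rr : reflexive r) (ra : antisymmetric r) (rt : transitive r).

Definition rel_poset : finPoset :=
  @FinPoset (Order.Disp tt tt)
    (HB.pack_for (finPOrderType (Order.Disp tt tt)) T
      (Order.Le_isPOrder.Build (Order.Disp tt tt) T rr ra rt)).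

End RelPoset.

Notation le_mono f := {mono f : x y / (x <= y)%O}.

Lemma emb_mono (P Q : finPoset) (a : embedding P Q) : le_mono a.
Proof. by have /is_embeddingP[] := emb_ok a. Qed.

Lemma emb_inj (P Q : finPoset) (a : embedding P Q) : injective a.
Proof. by have /is_embeddingP[] := emb_ok a. Qed.

Lemma emb_lt (P Q : finPoset) (a : embedding P Q) : {mono a : x y / x < y}.
Proof. exact: leW_mono (emb_mono a). Qed.

Lemma mono_embedding_ok (P Q : finPoset) (f : P -> Q) (fm : le_mono f) :
  is_embedding [ffun x => f x].
Proof.
apply/is_embeddingP; split=> [x y|x y]; rewrite !ffunE ?fm //.
exact: (inc_inj fm).
Qed.

Definition mono_embedding (P Q : finPoset) (f : P -> Q) (fm : le_mono f) :
  embedding P Q := Embedding (mono_embedding_ok fm).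

Lemma mono_embeddingE (P Q : finPoset) (f : P -> Q) (fm : le_mono f) :
  mono_embedding fm =1 f.
Proof. by move=> x; rewrite ffunE. Qed.

Lemma embP (P Q : finPoset) (a b : embedding P Q) : a =1 b -> a = b.
Proof.
case: a b => [f fP] [g gP] /= /ffunP E; subst g.
by congr Embedding; apply: bool_irrelevance.
Qed.

Section SubPoset.
Variables (P : finPoset) (S : {set P}).

Lemma sub_le_refl : reflexive (fun x y : {x | x \in S} => val x <= val y).
Proof. by move=> x /=. Qed.

Lemma sub_le_anti : antisymmetric (fun x y : {x | x \in S} => val x <= val y).
Proof. by move=> x y /le_anti /val_inj. Qed.

Lemma sub_le_trans : transitive (fun x y : {x | x \in S} => val x <= val y).
Proof. by move=> y x z; apply: le_trans. Qed.

Definition sub_poset : finPoset := rel_poset sub_le_refl sub_le_anti sub_le_trans.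

Definition sub_val (x : sub_poset) : P := val (x : {x | x \in S}).

Definition sub_elt (x : P) (xS : x \in S) : sub_poset := exist _ x xS.

Lemma sub_val_mono : le_mono sub_val.
Proof. by []. Qed.

Lemma sub_valP (x : sub_poset) : sub_val x \in S.
Proof. exact: (valP (x : {x | x \in S})). Qed.

Lemma sub_val_inj : injective sub_val.
Proof. exact: (inc_inj sub_val_mono). Qed.

End SubPoset.

(** * From one-point masses to measures *)

Definition below (P : finPoset) (S : {set P}) (x : P) := [set s in S | s < x].
Definition above (P : finPoset) (S : {set P}) (x : P) := [set s in S | x < s].

Definition is_cut (P : finPoset) (S L U : {set P}) : bool :=
  [&& L \subset S, U \subset S,
      [forall a in S, forall b in L, (a <= b) ==> (a \in L)],
      [forall a in S, forall b in U, (b <= a) ==> (a \in U)]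
    & [forall a in L, forall b in U, a < b]].

Lemma is_cutP (P : finPoset) (S L U : {set P}) :
  reflect [/\ L \subset S, U \subset S,
    forall a b, a \in S -> b \in L -> a <= b -> a \in L,
    forall a b, a \in S -> b \in U -> b <= a -> a \in U
    & forall a b, a \in L -> b \in U -> a < b] (is_cut S L U).
Proof.
apply: (iffP and5P) => -[LS US hL hU hLU]; split=> //.
- move=> a b aS bL ab; move/forall_inP: hL => /(_ a aS)/forall_inP/(_ b bL).
  by move/implyP; apply.
- move=> a b aS bL ab; move/forall_inP: hU => /(_ a aS)/forall_inP/(_ b bL).
  by move/implyP; apply.
- by move=> a b aL bU; move/forall_inP: hLU => /(_ a aL)/forall_inP/(_ b bU).
- apply/forall_inP => a aS; apply/forall_inP => b bL; apply/implyP; exact: hL.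
- apply/forall_inP => a aS; apply/forall_inP => b bL; apply/implyP; exact: hU.
- by apply/forall_inP => a aS; apply/forall_inP => b bL; apply: hLU.
Qed.

Lemma below_above_cut (P : finPoset) (S : {set P}) (x : P) :
  is_cut S (below S x) (above S x).
Proof.
apply/is_cutP; split.
- by apply/subsetP => y; rewrite inE => /andP[].
- by apply/subsetP => y; rewrite inE => /andP[].
- by move=> a b aS; rewrite !inE aS /= => /andP[_ bx] /le_lt_trans; apply.
- by move=> a b aS; rewrite !inE aS /= => /andP[_ bx]; apply: lt_le_trans.
- move=> a b; rewrite !inE => /andP[_ ax] /andP[_ xb]; exact: lt_trans xb.
Qed.

Lemma below_mono (P Q : finPoset) (f : P -> Q) (fm : le_mono f) (S : {set P}) (x : P) :
  below (f @: S) (f x) = f @: below S x.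
Proof.
have flt : {mono f : x y / x < y} := leW_mono fm.
apply/setP => z; rewrite inE; apply/andP/imsetP => [[/imsetP[y yS ->] yx]|[y]].
  by exists y => //; rewrite inE yS -flt.
by rewrite inE => /andP[yS yx] ->; rewrite flt imset_f.
Qed.

Lemma above_mono (P Q : finPoset) (f : P -> Q) (fm : le_mono f) (S : {set P}) (x : P) :
  above (f @: S) (f x) = f @: above S x.
Proof.
have flt : {mono f : x y / x < y} := leW_mono fm.
apply/setP => z; rewrite inE; apply/andP/imsetP => [[/imsetP[y yS ->] yx]|[y]].
  by exists y => //; rewrite inE yS -flt.
by rewrite inE => /andP[yS yx] ->; rewrite flt imset_f.
Qed.

(* [pm S L U] is the mass of the one-point extensions of the subposet [S] whose
   new point has [L] below it and [U] above it. *)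
Record point_mass (k : fieldType) := PointMass {
  pm :> forall P : finPoset, {set P} -> {set P} -> {set P} -> k;
  pm_mono : forall (P Q : finPoset) (f : P -> Q), le_mono f ->
    forall S L U : {set P}, pm (f @: S) (f @: L) (f @: U) = pm S L U;
  pm_swap : forall (P : finPoset) (S : {set P}) x y,
    x \notin S -> y \notin S -> x != y ->
    (pm S (below S x) (above S x) *
      pm (x |: S) (below (x |: S) y) (above (x |: S) y) =
    pm S (below S y) (above S y) *
      pm (y |: S) (below (y |: S) x) (above (y |: S) x))%R;
  pm_refine : forall (P : finPoset) (S L U : {set P}), is_cut S L U ->
    (pm S L U =
      #|[set y in ~: S | (below S y == L) && (above S y == U)]|%:R
      + \sum_(C : {set P} * {set P} | is_cut setT C.1 C.2
               && ((C.1 :&: S == L) && (C.2 :&: S == U)))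
          pm setT C.1 C.2)%R
}.

Section PathMass.
Variables (k : fieldType) (m : point_mass k).
Local Open Scope ring_scope.

Definition mass (P : finPoset) (S : {set P}) (x : P) : k :=
  pm m S (below S x) (above S x).

Lemma mass_mono (P Q : finPoset) (f : P -> Q) (fm : le_mono f) (S : {set P}) (x : P) :
  mass (f @: S) (f x) = mass S x.
Proof. by rewrite /mass below_mono // above_mono // pm_mono. Qed.

Fixpoint path_mass (P : finPoset) (S : {set P}) (s : seq P) : k :=
  if s is x :: s' then mass S x * path_mass (x |: S) s' else 1.

(** Adjacent transpositions, each an instance of [pm_swap], carry [x] to the front. *)
Lemma path_mass_front (P : finPoset) (S : {set P}) x (s t : seq P) :
  uniq (s ++ x :: t) -> {in s ++ x :: t, forall z, z \notin S} ->
  path_mass S (s ++ x :: t) = path_mass S (x :: s ++ t).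
Proof.
elim: s S => [|y s IH] S //= /andP[ys us] hS.
have yx : x != y.
  by apply: contraNneq ys => <-; rewrite mem_cat inE eqxx orbT.
rewrite IH //=; last first.
  move=> z zs; rewrite !inE negb_or hS ?andbT; last by rewrite inE zs orbT.
  by apply: contraNneq ys => <-.
rewrite !mulrA /mass pm_swap ?(setUCA [set x]) //.
- by rewrite hS // inE eqxx.
- by rewrite hS // inE mem_cat inE eqxx !orbT.
- by rewrite eq_sym.
Qed.

Lemma path_mass_perm (P : finPoset) (S : {set P}) (s t : seq P) :
  uniq s -> {in s, forall z, z \notin S} -> perm_eq s t ->
  path_mass S s = path_mass S t.
Proof.
elim: s S t => [|x s IH] S t; first by rewrite perm_sym => _ _ /perm_nilP ->.
move=> us hS pst.
have xt : x \in t by rewrite -(perm_mem pst) inE eqxx.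
move: pst; case/splitPr: xt => t1 t2 pst.
have ut : uniq (t1 ++ x :: t2) by rewrite -(perm_uniq pst).
rewrite path_mass_front //; last by move=> z; rewrite -(perm_mem pst); apply: hS.
move: us => /= /andP[xs us]; rewrite (IH _ (t1 ++ t2)) //.
  move=> z zs; rewrite !inE negb_or hS ?andbT ?inE ?zs ?orbT //.
  by apply: contraNneq xs => <-.
by rewrite -(perm_cons x) (perm_trans pst) // perm_catC /= perm_cons perm_catC.
Qed.

Lemma path_mass_cat (P : finPoset) (S : {set P}) (s t : seq P) :
  path_mass S (s ++ t) = path_mass S s * path_mass ([set z in s] :|: S) t.
Proof.
elim: s S => [|x s IH] S /=.
  rewrite mul1r; congr path_mass; apply/setP => z; by rewrite !inE.
rewrite IH mulrA; congr (_ * path_mass _ _).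
by apply/setP => z; rewrite !inE orbCA orbA.
Qed.

Lemma path_mass_mono (P Q : finPoset) (f : P -> Q) (fm : le_mono f) (S : {set P}) (s : seq P) :
  path_mass (f @: S) (map f s) = path_mass S s.
Proof.
elim: s S => [|x s IH] S //=; rewrite mass_mono //.
by rewrite -IH imsetU1.
Qed.

Definition im (P Q : finPoset) (a : embedding P Q) : {set Q} := a @: setT.

Lemma imP (P Q : finPoset) (a : embedding P Q) x :
  reflect (exists y, x = a y) (x \in im a).
Proof. by apply: (iffP imsetP) => [[y _ ->]|[y ->]]; exists y. Qed.

Lemma mem_im (P Q : finPoset) (a : embedding P Q) x : a x \in im a.
Proof. exact: imset_f. Qed.

Definition nu (P Q : finPoset) (a : embedding P Q) : k :=
  path_mass (im a) (enum (~: im a)).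

Lemma nuE (P Q : finPoset) (a : embedding P Q) (s : seq Q) :
  uniq s -> s =i ~: im a -> nu a = path_mass (im a) s.
Proof.
move=> us hs; apply: path_mass_perm; rewrite ?enum_uniq //.
  by move=> z; rewrite mem_enum inE.
by apply: uniq_perm; rewrite ?enum_uniq // => z; rewrite mem_enum hs.
Qed.

Lemma nu_iso (P Q : finPoset) (a : embedding P Q) : bijective a -> nu a = 1.
Proof.
move=> [b _ ab]; rewrite (@nuE _ _ _ [::]) // => z.
by rewrite !inE -(ab z) mem_im.
Qed.

(** By [nuE] the points may be added in the order of the factorisation: first those coming from [Q],
    then those outside [im b]. [path_mass_mono] pulls the first stretch back to [Q]. *)
Lemma nu_comp (P Q R : finPoset) (b : embedding Q R) (a : embedding P Q) :
  nu (comp_embedding b a) = nu b * nu a.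
Proof.
have bm := emb_mono b.
have E : im (comp_embedding b a) = b @: im a.
  by rewrite /im -imset_comp; apply: eq_imset => x /=; rewrite ffunE.
have Eb z : (z \in [seq b y | y <- enum (~: im a)]) = (z \in im b :\: b @: im a).
  rewrite inE; apply/mapP/andP => [[y]|[zba /imP[y zy]]].
    rewrite mem_enum inE => ya ->; split; last exact: mem_im.
    by rewrite mem_imset //; exact: emb_inj.
  by exists y => //; rewrite mem_enum inE; apply: contraNN zba => ?; rewrite zy imset_f.
rewrite (@nuE _ _ _ (map b (enum (~: im a)) ++ enum (~: im b))).
- rewrite E path_mass_cat path_mass_mono // mulrC; congr (path_mass _ _ * _).
  apply/setP => z; rewrite 2!inE Eb inE; apply/orP/idP => [[/andP[]|] //|->].
    by case/imsetP => y _ ->; apply: mem_im.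
  by rewrite andbT; case: (z \in _); [right|left].
- rewrite cat_uniq map_inj_uniq ?enum_uniq ?andbT /=; last exact: emb_inj.
  apply/hasPn => z; rewrite mem_enum Eb !inE => /negbTE ->; by rewrite andbF.
- move=> z; rewrite mem_cat Eb mem_enum E !inE.
  have : (z \in b @: im a) -> z \in im b by case/imsetP => y _ ->; apply: mem_im.
  by case: (z \in im b); case: (z \in b @: im a) => //= ->.
Qed.

Lemma nu_step (P Q : finPoset) (a : embedding P Q) x :
  x \notin im a -> x |: im a = setT -> nu a = mass (im a) x.
Proof.
move=> xa xT; rewrite (@nuE _ _ _ [:: x]) //= ?mulr1 // => z.
move/setP: xT => /(_ z); rewrite !inE; case: eqP => [->|_ /= ->//].
by rewrite xa.
Qed.

Lemma empty_nuE (P : finPoset) (s : seq P) :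
  uniq s -> s =i setT -> nu (empty_embedding P) = path_mass set0 s.
Proof.
have E : im (empty_embedding P) = set0.
  by apply/setP => z; rewrite inE; apply/negbTE/imP => -[[]].
by move=> us hs; rewrite (@nuE _ _ _ s us) E // => z; rewrite hs !inE.
Qed.

Lemma empty_nu_neq0 (P : finPoset) :
  (forall (S : {set P}) x, x \notin S -> mass S x != 0) ->
  nu (empty_embedding P) != 0.
Proof.
move=> h; rewrite (@empty_nuE P (enum P)) ?enum_uniq //; last first.
  by move=> z; rewrite in_setT mem_enum.
have : {in enum P, forall x, x \notin (set0 : {set P})} by move=> x; rewrite inE.
elim: (enum P) (enum_uniq P) set0 => [|x s IH] /=; first by rewrite oner_neq0.
case/andP => xs us S hS; rewrite mulf_neq0 //.
  by rewrite h // hS // inE eqxx.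
apply: IH => // z zs; rewrite !inE negb_or hS ?andbT ?inE ?zs ?orbT //.
by apply: contraNneq xs => <-.
Qed.

(** The points can be added so that [S] is filled first and [x] comes next; one vanishing step
    anywhere kills the product. Every forbidden pattern is excluded from a support in this way. *)
Lemma empty_nu_eq0 (P : finPoset) (S : {set P}) x :
  x \notin S -> mass S x = 0 -> nu (empty_embedding P) = 0.
Proof.
move=> xS m0.
rewrite (@empty_nuE P (enum S ++ x :: enum (~: (x |: S)))).
- rewrite path_mass_cat /= (_ : _ :|: set0 = S) ?m0 ?mul0r ?mulr0 //.
  by apply/setP => z; rewrite !inE mem_enum orbF.
- rewrite cat_uniq /= !enum_uniq !mem_enum !inE eqxx (negbTE xS) /=.
  rewrite andbT; apply/hasPn => z; rewrite !mem_enum !inE negb_or.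
  by case/andP.
- move=> z; rewrite mem_cat inE !mem_enum !inE.
  by case: (z == x); case: (z \in S).
Qed.

End PathMass.

(** * Sums over amalgamations *)

Section Glue.
Variables (P Q P' : finPoset) (a : embedding P Q) (b : embedding P P').
Implicit Types A B C : amalgamation a b.

Definition glue A (u : P' + Q) : A :=
  match u with inl y => am_a A y | inr y => am_b A y end.

Lemma glue_surj A z : exists u, glue A u == z.
Proof.
by case: (am_cover z) => -[y ->]; [exists (inl y)|exists (inr y)] => /=.
Qed.

Definition same_glue A B :=
  forall u v, (glue A u <= glue A v) = (glue B u <= glue B v).

(** A point is moved by choosing a name for it in [P' + Q]; when the two preorders agree, the chosen
    name is immaterial. *)
Definition transport A B (z : A) : B := glue B (xchoose (glue_surj z)).

Lemma transport_glue A B u : same_glue A B -> transport B (glue A u) = glue B u.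
Proof.
move=> AB; apply/le_anti; rewrite -!AB.
by rewrite (eqP (xchooseP (glue_surj (glue A u)))) lexx.
Qed.

Lemma transport_mono A B : same_glue A B -> le_mono (@transport A B).
Proof.
move=> AB y z; case: (glue_surj y) => u /eqP <-; case: (glue_surj z) => v /eqP <-.
by rewrite !transport_glue.
Qed.

Lemma transportK A B : same_glue A B -> cancel (@transport A B) (@transport B A).
Proof.
move=> AB z; case: (glue_surj z) => u /eqP <-; by rewrite !transport_glue // => ? ?; rewrite AB.
Qed.

(* An isomorphism class of amalgamations is the same as the preorder that it
   induces on the disjoint union [P' + Q]. *)
Lemma amalgamation_isoP A B : amalgamation_iso A B <-> same_glue A B.
Proof.
split=> [[h [_ ha hb]] u v|AB].
  have E w : glue B w = h (glue A w) by case: w => y /=; rewrite ?ha ?hb.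
  by rewrite !E emb_mono.
exists (mono_embedding (transport_mono AB)); split.
- exists (@transport B A) => z; rewrite mono_embeddingE transportK //.
- by move=> y; rewrite mono_embeddingE (transport_glue (inl y)).
- by move=> y; rewrite mono_embeddingE (transport_glue (inr y)).
Qed.

End Glue.

Section AmalgamationSum.
Variables (k : fieldType) (m : point_mass k).
Local Open Scope ring_scope.

Definition reps (P Q P' : finPoset) (a : embedding P Q) (b : embedding P P')
    (I : finType) (A : I -> amalgamation a b) : Prop :=
  forall B : amalgamation a b, exists! i : I, same_glue B (A i).

(** An informative sigma type, so that a family of solutions, one for each intermediate amalgam, can
    be projected out. The index is any finite type because the induction produces sums and dependent
    pairs. *)
Definition solved (P Q P' : finPoset) (a : embedding P Q) (b : embedding P P') :=
  {I : finType & {A : I -> amalgamation a b |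
     reps A /\ nu m a = \sum_i nu m (am_a (A i))}}.

Lemma nu_same_glue (P Q P' : finPoset) (a : embedding P Q) (b : embedding P P')
    (A B : amalgamation a b) : same_glue A B -> nu m (am_a A) = nu m (am_a B).
Proof.
case/amalgamation_isoP => h [hb ha _].
have <- : comp_embedding h (am_a A) = am_a B by apply: embP => y; rewrite ffunE ha.
by rewrite nu_comp (nu_iso m hb) mul1r.
Qed.

(** Two irredundant lists of the same isomorphism classes are in bijection, and [nu] of the leg from
    [P'] depends only on the class; one solved list settles them all. *)
Lemma solved_sum (P Q P' : finPoset) (a : embedding P Q) (b : embedding P P')
    (r : nat) (A : 'I_r -> amalgamation a b) :
  solved a b -> amalgamation_reps A -> nu m a = \sum_(i < r) nu m (am_a (A i)).
Proof.
move=> [I [B [rB ->]]] rA.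
have /fin_all_exists[f fP] : forall i, exists j, same_glue (A i) (B j).
  by move=> i; case: (rB (A i)) => j [? _]; exists j.
have /fin_all_exists[g gP] : forall j, exists i, same_glue (B j) (A i).
  by move=> j; case: (rA (B j)) => i [/amalgamation_isoP ? _]; exists i.
have fg : cancel f g.
  move=> i; case: (rA (A i)) => i0 [_ U]; apply: (@etrans _ _ i0).
    by apply/esym/U/amalgamation_isoP => u v; rewrite fP gP.
  by apply/U/amalgamation_isoP.
have gf : cancel g f.
  move=> j; case: (rB (B j)) => j0 [_ U]; apply: (@etrans _ _ j0).
    by apply/esym/U => u v; rewrite gP fP.
  exact/U.
rewrite (reindex f) /=; last by exists g => ? _; [apply: fg|apply: gf].
by apply: eq_bigr => i _; apply/esym/nu_same_glue/fP.
Qed.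

Section Comp.
Variables (P Q1 Q P' : finPoset) (a1 : embedding P Q1) (a2 : embedding Q1 Q).
Variables (b : embedding P P').
Let a := comp_embedding a2 a1.

Section Stack.
Variables (A : amalgamation a1 b) (B : amalgamation a2 (am_b A)).

Lemma stack_comm x : am_b B (a x) = comp_embedding (am_a B) (am_a A) (b x).
Proof. by rewrite !ffunE am_comm am_comm. Qed.

Lemma stack_cover z :
  (exists y, z = comp_embedding (am_a B) (am_a A) y) \/ (exists y, z = am_b B y).
Proof.
case: (am_cover z) => -[y ->]; last by right; exists y.
case: (am_cover y) => -[t ->]; first by left; exists t; rewrite ffunE.
by right; exists (a2 t); rewrite am_comm.
Qed.

Definition stack : amalgamation a b := Amalgamation stack_comm stack_cover.

Definition stack_lift (u : P' + Q1) : P' + Q :=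
  match u with inl y => inl y | inr y => inr (a2 y) end.

Lemma glue_stack_lift u : glue stack (stack_lift u) = am_a B (glue A u).
Proof. by case: u => y /=; rewrite ?ffunE ?am_comm. Qed.

Lemma glue_stack u :
  glue stack u = glue B (match u with inl y => inl (am_a A y) | inr y => inr y end).
Proof. by case: u => y; rewrite /= ?ffunE. Qed.

End Stack.

Section Unstack.
Variables (C : amalgamation a b).

(** The trace of [P'] and [Q1] in [C]: the intermediate amalgam that [C] determines. *)
Definition mid_set : {set C} :=
  (fun u => glue C (stack_lift u)) @: [set: (P' + Q1)%type].

Definition mid_elt u : sub_poset mid_set :=
  sub_elt (imset_f (fun u => glue C (stack_lift u)) (in_setT u)).

Lemma mid_a_mono : le_mono (fun y => mid_elt (inl y)).
Proof. by move=> y z; rewrite -sub_val_mono /= emb_mono. Qed.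

Lemma mid_b_mono : le_mono (fun y => mid_elt (inr y)).
Proof. by move=> y z; rewrite -sub_val_mono /= !emb_mono. Qed.

Lemma mid_comm x :
  mono_embedding mid_b_mono (a1 x) = mono_embedding mid_a_mono (b x).
Proof.
rewrite !mono_embeddingE; apply: sub_val_inj.
change (am_b C (a2 (a1 x)) = am_a C (b x)).
by rewrite -am_comm ffunE.
Qed.

Lemma mid_cover z : (exists y, z = mono_embedding mid_a_mono y)
  \/ (exists y, z = mono_embedding mid_b_mono y).
Proof.
have /imsetP[u _ E] := sub_valP z.
case: u E => y E; [left|right]; exists y; rewrite mono_embeddingE;
  exact: sub_val_inj.
Qed.

Definition mid : amalgamation a1 b := Amalgamation mid_comm mid_cover.

Lemma glue_mid u : sub_val (glue mid u : sub_poset mid_set) = glue C (stack_lift u).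
Proof. by case: u => y /=; rewrite ffunE. Qed.

Variable A : amalgamation a1 b.
Hypothesis midA : same_glue mid A.

Let f (z : A) : C := sub_val (transport mid z : sub_poset mid_set).

Lemma over_glue u : f (glue A u) = glue C (stack_lift u).
Proof.
by rewrite /f transport_glue ?glue_mid // => ? ?; rewrite midA.
Qed.

Lemma over_mono : le_mono f.
Proof.
move=> y z; rewrite /f sub_val_mono; apply: (transport_mono (B := mid)).
by move=> ? ?; rewrite midA.
Qed.

Lemma over_comm x : am_b C (a2 x) = mono_embedding over_mono (am_b A x).
Proof. by rewrite mono_embeddingE (over_glue (inr x)). Qed.

Lemma over_cover z : (exists y, z = mono_embedding over_mono y)
  \/ (exists y, z = am_b C y).
Proof.
case: (am_cover z) => -[y ->]; last by right; exists y.
by left; exists (am_a A y); rewrite mono_embeddingE (over_glue (inl y)).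
Qed.

Definition over : amalgamation a2 (am_b A) := Amalgamation over_comm over_cover.

Lemma glue_stack_over u : glue (stack over) u = glue C u.
Proof.
case: u => y //=; rewrite !ffunE; exact: (over_glue (inl y)).
Qed.

End Unstack.

(** An amalgam [C] determines its middle part, and is then an amalgam of [Q] over that part. The sum
    over pairs factors because [nu] is multiplicative. *)
Lemma solved_comp : solved a1 b ->
  (forall P1 (b1 : embedding Q1 P1), solved a2 b1) -> solved a b.
Proof.
move=> [I [A [rA sA]]] h2.
pose J i := projT1 (h2 _ (am_b (A i))).
pose B i : J i -> amalgamation a2 (am_b (A i)) := sval (projT2 (h2 _ (am_b (A i)))).
have rB i : reps (B i) := (svalP (projT2 (h2 _ (am_b (A i))))).1.
have sB i : nu m a2 = \sum_j nu m (am_a (B i j)) :=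
  (svalP (projT2 (h2 _ (am_b (A i))))).2.
exists {i : I & J i}, (fun p => stack (B (tag p) (tagged p))); split; last first.
  rewrite nu_comp sA mulr_sumr.
  rewrite -(sig_big_dep (fun _ => true) (fun _ _ => true)
    (fun i j => nu m (am_a (stack (B i j))))) /=.
  apply: eq_bigr => i _; rewrite (sB i) mulr_suml.
  by apply: eq_bigr => j _; rewrite nu_comp.
move=> C; have [i [Ci Ui]] := rA (mid C).
have [j [Cj Uj]] := rB i (over Ci).
have CS : same_glue C (stack (B i j)).
  move=> u v; rewrite -!(glue_stack_over Ci).
  by rewrite !glue_stack Cj.
exists (Tagged J j); split=> // -[i' j'] /= Cij.
(* Restricting the preorder of [C] to [P' + Q1] recovers the first index. *)
have Ei : i = i'.
  apply: Ui => u v; rewrite -sub_val_mono !glue_mid Cij.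
  by rewrite !glue_stack_lift emb_mono.
subst i'; congr existT; apply: Uj => u v.
(* Points of [A i] have names in [P' + Q1], so agreement of the stacked preorders on [P' + Q]
   already gives agreement over [A i]. *)
have key w : exists w', forall B' : amalgamation a2 (am_b (A i)),
    glue B' w = glue (stack B') w'.
  case: w => y; last by exists (inr y).
  case: (glue_surj y) => t /eqP <-.
  by exists (stack_lift t) => B'; rewrite glue_stack_lift.
by have [u' Eu] := key u; have [v' Ev] := key v; rewrite !Eu !Ev !glue_stack_over Cij.
Qed.

End Comp.

End AmalgamationSum.

(** * One-point extensions and their amalgamations *)

Section CutPoset.
Variables (P : finPoset) (L U : {set P}).

Definition cut_le (x y : option P) : bool :=
  match x, y with
  | Some x, Some y => x <= y
  | Some x, None => x \in L
  | None, Some y => y \in U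
  | None, None => true
  end.

Hypothesis cutLU : is_cut setT L U.

Lemma cut_le_refl : reflexive cut_le.
Proof. by case=> //= x. Qed.

Lemma cut_le_anti : antisymmetric cut_le.
Proof.
have [_ _ _ _ LU] := is_cutP _ _ _ cutLU.
case=> [x|] [y|] //= /andP[h1 h2]; first by congr Some; apply/le_anti; rewrite h1.
- by have := LU _ _ h1 h2; rewrite ltxx.
- by have := LU _ _ h2 h1; rewrite ltxx.
Qed.

Lemma cut_le_trans : transitive cut_le.
Proof.
have [_ _ dL uU LU] := is_cutP _ _ _ cutLU.
case=> [y|] [x|] [z|] //=; first exact: le_trans.
- by move=> xy yL; apply: dL xy; rewrite ?inE.
- by move=> yU yz; apply: uU yz; rewrite ?inE.
- by move=> xL zU; apply/ltW/LU.
Qed.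

Definition cut_poset : finPoset := rel_poset cut_le_refl cut_le_anti cut_le_trans.

Definition cut_some (x : P) : cut_poset := Some x.
Definition cut_new : cut_poset := None.

Lemma cut_some_mono : le_mono cut_some.
Proof. by []. Qed.

Lemma cut_some_lt x : (cut_some x < cut_new) = (x \in L).
Proof. by rewrite lt_neqAle. Qed.

Lemma cut_new_lt x : (cut_new < cut_some x) = (x \in U).
Proof. by rewrite lt_neqAle. Qed.

Lemma cut_some_le x : (cut_some x <= cut_new) = (x \in L).
Proof. by []. Qed.

Lemma cut_new_le x : (cut_new <= cut_some x) = (x \in U).
Proof. by []. Qed.

End CutPoset.

Section OnePoint.
Variables (P Q P' : finPoset) (a : embedding P Q) (b : embedding P P') (x : Q).
Hypotheses (xa : x \notin im a) (xT : x |: im a = setT).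

Lemma one_point_case q : q = x \/ exists p, q = a p.
Proof.
have : q \in x |: im a by rewrite xT inE.
by case/setU1P => [->|/imP]; [left|right].
Qed.

(** The default [z] is reached only at [x], the one point outside the image of [a]. *)
Definition extend (T : finPoset) (f : P -> T) (z : T) (q : Q) : T :=
  if [pick p | a p == q] is Some p then f p else z.

Lemma extend_old (T : finPoset) (f : P -> T) z p : extend f z (a p) = f p.
Proof.
rewrite /extend; case: pickP => [p' /eqP/emb_inj -> //|/(_ p)].
by rewrite eqxx.
Qed.

Lemma extend_new (T : finPoset) (f : P -> T) z : extend f z x = z.
Proof.
rewrite /extend; case: pickP => // p /eqP pa.
by move: xa; rewrite -pa mem_im.
Qed.

Lemma extend_mono (T : finPoset) (f : P -> T) z : le_mono f ->
  (forall p, (f p <= z) = (a p < x)) -> (forall p, (z <= f p) = (x < a p)) ->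
  le_mono (extend f z).
Proof.
move=> fm fz zf q r.
have xna p : x != a p by apply: contraNneq xa => ->; apply: mem_im.
case: (one_point_case q) => [->|[p ->]]; case: (one_point_case r) => [->|[p' ->]];
  rewrite ?extend_new ?extend_old ?lexx // ?fm ?emb_mono //.
- by rewrite zf lt_neqAle xna.
- by rewrite fz lt_neqAle eq_sym xna.
Qed.

Lemma one_point_same_glue (A B : amalgamation a b) :
  (forall y, (am_a A y <= am_b A x) = (am_a B y <= am_b B x)) ->
  (forall y, (am_b A x <= am_a A y) = (am_b B x <= am_a B y)) -> same_glue A B.
Proof.
move=> h1 h2 u v.
have red w : (forall C : amalgamation a b, glue C w = am_b C x) \/
    exists y, forall C : amalgamation a b, glue C w = am_a C y.
  case: w => [y|q]; first by right; exists y.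
  case: (one_point_case q) => [->|[p ->]]; first by left.
  by right; exists (b p) => C; rewrite /= am_comm.
case: (red u) => [Eu|[y Eu]]; case: (red v) => [Ev|[z Ev]];
  by rewrite !Eu !Ev ?lexx ?emb_mono.
Qed.

Definition old_below : {set P'} := [set b p | p in [set p | a p < x]].
Definition old_above : {set P'} := [set b p | p in [set p | x < a p]].

Lemma mem_old_below p : (b p \in old_below) = (a p < x).
Proof. by rewrite mem_imset ?inE //; exact: emb_inj. Qed.

Lemma mem_old_above p : (b p \in old_above) = (x < a p).
Proof. by rewrite mem_imset ?inE //; exact: emb_inj. Qed.

Lemma old_sub (A : {set P'}) :
  A \subset im b -> forall A' : {set P'}, A' \subset im b ->
  (forall p, (b p \in A) = (b p \in A')) -> A = A'.
Proof.
move=> /subsetP Ab A' /subsetP A'b E; apply/setP => y; apply/idP/idP => yA.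
  by have /imP[p yp] := Ab _ yA; rewrite yp -E -yp.
by have /imP[p yp] := A'b _ yA; rewrite yp E -yp.
Qed.

Lemma old_below_im : old_below \subset im b.
Proof. by apply/subsetP => y /imsetP[p _ ->]; apply: mem_im. Qed.

Lemma old_above_im : old_above \subset im b.
Proof. by apply/subsetP => y /imsetP[p _ ->]; apply: mem_im. Qed.

Lemma old_cut : is_cut (im b) old_below old_above.
Proof.
apply/is_cutP; split; rewrite ?old_below_im ?old_above_im //.
- move=> y z /imP[p ->] /imsetP[q]; rewrite inE => qx ->.
  by rewrite emb_mono mem_old_below -(emb_mono a) => /le_lt_trans; apply.
- move=> y z /imP[p ->] /imsetP[q]; rewrite inE => qx ->.
  by rewrite emb_mono mem_old_above -(emb_mono a); apply: lt_le_trans.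
- move=> _ _ /imsetP[p px ->] /imsetP[q qx ->]; rewrite !inE in px qx.
  by rewrite emb_lt -(emb_lt a) (lt_trans px qx).
Qed.

(** The points of [P'] with which [x] may be identified. Each yields an amalgam equal to [P'], of
    value 1; together they form the cardinality in [pm_refine], while [new_cuts] indexes its sum. *)
Definition old_pts : {set P'} := [set y in ~: im b |
  (below (im b) y == old_below) && (above (im b) y == old_above)].

Definition new_cuts : pred ({set P'} * {set P'}) := fun C =>
  is_cut setT C.1 C.2 &&
    ((C.1 :&: im b == old_below) && (C.2 :&: im b == old_above)).

Section OldPoint.
Variable y : {y : P' | y \in old_pts}.

Lemma old_lt p : (b p < val y) = (a p < x).
Proof.
have := valP y; rewrite inE => /and3P[_ /eqP/setP/(_ (b p)) E _].
by rewrite mem_old_below inE mem_im in E.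
Qed.

Lemma old_gt p : (val y < b p) = (x < a p).
Proof.
have := valP y; rewrite inE => /and3P[_ _ /eqP/setP/(_ (b p)) E].
by rewrite mem_old_above inE mem_im in E.
Qed.

Lemma old_neq p : val y != b p.
Proof.
have := valP y; rewrite inE => /and3P[yb _ _]; apply: contraTneq yb => ->.
by rewrite inE negbK mem_im.
Qed.

Lemma old_ext_mono : le_mono (extend b (val y)).
Proof.
apply: extend_mono; first exact: emb_mono.
  by move=> p; rewrite -old_lt lt_neqAle eq_sym old_neq.
by move=> p; rewrite -old_gt lt_neqAle old_neq.
Qed.

Lemma id_mono : le_mono (@id P').
Proof. by []. Qed.

Lemma old_comm p : mono_embedding old_ext_mono (a p) = mono_embedding id_mono (b p).
Proof. by rewrite !mono_embeddingE extend_old. Qed.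

Lemma old_cover z : (exists y, z = mono_embedding id_mono y)
  \/ (exists y, z = mono_embedding old_ext_mono y).
Proof. by left; exists z; rewrite mono_embeddingE. Qed.

Definition old_amalgam : amalgamation a b := Amalgamation old_comm old_cover.

End OldPoint.

Section NewPoint.
Variable C : {C | C \in new_cuts}.

Lemma new_is_cut : is_cut setT (val C).1 (val C).2.
Proof. by case/andP: (valP C). Qed.

Lemma new_below p : (b p \in (val C).1) = (a p < x).
Proof.
have /and3P[_ /eqP/setP/(_ (b p)) E _] := valP C.
by rewrite mem_old_below inE mem_im andbT in E.
Qed.

Lemma new_above p : (b p \in (val C).2) = (x < a p).
Proof.
have /and3P[_ _ /eqP/setP/(_ (b p)) E] := valP C.
by rewrite mem_old_above inE mem_im andbT in E.
Qed.

Lemma new_ext_mono :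
  le_mono (extend (fun p => cut_some new_is_cut (b p)) (cut_new new_is_cut)).
Proof.
apply: extend_mono; first by move=> p q; rewrite cut_some_mono emb_mono.
  by move=> p; rewrite cut_some_le new_below.
by move=> p; rewrite cut_new_le new_above.
Qed.

Lemma new_comm p : mono_embedding new_ext_mono (a p) =
  mono_embedding (cut_some_mono new_is_cut) (b p).
Proof. by rewrite !mono_embeddingE extend_old. Qed.

Lemma new_cover z : (exists y, z = mono_embedding (cut_some_mono new_is_cut) y)
  \/ (exists y, z = mono_embedding new_ext_mono y).
Proof.
case: z => [y|]; first by left; exists y; rewrite mono_embeddingE.
by right; exists x; rewrite mono_embeddingE extend_new.
Qed.

Definition new_amalgam : amalgamation a b := Amalgamation new_comm new_cover.

End NewPoint.

Definition one_point_amalgam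
    (i : {y | y \in old_pts} + {C | C \in new_cuts}) : amalgamation a b :=
  match i with inl y => old_amalgam y | inr C => new_amalgam C end.

Lemma old_amalgam_le y z :
  (am_a (old_amalgam y) z <= am_b (old_amalgam y) x) = (z <= val y).
Proof. by rewrite /= !ffunE extend_new. Qed.

Lemma old_amalgam_ge y z :
  (am_b (old_amalgam y) x <= am_a (old_amalgam y) z) = (val y <= z).
Proof. by rewrite /= !ffunE extend_new. Qed.

Lemma new_amalgam_le C z :
  (am_a (new_amalgam C) z <= am_b (new_amalgam C) x) = (z \in (val C).1).
Proof. by rewrite /= !ffunE extend_new. Qed.

Lemma new_amalgam_ge C z :
  (am_b (new_amalgam C) x <= am_a (new_amalgam C) z) = (z \in (val C).2).
Proof. by rewrite /= !ffunE extend_new. Qed.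

(** An identified [x] is both below and above one old point, impossible for a new point because its
    lower set is strictly below its upper set. Within one kind, the comparisons with [P'] recover
    the index. *)
Lemma one_point_uniq i j :
  same_glue (one_point_amalgam i) (one_point_amalgam j) -> i = j.
Proof.
move=> ij; have h1 z := ij (inl z) (inr x); have h2 z := ij (inr x) (inl z).
case: i j {ij} h1 h2 => [y|C] [y'|C'] /= h1 h2.
- congr inl; apply/val_inj/le_anti; rewrite -old_amalgam_le -old_amalgam_ge.
  by rewrite -h1 -h2 old_amalgam_le old_amalgam_ge lexx.
- have yL : val y \in (val C').1 by rewrite -new_amalgam_le -h1 old_amalgam_le.
  have yU : val y \in (val C').2 by rewrite -new_amalgam_ge -h2 old_amalgam_ge.
  have /is_cutP[_ _ _ _ /(_ _ _ yL yU)] := new_is_cut C'.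
  by rewrite ltxx.
- have yL : val y' \in (val C).1 by rewrite -new_amalgam_le h1 old_amalgam_le.
  have yU : val y' \in (val C).2 by rewrite -new_amalgam_ge h2 old_amalgam_ge.
  have /is_cutP[_ _ _ _ /(_ _ _ yL yU)] := new_is_cut C.
  by rewrite ltxx.
- congr inr; apply: val_inj; rewrite [LHS]surjective_pairing [RHS]surjective_pairing.
  congr pair; apply/setP => z; first by have := h1 z; rewrite !new_amalgam_le.
  by have := h2 z; rewrite !new_amalgam_ge.
Qed.

Lemma one_point_exists (B : amalgamation a b) :
  exists i, same_glue B (one_point_amalgam i).
Proof.
have bx p : am_b B x != am_a B (b p).
  rewrite -am_comm (inj_eq (@emb_inj _ _ _)).
  by apply: contraNneq xa => ->; apply: mem_im.
case: (boolP (am_b B x \in im (am_a B))) => [/imP[y xy]|xB].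
  have yP : y \in old_pts.
    rewrite !inE; apply/and3P; split.
    - by apply/negP => /imP[p yp]; have := bx p; rewrite xy yp eqxx.
    - apply/eqP/old_sub; rewrite ?old_below_im //.
        by apply/subsetP => z; rewrite inE => /andP[].
      by move=> p; rewrite inE mem_im mem_old_below -(emb_lt (am_a B)) -xy -am_comm emb_lt.
    - apply/eqP/old_sub; rewrite ?old_above_im //.
        by apply/subsetP => z; rewrite inE => /andP[].
      by move=> p; rewrite inE mem_im mem_old_above -(emb_lt (am_a B)) -xy -am_comm emb_lt.
  exists (inl (exist _ y yP)); apply: one_point_same_glue => z.
    by rewrite old_amalgam_le xy emb_mono.
  by rewrite old_amalgam_ge xy emb_mono.
pose C := ([set z | am_a B z < am_b B x], [set z | am_b B x < am_a B z]).
have CP : new_cuts C.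
  apply/and3P; split.
  - apply/is_cutP; split; rewrite ?subsetT //.
    + by move=> u v _; rewrite !inE -(emb_mono (am_a B)) => vx /le_lt_trans; apply.
    + by move=> u v _; rewrite !inE -(emb_mono (am_a B)); apply: lt_le_trans.
    + move=> u v; rewrite !inE -(emb_lt (am_a B)); exact: lt_trans.
  - apply/eqP/old_sub; rewrite ?old_below_im ?subsetIr //.
    by move=> p; rewrite !inE mem_im andbT mem_old_below -am_comm emb_lt.
  - apply/eqP/old_sub; rewrite ?old_above_im ?subsetIr //.
    by move=> p; rewrite !inE mem_im andbT mem_old_above -am_comm emb_lt.
have xz z : am_b B x != am_a B z.
  by apply: contraNneq xB => ->; apply: mem_im.
exists (inr (exist _ C CP)); apply: one_point_same_glue => z.
  by rewrite new_amalgam_le inE lt_neqAle eq_sym xz.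
by rewrite new_amalgam_ge inE lt_neqAle xz.
Qed.

Variables (k : fieldType) (m : point_mass k).
Local Open Scope ring_scope.

(** The mass travels from [im a] in [Q] to [im b] in [P'] through the common source [P]. *)
Lemma one_point_nu : nu m a = pm m (im b) old_below old_above.
Proof.
rewrite (nu_step m xa xT) /mass.
have Eb : below (im a) x = a @: [set p | (a p < x)%O].
  apply/setP => q; rewrite inE; apply/andP/imsetP => [[/imP[p ->] px]|[p]].
    by exists p; rewrite ?inE.
  by rewrite inE => px ->; rewrite mem_im.
have Ea : above (im a) x = a @: [set p | (x < a p)%O].
  apply/setP => q; rewrite inE; apply/andP/imsetP => [[/imP[p ->] px]|[p]].
    by exists p; rewrite ?inE.
  by rewrite inE => px ->; rewrite mem_im.
by rewrite Eb Ea (pm_mono m (emb_mono a)) (pm_mono m (emb_mono b)).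
Qed.

Lemma new_nu C : nu m (am_a (new_amalgam C)) = pm m setT (val C).1 (val C).2.
Proof.
have E : im (am_a (new_amalgam C)) = cut_some (new_is_cut C) @: setT.
  by apply: eq_imset => y /=; rewrite ffunE.
rewrite (@nu_step _ _ _ _ _ (cut_new (new_is_cut C))) /mass ?E.
- rewrite -(pm_mono m (cut_some_mono (new_is_cut C))); congr (pm _ _ _ _).
  + apply/setP => z; rewrite inE.
    apply/andP/imsetP => [[/imsetP[y _ ->]]|[y yC ->]].
      by rewrite cut_some_lt => yC; exists y.
    by rewrite cut_some_lt imset_f.
  + apply/setP => z; rewrite inE.
    apply/andP/imsetP => [[/imsetP[y _ ->]]|[y yC ->]].
      by rewrite cut_new_lt => yC; exists y.
    by rewrite cut_new_lt imset_f.
- by apply/imsetP => -[].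
- apply/setP => -[y|]; rewrite !inE //=.
  by apply/imsetP; exists y.
Qed.

Lemma old_nu y : nu m (am_a (old_amalgam y)) = 1.
Proof. by apply: nu_iso; exists id => z; rewrite /= ffunE. Qed.

Lemma solved_one_point : solved m a b.
Proof.
exists ({y | y \in old_pts} + {C | C \in new_cuts})%type, one_point_amalgam; split.
  move=> B; have [i Bi] := one_point_exists B; exists i; split=> // j Bj.
  by apply: one_point_uniq => u v; rewrite -Bi Bj.
rewrite one_point_nu pm_refine ?old_cut // big_sumType /=; congr (_ + _).
  rewrite (eq_bigr (fun=> 1)); last by move=> y _; rewrite old_nu.
  by rewrite sumr_const card_sig.
rewrite (eq_bigr (fun C => pm m setT (val C).1 (val C).2)); last first.
  by move=> C _; rewrite new_nu.
rewrite -(big_sub new_cuts (fun C => pm m setT C.1 C.2)).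
by apply: eq_bigl => C; rewrite unfold_in.
Qed.

End OnePoint.

Section IsoAmalgam.
Variables (P Q P' : finPoset) (a : embedding P Q) (b : embedding P P').
Hypothesis aT : im a = setT.

Lemma iso_pre q : exists p, a p == q.
Proof.
have : q \in im a by rewrite aT inE.
by case/imP => p ->; exists p.
Qed.

Definition iso_inv q : P := xchoose (iso_pre q).

Lemma iso_invK q : a (iso_inv q) = q.
Proof. exact/eqP/(xchooseP (iso_pre q)). Qed.

Lemma iso_ext_mono : le_mono (fun q => b (iso_inv q)).
Proof. by move=> q r; rewrite emb_mono -(emb_mono a) !iso_invK. Qed.

Lemma iso_comm p :
  mono_embedding iso_ext_mono (a p) = mono_embedding (@id_mono P') (b p).
Proof. by rewrite !mono_embeddingE; congr (b _); apply: (@emb_inj _ _ a); rewrite iso_invK. Qed.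

Lemma iso_cover z : (exists y, z = mono_embedding (@id_mono P') y)
  \/ (exists y, z = mono_embedding iso_ext_mono y).
Proof. by left; exists z; rewrite mono_embeddingE. Qed.

Definition iso_amalgam : amalgamation a b := Amalgamation iso_comm iso_cover.

Lemma solved_iso (k : fieldType) (m : point_mass k) : solved m a b.
Proof.
exists unit, (fun=> iso_amalgam); split.
  move=> B; exists tt; split=> [|[] //] u v.
  have red w : exists y, forall C : amalgamation a b, glue C w = am_a C y.
    case: w => [y|q]; first by exists y.
    by exists (b (iso_inv q)) => C; rewrite /= -am_comm iso_invK.
  by have [y Ey] := red u; have [z Ez] := red v; rewrite !Ey !Ez !emb_mono.
rewrite (big_pred1 tt) /=; last by case.
rewrite !nu_iso //; last by exists iso_inv => p; [apply: (@emb_inj _ _ a)|]; rewrite iso_invK.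
by exists id => z; rewrite ffunE.
Qed.

End IsoAmalgam.

Section Remove.
Variables (P Q : finPoset) (a : embedding P Q) (x : Q).
Hypothesis xa : x \notin im a.

Lemma remove_in p : a p \in [set~ x].
Proof. by rewrite !inE; apply: contraNneq xa => <-; apply: mem_im. Qed.

Definition remove_fun p : sub_poset [set~ x] := sub_elt (remove_in p).

Lemma remove_mono : le_mono remove_fun.
Proof. by move=> p q; rewrite -sub_val_mono emb_mono. Qed.

Definition remove_emb := mono_embedding remove_mono.
Definition remove_incl := mono_embedding (@sub_val_mono Q [set~ x]).

Lemma remove_comp : a = comp_embedding remove_incl remove_emb.
Proof. by apply: embP => p; rewrite ffunE !mono_embeddingE. Qed.

Lemma im_sub_incl (S : {set Q}) : im (mono_embedding (@sub_val_mono Q S)) = S.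
Proof.
apply/setP => y; apply/imP/idP => [[z ->]|yS].
  by rewrite mono_embeddingE sub_valP.
by exists (sub_elt yS); rewrite mono_embeddingE.
Qed.

Lemma im_remove_incl : im remove_incl = [set~ x].
Proof. exact: im_sub_incl. Qed.

Lemma remove_card : #|~: im a| = #|~: im remove_emb|.+1.
Proof.
have -> : ~: im a = x |: [set sub_val z | z in ~: im remove_emb].
  apply/setP => y; rewrite in_setC in_setU1; have [->|yx] := eqVneq y x => //=.
  have yS : y \in [set~ x] by rewrite !inE.
  rewrite -[y]/(sub_val (sub_elt yS)) mem_imset ?in_setC; last exact: sub_val_inj.
  congr (~~ _); apply/imP/imP => -[p E]; exists p.
    by apply: sub_val_inj; rewrite mono_embeddingE.
  by rewrite E mono_embeddingE.
rewrite cardsU1 card_imset; last exact: sub_val_inj.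
have -> // : x \notin [set sub_val z | z in ~: im remove_emb].
by apply/imsetP => -[z _ E]; have := sub_valP z; rewrite -E !inE eqxx.
Qed.

End Remove.

Lemma solved_all (k : fieldType) (m : point_mass k) (P Q P' : finPoset)
  (a : embedding P Q) (b : embedding P P') : solved m a b.
Proof.
have [n] := ubnP #|~: im a|; elim: n P Q P' a b => // n IH P Q P' a b an.
case: (pickP (mem (~: im a))) => [x xa|a0]; last first.
  apply: solved_iso; apply/setP => q; have := a0 q.
  by rewrite /= !inE => /negbFE.
have {}xa : x \notin im a by move: xa; rewrite /= inE.
rewrite (remove_comp xa); apply: solved_comp.
  by apply: IH; rewrite -ltnS -remove_card.
move=> P1 b1; apply: (@solved_one_point _ _ _ _ _ x).
  by rewrite im_remove_incl !inE eqxx.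
by rewrite im_remove_incl setUCr.
Qed.

Definition measure_of_masses (k : fieldType) (m : point_mass k) : measure k :=
  Measure (@nu_iso k m) (@nu_comp k m)
    (fun P Q P' a b r A => @solved_sum k m P Q P' a b r A (solved_all m a b)).

(** * Masses with cancelling twins *)

Lemma sum_indicator (k : fieldType) (T : finType) (A : {set T}) (h : pred T) :
  (#|[set p in A | h p]|%:R = \sum_(p in A) (h p)%:R :> k)%R.
Proof.
rewrite -sum1_card natr_sum [LHS]big_mkcond [RHS]big_mkcond.
by apply: eq_bigr => p _; rewrite inE; case: (p \in A); case: (h p).
Qed.

Definition twin (P : finPoset) (S : {set P}) (p q : P) : bool :=
  (below S p == below S q) && (above S p == above S q).

Lemma twinP (P : finPoset) (S : {set P}) (p q : P) :
  reflect (forall s, s \in S -> (s < p) = (s < q) /\ (p < s) = (q < s)) (twin S p q).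
Proof.
apply: (iffP andP) => [[/eqP/setP hb /eqP/setP ha] s sS|h].
  by have := hb s; have := ha s; rewrite !inE sS.
by split; apply/eqP/setP => s; rewrite !inE; case sS: (s \in S) => //=;
  case: (h s sS).
Qed.

Lemma twin_sym (P : finPoset) (S : {set P}) (p q : P) : twin S p q = twin S q p.
Proof. by rewrite /twin eq_sym [X in _ && X]eq_sym. Qed.

Lemma twinU1 (P : finPoset) (S : {set P}) (x p q : P) : x \notin S ->
  twin (x |: S) p q = [&& twin S p q, (x < p) == (x < q) & (p < x) == (q < x)].
Proof.
move=> xS; apply/twinP/and3P => [h|[/twinP h /eqP h1 /eqP h2] s].
  have [h1 h2] := h x (setU11 _ _); rewrite h1 h2 !eqxx; split=> //.
  by apply/twinP => s sS; apply: h; rewrite inE sS orbT.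
by case/setU1P => [->|/h].
Qed.

Section TwinMass.
Variables (k : fieldType) (kap : forall P : finPoset, {set P} -> {set P} -> {set P} -> k).
Local Notation kapx S x := (kap S (below S x) (above S x)).

Hypothesis kap_mono : forall (P Q : finPoset) (f : P -> Q), le_mono f ->
  forall S L U : {set P}, kap (f @: S) (f @: L) (f @: U) = kap S L U.
Hypothesis kap_swap : forall (P : finPoset) (S : {set P}) x y,
  x \notin S -> y \notin S -> x != y ->
  (kapx S x * kapx (x |: S) y = kapx S y * kapx (y |: S) x)%R.
(** Once [S] contains a twin [p] of [x], adding [x] brings nothing new: [kap] puts no mass on points
    that separate [x] from [p]. *)
Hypothesis kap_twin : forall (P : finPoset) (S : {set P}) x y p,
  x \notin S -> y \notin S -> x != y -> p \in S -> twin S p x ->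
  kapx (x |: S) y =
    ((((p < y) == (x < y)) && ((y < p) == (y < x)))%O%:R * kapx S y)%R.
Hypothesis kap_refine : forall (P : finPoset) (S L U : {set P}), is_cut S L U ->
  (kap S L U = \sum_(C : {set P} * {set P} | is_cut setT C.1 C.2
       && ((C.1 :&: S == L) && (C.2 :&: S == U))) kap setT C.1 C.2)%R.

Definition twins (P : finPoset) (S L U : {set P}) : {set P} :=
  [set p in S | (below S p == L) && (above S p == U)].

Definition twin_pm (P : finPoset) (S L U : {set P}) : k :=
  (kap S L U - #|twins S L U|%:R)%R.

Lemma twins_mono (P Q : finPoset) (f : P -> Q) (fm : le_mono f) (S L U : {set P}) :
  twins (f @: S) (f @: L) (f @: U) = f @: twins S L U.
Proof.
have fi : injective f := inc_inj fm.
apply/setP => z; rewrite inE; apply/andP/imsetP.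
  case=> /imsetP[y yS ->]; rewrite below_mono // above_mono //.
  by rewrite !(inj_eq (imset_inj fi)) => h; exists y => //; rewrite inE yS.
case=> y; rewrite inE => /and3P[yS /eqP <- /eqP <-] ->.
by rewrite imset_f // below_mono // above_mono // !eqxx.
Qed.

Lemma twin_pm_mono (P Q : finPoset) (f : P -> Q) : le_mono f ->
  forall S L U : {set P}, twin_pm (f @: S) (f @: L) (f @: U) = twin_pm S L U.
Proof.
move=> fm S L U; rewrite /twin_pm kap_mono // twins_mono // card_imset //.
exact: inc_inj fm.
Qed.

Lemma twinsE (P : finPoset) (S : {set P}) x :
  (#|twins S (below S x) (above S x)|%:R = \sum_(p in S) (twin S p x)%:R :> k)%R.
Proof. exact: sum_indicator. Qed.

Lemma twinsU1E (P : finPoset) (S : {set P}) x y : x \notin S -> x != y ->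
  (#|twins (x |: S) (below (x |: S) y) (above (x |: S) y)|%:R
   = \sum_(p in S) (twin S p y)%:R * (((p < x)%O == (y < x)%O) && ((x < p)%O == (x < y)%O))%:R
     + [&& twin S x y, ~~ (x < y)%O & ~~ (y < x)%O]%:R :> k)%R.
Proof.
move=> xS xy; rewrite twinsE big_setU1 //= addrC; congr (_ + _)%R.
  apply: eq_bigr => p _; rewrite twinU1 // -natrM mulnb.
  by congr (nat_of_bool _)%:R%R; rewrite [X in _ && X]andbC.
by rewrite twinU1 // ltxx !(eq_sym false) !eqbF_neg.
Qed.

(** After expansion the cross terms match in pairs: twins of [x] or of [y] contribute equally to
    both sides by [kap_twin], and [e] is nonzero only if [x] and [y] have the same cut over [S]. *)
Lemma twin_pm_swap (P : finPoset) (S : {set P}) x y :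
  x \notin S -> y \notin S -> x != y ->
  (twin_pm S (below S x) (above S x) *
    twin_pm (x |: S) (below (x |: S) y) (above (x |: S) y) =
  twin_pm S (below S y) (above S y) *
    twin_pm (y |: S) (below (y |: S) x) (above (y |: S) x))%R.
Proof.
move=> xS yS xy; have yx : y != x by rewrite eq_sym.
rewrite /twin_pm (twinsU1E xS xy) (twinsU1E yS yx) !twinsE.
set e := [&& twin S x y, _ & _].
have -> : [&& twin S y x, ~~ (y < x) & ~~ (x < y)] = e.
  by rewrite /e twin_sym; congr andb; rewrite andbC.
set X := (\sum_(p in S) (twin S p x)%:R)%R.
set Y := (\sum_(p in S) (twin S p y)%:R)%R.
set X' := (X in (_ = _ * (_ - (X + _)))%R).
set Y' := (X in ((_ * (_ - (X + _)))%R = _)).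
have kX : (X * kapx (x |: S) y = X' * kapx S y)%R.
  rewrite /X /X' !mulr_suml; apply: eq_bigr => p pS.
  case tp: (twin S p x); last by rewrite !mul0r.
  by rewrite !mul1r (kap_twin xS yS xy pS tp).
have kY : (Y * kapx (y |: S) x = Y' * kapx S x)%R.
  rewrite /Y /Y' !mulr_suml; apply: eq_bigr => p pS.
  case tp: (twin S p y); last by rewrite !mul0r.
  by rewrite !mul1r (kap_twin yS xS yx pS tp).
(* For [p] a twin of [x] and [q] a twin of [y], both indicators say that [x], [y] are related as
   [p], [q] are. *)
have XY : (X * Y' = X' * Y)%R.
  rewrite /X /X' /Y /Y' !big_distrlr /=; apply: eq_bigr => p pS.
  apply: eq_bigr => q qS; case tp: (twin S p x); last by rewrite !mul0r.
  case tq: (twin S q y); last by rewrite !(mul0r, mulr0).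
  rewrite !mul1r mulr1; congr (nat_of_bool _)%:R%R.
  have [<- <-] := twinP _ _ _ tp q qS; have [<- <-] := twinP _ _ _ tq p pS.
  by rewrite andbC.
have eS : (e%:R * kapx S x = e%:R * kapx S y)%R.
  rewrite /e; case t: (twin S x y); last by rewrite !mul0r.
  by case/andP: t => /eqP -> /eqP ->.
have eXY : (e%:R * X = e%:R * Y)%R.
  rewrite /e; case t: (twin S x y); last by rewrite !mul0r.
  case/andP: t => /eqP h1 /eqP h2; congr (_ * _)%R.
  by apply: eq_bigr => p _; rewrite /twin h1 h2.
have K := kap_swap xS yS xy.
move: K kX kY XY eS eXY.
move: (kapx S x) (kapx S y) (kapx (x |: S) y) (kapx (y |: S) x) (e%:R : k)%R.
move=> kx ky kxy kyx E K kX kY XY eS eXY.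
have -> : ((kx - X) * (kxy - (Y' + E)) =
  kx * kxy - X * kxy - Y' * kx - E * kx + X * Y' + E * X)%R by ring.
have -> : ((ky - Y) * (kyx - (X' + E)) =
  ky * kyx - Y * kyx - X' * ky - E * ky + X' * Y + E * Y)%R by ring.
by rewrite K kX kY XY eS eXY; ring.
Qed.

(** Over all of [P] a point is counted at one cut only, its own, which restricts to its cut over
    [S]. Points in [S] give the twins, the others the counting term of [pm_refine]. *)
Lemma sum_twins (P : finPoset) (S L U : {set P}) :
  (\sum_(C : {set P} * {set P} | is_cut setT C.1 C.2
       && ((C.1 :&: S == L) && (C.2 :&: S == U))) #|twins setT C.1 C.2|%:R
   = #|[set y in ~: S | (below S y == L) && (above S y == U)]|%:R
     + #|twins S L U|%:R :> k)%R.
Proof.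
have bT (p : P) : below setT p :&: S = below S p.
  by apply/setP => s; rewrite !inE andbC.
have aT (p : P) : above setT p :&: S = above S p.
  by apply/setP => s; rewrite !inE andbC.
under eq_bigr => C _ do rewrite sum_indicator.
rewrite exchange_big /= /twins -natrD -cardsUI [X in (_ + X)%N](_ : _ = 0) ?addn0; last first.
  by apply/eqP; rewrite cards_eq0; apply/eqP/setP => p; rewrite !inE; case: (p \in S); rewrite ?andbF.
have -> : [set y in ~: S | (below S y == L) && (above S y == U)] :|:
    [set p in S | (below S p == L) && (above S p == U)]
    = [set p in setT | (below S p == L) && (above S p == U)].
  by apply/setP => p; rewrite !inE; case: (p \in S); rewrite ?orbF.
rewrite sum_indicator; apply: eq_bigr => p _.
rewrite (bigID (pred1 (below setT p, above setT p))) /= [X in (_ + X)%R]big1 ?addr0.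
  case h: ((below S p == L) && (above S p == U)); last first.
    rewrite big_pred0 // => C; apply: contraFF h => /andP[/and3P[_ /eqP <- /eqP <-] /eqP ->] /=.
    by rewrite bT aT !eqxx.
  rewrite (big_pred1 (below setT p, above setT p)) /= ?eqxx // => C.
  rewrite /=; case: (C =P _) => [->|]; rewrite ?andbF //= below_above_cut.
  by rewrite bT aT h.
move=> C /andP[_ Cp]; case: eqP => // h1; case: eqP => // h2.
by case/eqP: Cp; rewrite h1 h2 -surjective_pairing.
Qed.

Lemma twin_pm_refine (P : finPoset) (S L U : {set P}) : is_cut S L U ->
  (twin_pm S L U =
    #|[set y in ~: S | (below S y == L) && (above S y == U)]|%:R
    + \sum_(C : {set P} * {set P} | is_cut setT C.1 C.2
             && ((C.1 :&: S == L) && (C.2 :&: S == U)))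
        twin_pm setT C.1 C.2)%R.
Proof.
move=> cut; rewrite /twin_pm sumrB sum_twins -kap_refine //; ring.
Qed.

Definition twin_mass : point_mass k :=
  PointMass twin_pm_mono twin_pm_swap twin_pm_refine.

End TwinMass.

Section Isolated.
Variables (k : fieldType) (c : k).
Local Open Scope ring_scope.

Definition isolated_mass (P : finPoset) (S L U : {set P}) : k :=
  c * ((L == set0) && (U == set0))%:R.

Definition isolated (P : finPoset) (S : {set P}) (x : P) : bool :=
  (below S x == set0) && (above S x == set0).

Lemma isolatedP (P : finPoset) (S : {set P}) (x : P) :
  reflect {in S, forall s, ~~ (s < x)%O /\ ~~ (x < s)%O} (isolated S x).
Proof.
apply: (iffP andP) => [[/eqP/setP hb /eqP/setP ha] s sS|h].
  by have := hb s; have := ha s; rewrite !inE sS /= => -> ->.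
split; apply/eqP/setP => s; rewrite !inE; case sS: (s \in S) => //=;
  by have [/negbTE h1 /negbTE h2] := h s sS.
Qed.

Lemma isolatedU1 (P : finPoset) (S : {set P}) (x y : P) :
  isolated (x |: S) y = [&& isolated S y, ~~ (x < y)%O & ~~ (y < x)%O].
Proof.
apply/isolatedP/and3P => [h|[/isolatedP h h1 h2] s].
  have [h1 h2] := h x (setU11 _ _); split=> //.
  by apply/isolatedP => s sS; apply: h; rewrite inE sS orbT.
by case/setU1P => [->|/h].
Qed.

Lemma isolated_mass_mono (P Q : finPoset) (f : P -> Q) : le_mono f ->
  forall S L U : {set P},
  isolated_mass (f @: S) (f @: L) (f @: U) = isolated_mass S L U.
Proof. by move=> _ S L U; rewrite /isolated_mass !imset_eq0. Qed.

Lemma isolated_mass_swap (P : finPoset) (S : {set P}) x y :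
  x \notin S -> y \notin S -> x != y ->
  isolated_mass S (below S x) (above S x) *
    isolated_mass (x |: S) (below (x |: S) y) (above (x |: S) y) =
  isolated_mass S (below S y) (above S y) *
    isolated_mass (y |: S) (below (y |: S) x) (above (y |: S) x).
Proof.
move=> _ _ _; rewrite /isolated_mass -!/(isolated _ _) !isolatedU1.
rewrite !mulrA ![c * _ * c]mulrAC -!mulrA -!natrM !mulnb.
by do 2!congr (_ * _); congr (nat_of_bool _)%:R; case: isolated; case: isolated;
  case: (x < y)%O; case: (y < x)%O.
Qed.

Lemma isolated_mass_twin (P : finPoset) (S : {set P}) x y p :
  x \notin S -> y \notin S -> x != y -> p \in S -> twin S p x ->
  isolated_mass (x |: S) (below (x |: S) y) (above (x |: S) y) =
    (((p < y) == (x < y)) && ((y < p) == (y < x)))%O%:R *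
    isolated_mass S (below S y) (above S y).
Proof.
move=> _ _ _ pS _; rewrite /isolated_mass -!/(isolated _ _) isolatedU1.
case: (isolatedP S y) => [/(_ p pS) [/negbTE -> /negbTE ->]|_]; last by rewrite !mulr0.
by rewrite !(eq_sym false) !eqbF_neg mulr1 mulrC.
Qed.

Lemma isolated_mass_refine (P : finPoset) (S L U : {set P}) : is_cut S L U ->
  isolated_mass S L U = \sum_(C : {set P} * {set P} | is_cut setT C.1 C.2
       && ((C.1 :&: S == L) && (C.2 :&: S == U))) isolated_mass setT C.1 C.2.
Proof.
move=> _; rewrite (bigID (pred1 (set0, set0))) /= [X in _ + X]big1 ?addr0; last first.
  move=> [A B] /andP[_]; rewrite /isolated_mass /= xpair_eqE => /negbTE ->.
  by rewrite mulr0.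
have cut0 : is_cut (setT : {set P}) set0 set0.
  by apply/is_cutP; split; rewrite ?sub0set // => a b; rewrite !inE.
case: (boolP ((set0 == L) && (set0 == U))) => h.
  rewrite (big_pred1 (set0, set0)).
    by rewrite /isolated_mass /= !eqxx !(eq_sym _ set0) h.
  move=> [A B] /=; rewrite xpair_eqE /=; case: (A =P set0) => [->|]; rewrite ?andbF //.
  by case: (B =P set0) => [->|]; rewrite ?andbF // cut0 !set0I h.
rewrite big_pred0; first by rewrite /isolated_mass !(eq_sym _ set0) (negbTE h) mulr0.
move=> [A B] /=; rewrite xpair_eqE; case: (A =P set0) => [->|]; rewrite ?andbF //.
by case: (B =P set0) => [->|]; rewrite ?andbF // !set0I (negbTE h) andbF.
Qed.

Definition antichain_mass : point_mass k :=
  twin_mass isolated_mass_mono isolated_mass_swap isolated_mass_twin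
    isolated_mass_refine.

End Isolated.

(** * Inclusion-exclusion sums over sets between two bounds *)

Section AlternatingSum.
Variables (k : fieldType) (T : finType).
Implicit Types (S L A : {set T}) (g : {set T} -> k).
Local Open Scope ring_scope.

(** If [g A] measures the objects related to all of [A], this is the measure of those related, among
    the points of [S], to exactly [L]. *)
Definition alt S L g : k :=
  \sum_(A : {set T} | (L \subset A) && (A \subset S)) (-1) ^+ #|A :\: L| * g A.

Lemma eq_alt S L g h :
  (forall A, L \subset A -> A \subset S -> g A = h A) -> alt S L g = alt S L h.
Proof. by move=> gh; apply: eq_bigr => A /andP[LA AS]; rewrite gh. Qed.

Lemma altB S L g h : alt S L (fun A => g A - h A) = alt S L g - alt S L h.
Proof. by rewrite -sumrB; apply: eq_bigr => A _; rewrite mulrBr. Qed.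

Lemma altZ S L c g : alt S L (fun A => c * g A) = c * alt S L g.
Proof. by rewrite mulr_sumr; apply: eq_bigr => A _; rewrite mulrCA. Qed.

Lemma alt0 S L g :
  (forall A, L \subset A -> A \subset S -> g A = 0) -> alt S L g = 0.
Proof. by move=> g0; apply: big1 => A /andP[LA AS]; rewrite g0 ?mulr0. Qed.

Lemma alt_exchange S L S' L' (f : {set T} -> {set T} -> k) :
  alt S L (fun A => alt S' L' (fun B => f A B)) =
  alt S' L' (fun B => alt S L (fun A => f A B)).
Proof.
rewrite /alt; under eq_bigr => A _ do rewrite mulr_sumr.
rewrite exchange_big /=; apply: eq_bigr => B _; rewrite mulr_sumr.
by apply: eq_bigr => A _; rewrite mulrCA.
Qed.

Lemma alt_shrink S S' L g : L \subset S' -> S' \subset S ->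
  (forall A, L \subset A -> A \subset S -> ~~ (A \subset S') -> g A = 0) ->
  alt S L g = alt S' L g.
Proof.
move=> LS' S'S g0; rewrite /alt (bigID (fun A : {set T} => A \subset S')) /=.
rewrite [X in _ + X]big1 ?addr0.
  apply: eq_bigl => A; case LA: (L \subset A) => //=.
  case AS': (A \subset S'); rewrite ?andbF // (subset_trans _ S'S) //.
by move=> A /andP[/andP[LA AS] AS']; rewrite g0 ?mulr0.
Qed.

Lemma alt_self L g : alt L L g = g L.
Proof.
rewrite /alt (big_pred1 L) => [|A]; first by rewrite setDv cards0 mul1r.
by rewrite /pred1 /= eqEsubset andbC.
Qed.

Lemma sum_setU1 (x : T) (Q : pred {set T}) (F : {set T} -> k) :
  \sum_(A | Q A && (x \in A)) F A = \sum_(A | Q (x |: A) && (x \notin A)) F (x |: A).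
Proof.
rewrite (reindex_onto (fun A => x |: A) (fun A => A :\ x)) /=; last first.
  by move=> A /andP[_ xA]; rewrite setD1K.
apply: eq_bigl => A; rewrite setU11 andbT; congr andb.
by apply/eqP/idP => [<-|/setU1K //]; rewrite !inE eqxx.
Qed.

Lemma sum_toggle0 (x : T) (Q : pred {set T}) (F : {set T} -> k) :
  (forall A, x \notin A -> Q (x |: A) = Q A) ->
  (forall A, x \notin A -> Q A -> F (x |: A) = - F A) ->
  \sum_(A | Q A) F A = 0.
Proof.
move=> hQ hF; rewrite (bigID (fun A : {set T} => x \in A)) /= sum_setU1.
apply/eqP; rewrite addr_eq0 -sumrN; apply/eqP/eq_big => [A|A /andP[QA xA]].
  by case xA: (x \in A); rewrite ?andbF //= hQ ?xA.
by rewrite hF // -hQ.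
Qed.

Lemma sign_setU1 (x : T) (A L : {set T}) : x \notin A -> x \notin L ->
  (-1) ^+ #|(x |: A) :\: L| = - (-1) ^+ #|A :\: L| :> k.
Proof.
move=> xA xL; rewrite setDUl (setDidPl _) ?disjoints1 // cardsU1 inE (negbTE xA).
by rewrite andbF exprS mulN1r.
Qed.

Lemma subset_setU1r (x : T) (A B : {set T}) :
  x \notin A -> (A \subset x |: B) = (A \subset B).
Proof.
by move=> xA; rewrite -subDset (setDidPl _) // disjoint_sym disjoints1.
Qed.

Lemma alt_toggle S L x g : x \in S -> x \notin L ->
  (forall A, L \subset A -> A \subset S -> x \notin A -> g (x |: A) = g A) ->
  alt S L g = 0.
Proof.
move=> xS xL gx; apply: (@sum_toggle0 x) => [A xA|A xA /andP[LA AS]].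
  by rewrite subUset sub1set xS /= subset_setU1r.
by rewrite gx // sign_setU1 // mulNr.
Qed.

Lemma alt_addl S L x g : x \notin S -> L \subset S ->
  alt (x |: S) (x |: L) g = alt S L (fun A => g (x |: A)).
Proof.
move=> xS LS; have xL : x \notin L by apply: contraNN xS; apply: (subsetP LS).
have -> : alt (x |: S) (x |: L) g =
    \sum_(A : {set T} | ((x |: L \subset A) && (A \subset x |: S)) && (x \in A))
      (-1) ^+ #|A :\: (x |: L)| * g A.
  apply: eq_bigl => A; rewrite subUset sub1set.
  by case: (x \in A); rewrite ?andbT ?andbF.
rewrite sum_setU1; apply: eq_big => [A|A /andP[_ xA]].
  rewrite !subUset !sub1set !setU11 /= subset_setU1r //.
  case xA: (x \in A); rewrite /= ?andbT ?andbF ?subset_setU1r ?xA //.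
  by apply/esym/negbTE; apply: contra xS => /andP[_ /subsetP]; apply.
congr ((-1) ^+ #|pred_of_set _| * _); apply/setP => z; rewrite !inE.
by case: (z =P x) => //= ->; rewrite (negbTE xA) andbF.
Qed.

Lemma alt_addr S L x g : x \notin S -> L \subset S ->
  alt (x |: S) L g = alt S L g - alt S L (fun A => g (x |: A)).
Proof.
move=> xS LS; have xL : x \notin L by apply: contraNN xS; apply: (subsetP LS).
rewrite {1}/alt (bigID (fun A : {set T} => x \in A)) /= sum_setU1 addrC.
congr (_ + _).
  apply: eq_bigl => A; case xA: (x \in A); rewrite /= ?andbF ?andbT ?subset_setU1r ?xA //.
  by apply/esym/negbTE; apply: contra xS => /andP[_ /subsetP]; apply.
rewrite -sumrN; apply: eq_big => [A|A /andP[_ xA]].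
  rewrite subset_setU1r // subUset sub1set setU11 /=.
  case xA: (x \in A); rewrite /= ?andbF ?andbT ?subset_setU1r ?xA //.
  by apply/esym/negbTE; apply: contra xS => /andP[_ /subsetP]; apply.
by rewrite sign_setU1 // mulNr.
Qed.

(** Forgetting the points outside [S]: if [A] contains such a point [z], toggling [z] in [L'] flips
    the sign and the terms cancel; for [A] inside [S] only [L' = L] occurs. *)
Lemma sum_alt S L g : L \subset S ->
  \sum_(L' : {set T} | L' :&: S == L) alt setT L' g = alt S L g.
Proof.
move=> LS; rewrite /alt (exchange_big_dep xpredT) /=; last by [].
rewrite (bigID (fun A : {set T} => A \subset S)) /= [X in _ + X]big1 ?addr0; last first.
  move=> A /subsetPn[z zA zS]; rewrite -mulr_suml (@sum_toggle0 z) ?mul0r //.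
    move=> L' zL'; rewrite subUset sub1set zA /= setIUl.
    by rewrite (_ : [set z] :&: S = set0) ?set0U //; apply/disjoint_setI0; rewrite disjoints1.
  move=> L' zL' _; have -> : #|A :\: L'| = #|A :\: (z |: L')|.+1.
    rewrite (cardsD1 z (A :\: L')) inE zL' zA /=; congr (_.+1); apply: eq_card => y.
    by rewrite !inE negb_or andbA.
  by rewrite exprS mulN1r opprK.
rewrite [RHS]big_mkcond [LHS]big_mkcond; apply: eq_bigr => A _.
case AS: (A \subset S); rewrite ?andbF ?andbT //.
have E L' : (L' :&: S == L) && ((L' \subset A) && (A \subset setT)) = (L' == L) && (L \subset A).
  rewrite subsetT andbT; apply/andP/andP => [[/eqP E L'A]|[/eqP -> LA]].
    have L'L : L' = L by rewrite -E; apply/esym/setIidPl/(subset_trans L'A).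
    by rewrite -L'L.
  by rewrite LA; split=> //; apply/eqP/setIidPl.
case LA: (L \subset A); last by rewrite big_pred0 // => L'; rewrite E LA andbF.
by rewrite (big_pred1 L) // => L'; rewrite E LA andbT.
Qed.

End AlternatingSum.

Lemma alt_imset (k : fieldType) (T T' : finType) (f : T -> T') (fi : injective f)
  (S L : {set T}) (g : {set T'} -> k) :
  alt (f @: S) (f @: L) g = alt S L (fun A => g (f @: A)).
Proof.
rewrite /alt (reindex_onto (fun A : {set T} => f @: A) (fun A => f @^-1: A)) /=.
  apply: eq_big => [A|A _].
    have sub (B C : {set T}) : (f @: B \subset f @: C) = (B \subset C).
      apply/idP/idP => [/subsetP h|]; last exact: imsetS.
      by apply/subsetP => z zB; rewrite -(mem_imset _ _ fi) h ?imset_f.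
    rewrite !sub andb_idr // => _.
    by apply/eqP/setP => z; rewrite inE mem_imset.
  have -> : #|(f @: A) :\: (f @: L)| = #|f @: (A :\: L)|.
    apply: eq_card => z; rewrite inE; apply/andP/imsetP => [[zL /imsetP[a aA za]]|[a]].
      by exists a => //; rewrite inE aA andbT; apply: contraNN zL; rewrite za; apply: imset_f.
    by rewrite inE => /andP[aL aA] ->; rewrite mem_imset // imset_f.
  by rewrite card_imset.
move=> A /andP[_ AS]; apply/setP => z; apply/imsetP/idP => [[a + ->]|zA].
  by rewrite inE.
have /imsetP[a _ za] := subsetP AS z zA.
by exists a; rewrite // inE -za.
Qed.

(** * The interval functional behind weak orders *)

Section Kappa.
Variable P : finPoset.
Implicit Types (S A B L U : {set P}) (x y : P).

Definition lts A B : bool := [forall a in A, forall b in B, a < b].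

Lemma ltsP A B : reflect {in A & B, forall a b, a < b} (lts A B).
Proof.
apply: (iffP forall_inP) => [h a b aA bB|h a aA].
  by have /forall_inP := h a aA; apply.
by apply/forall_inP => b bB; apply: h.
Qed.

Lemma lts_setU1l S x A B : B \subset S ->
  lts (x |: A) B = lts A B && (B \subset above S x).
Proof.
move=> /subsetP BS; apply/ltsP/andP => [h|[/ltsP h /subsetP BU] a b].
  split; first by apply/ltsP => a b aA; apply: h; rewrite inE aA orbT.
  by apply/subsetP => b bB; rewrite inE BS // h // setU11.
by case/setU1P => [-> /BU|]; [rewrite inE => /andP[]|apply: h].
Qed.

Lemma lts_setU1r S x A B : A \subset S ->
  lts A (x |: B) = lts A B && (A \subset below S x).
Proof.
move=> /subsetP AS; apply/ltsP/andP => [h|[/ltsP h /subsetP AL] a b aA].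
  split; first by apply/ltsP => a b aA bB; apply: h; rewrite // inE bB orbT.
  by apply/subsetP => a aA; rewrite inE AS // h // setU11.
by case/setU1P => [->|/h -> //]; move/AL: aA; rewrite inE => /andP[].
Qed.

Lemma belowU1 S x y : below (x |: S) y = if x < y then x |: below S y else below S y.
Proof.
apply/setP => z; case: ifP => xy; rewrite !inE;
  by case: (z =P x) => [->|] //=; rewrite xy ?andbF.
Qed.

Lemma aboveU1 S x y : above (x |: S) y = if y < x then x |: above S y else above S y.
Proof.
apply/setP => z; case: ifP => xy; rewrite !inE;
  by case: (z =P x) => [->|] //=; rewrite xy ?andbF.
Qed.

Lemma below_sub S x : below S x \subset S.
Proof. by apply/subsetP => z; rewrite inE => /andP[]. Qed.

Lemma above_sub S x : above S x \subset S.
Proof. by apply/subsetP => z; rewrite inE => /andP[]. Qed.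

Variable k : fieldType.
Local Open Scope ring_scope.

(* Inclusion-exclusion for the functional giving every nonempty interval
   {x | A < x < B} the value 1, evaluated at the points having exactly [L]
   below and [U] above. *)
Definition kappa S L U : k :=
  alt S L (fun A => alt S U (fun B => (lts A B)%:R)).

(** The share of [kappa] lying above [x]: for [B] inside [S] the extra condition amounts to
    enlarging [A] by [x]. Dually for [kappa_dn]. *)
Definition kappa_up S x L U : k :=
  alt S L (fun A => alt S U (fun B => (lts A B && (B \subset above S x))%:R)).

Definition kappa_dn S x L U : k :=
  alt S L (fun A => alt S U (fun B => (lts A B && (A \subset below S x))%:R)).

Local Notation kapx S x := (kappa S (below S x) (above S x)).

(** No interval has [x] on both sides, so a new point is above [x], below [x], or in the complement
    of these two cases. *)
Lemma kappaU1 S x y : x \notin S ->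
  kapx (x |: S) y =
    if (x < y)%O then kappa_up S x (below S y) (above S y)
    else if (y < x)%O then kappa_dn S x (below S y) (above S y)
    else kapx S y - kappa_up S x (below S y) (above S y)
                  - kappa_dn S x (below S y) (above S y).
Proof.
move=> xS; have bS := below_sub S y; have aS := above_sub S y.
have xx A B : lts (x |: A) (x |: B) = false.
  by apply/negbTE/ltsP => /(_ x x (setU11 _ _) (setU11 _ _)); rewrite ltxx.
rewrite /kappa belowU1 aboveU1; case: ifP => xy; [rewrite lt_gtF //|case: ifP => yx].
- rewrite alt_addl //; apply: eq_alt => A LA AS; rewrite alt_addr //.
  rewrite [X in _ - X]alt0 ?subr0; last by move=> B _ _; rewrite xx.
  by apply: eq_alt => B _ BS; rewrite (lts_setU1l _ _ BS).
- rewrite alt_addr // [X in _ - X]alt0 ?subr0; last first.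
    by move=> A _ _; rewrite alt_addl // alt0 // => B _ _; rewrite xx.
  apply: eq_alt => A LA AS; rewrite alt_addl //.
  by apply: eq_alt => B _ BS; rewrite (lts_setU1r _ _ AS).
- rewrite alt_addr // [RHS]addrAC; congr (_ - _).
    rewrite /kappa_dn -altB; apply: eq_alt => A LA AS.
    rewrite alt_addr //; congr (_ - _).
    by apply: eq_alt => B _ BS; rewrite (lts_setU1r _ _ AS).
  apply: eq_alt => A LA AS; rewrite alt_addr //.
  rewrite [X in _ - X]alt0 ?subr0; last by move=> B _ _; rewrite xx.
  by apply: eq_alt => B _ BS; rewrite (lts_setU1l _ _ BS).
Qed.

(* The two-point analogue of [kappa] when [x < y] is imposed: it is symmetric
   in the order in which the two points are added. *)
Definition kappa2 S x y : k :=
  alt S (below S x) (fun A1 => alt S (above S x) (fun B1 =>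
  alt S (below S y) (fun A2 => alt S (above S y) (fun B2 =>
    [&& lts A1 B1, lts A2 B2 & lts A1 B2]%:R)))).

Lemma lts_setU A B C : lts A (B :|: C) = lts A B && lts A C.
Proof.
apply/ltsP/andP => [h|[/ltsP hB /ltsP hC] a b aA].
  by split; apply/ltsP => a b aA bB; apply: h; rewrite // inE bB ?orbT.
by case/setUP => [/(hB _ _ aA)|/(hC _ _ aA)].
Qed.

Lemma lts_setUl A B C : lts (A :|: C) B = lts A B && lts C B.
Proof.
apply/ltsP/andP => [h|[/ltsP hB /ltsP hC] a b].
  by split; apply/ltsP => a b aA bB; apply: h; rewrite // inE aA ?orbT.
by case/setUP => [/hB|/hC]; apply.
Qed.

(* Imposing [x < D] on the inclusion-exclusion sum either changes nothing or,
   when some [d] in [D] is not above [x], makes toggling [d] sign-reversing. *)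
Lemma kappa_force_up S x (D : {set P}) : D \subset S ->
  alt S (below S x) (fun A => alt S (above S x) (fun B => (lts A B && lts A D)%:R)) =
  (D \subset above S x)%:R * kapx S x.
Proof.
move=> DS; case: (boolP (D \subset _)) => [DU|/subsetPn[d dD dU]].
  rewrite mul1r; apply: eq_alt => A _ _; apply: eq_alt => B UB _.
  by rewrite -lts_setU (setUidPl (subset_trans DU UB)).
rewrite mul0r; apply: alt0 => A _ _; apply: (alt_toggle (x := d)) => //.
  exact: (subsetP DS).
move=> B _ _ dB; rewrite -!lts_setU; congr (lts _ _)%:R.
by apply/setP => z; rewrite !inE; case: eqP => [->|]; rewrite ?dD ?orbT.
Qed.

Lemma kappa_force_dn S x (D : {set P}) : D \subset S ->
  alt S (below S x) (fun A => alt S (above S x) (fun B => (lts A B && lts D B)%:R)) =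
  (D \subset below S x)%:R * kapx S x.
Proof.
move=> DS; case: (boolP (D \subset _)) => [DL|/subsetPn[d dD dL]].
  rewrite mul1r; apply: eq_alt => A LA _; apply: eq_alt => B _ _.
  by rewrite -lts_setUl (setUidPl (subset_trans DL LA)).
rewrite mul0r; apply: (alt_toggle (x := d)) => //.
  exact: (subsetP DS).
move=> A _ _ dA; apply: eq_alt => B _ _; rewrite -!lts_setUl; congr (lts _ _)%:R.
by apply/setP => z; rewrite !inE; case: eqP => [->|]; rewrite ?dD ?orbT.
Qed.

(** By [kappa_force_up] the condition [B2 \subset above S x], multiplied by the factor for [x],
    becomes [lts A1 B2] inside the sum for [x]; this form does not depend on which point was added
    first. *)
Lemma kappa2_up S x y :
  kapx S x * kappa_up S x (below S y) (above S y) = kappa2 S x y.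
Proof.
rewrite /kappa_up -altZ.
transitivity (alt S (below S y) (fun A2 => alt S (above S y) (fun B2 =>
  alt S (below S x) (fun A1 => alt S (above S x) (fun B1 =>
    [&& lts A1 B1, lts A2 B2 & lts A1 B2]%:R : k))))).
  apply: eq_alt => A2 _ _; rewrite -altZ; apply: eq_alt => B2 _ B2S.
  have -> : kapx S x * (lts A2 B2 && (B2 \subset above S x))%:R =
      (lts A2 B2)%:R * ((B2 \subset above S x)%:R * kapx S x).
    by rewrite -mulnb natrM mulrC -mulrA.
  rewrite -kappa_force_up // -altZ; apply: eq_alt => A1 _ _.
  by rewrite -altZ; apply: eq_alt => B1 _ _; rewrite -natrM mulnb andbCA.
rewrite /kappa2.
under eq_alt => A2 _ _ do rewrite alt_exchange.
rewrite alt_exchange; apply: eq_alt => A1 _ _.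
under eq_alt => A2 _ _ do rewrite alt_exchange.
by rewrite alt_exchange.
Qed.

Lemma kappa2_dn S x y :
  kapx S y * kappa_dn S y (below S x) (above S x) = kappa2 S x y.
Proof.
rewrite /kappa_dn -altZ; apply: eq_alt => A1 _ A1S; rewrite -altZ.
apply: eq_alt => B1 _ _.
have -> : kapx S y * (lts A1 B1 && (A1 \subset below S y))%:R =
    (lts A1 B1)%:R * ((A1 \subset below S y)%:R * kapx S y).
  by rewrite -mulnb natrM mulrC -mulrA.
rewrite -kappa_force_dn // -altZ; apply: eq_alt => A2 _ _.
by rewrite -altZ; apply: eq_alt => B2 _ _; rewrite -natrM mulnb.
Qed.

Lemma kappa_swap S x y : x \notin S -> y \notin S -> x != y ->
  kapx S x * kapx (x |: S) y = kapx S y * kapx (y |: S) x.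
Proof.
move=> xS yS _; rewrite !kappaU1 //.
case xy: (x < y)%O; case yx: (y < x)%O.
- by have := lt_trans xy yx; rewrite ltxx.
- by rewrite kappa2_up kappa2_dn.
- by rewrite kappa2_up kappa2_dn.
- rewrite !mulrBr !kappa2_up !kappa2_dn; ring.
Qed.

(** Within [S], lying above [x] means lying above [p], so the condition on [B] is the same as adding
    [p] to [A]. This is automatic if [p < y]; otherwise toggling [p] gives 0. *)
Lemma kappa_up_twin S x y p : p \in S -> twin S p x ->
  kappa_up S x (below S y) (above S y) = (p < y)%O%:R * kapx S y.
Proof.
move=> pS /andP[_ /eqP E]; have pL : (p \in below S y) = (p < y)%O by rewrite inE pS.
have key A B : B \subset S -> lts (p |: A) B = lts A B && (B \subset above S x).
  by move=> BS; rewrite (lts_setU1l _ _ BS) E.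
rewrite /kappa_up; case py: (p < y)%O.
  rewrite mul1r; apply: eq_alt => A LA AS; apply: eq_alt => B UB BS.
  rewrite -key // (setUidPr _) // sub1set.
  by apply: (subsetP LA); rewrite pL.
rewrite mul0r; apply: (alt_toggle (x := p)) => //; first by rewrite pL py.
move=> A LA AS _; apply: eq_alt => B UB BS; rewrite -!key //.
by rewrite setUA setUid.
Qed.

Lemma kappa_dn_twin S x y p : p \in S -> twin S p x ->
  kappa_dn S x (below S y) (above S y) = (y < p)%O%:R * kapx S y.
Proof.
move=> pS /andP[/eqP E _]; have pU : (p \in above S y) = (y < p)%O by rewrite inE pS.
have key A B : A \subset S -> lts A (p |: B) = lts A B && (A \subset below S x).
  by move=> AS; rewrite (lts_setU1r _ _ AS) E.
rewrite /kappa_dn; case py: (y < p)%O.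
  rewrite mul1r; apply: eq_alt => A LA AS; apply: eq_alt => B UB BS.
  rewrite -key // (setUidPr _) // sub1set.
  by apply: (subsetP UB); rewrite pU.
rewrite mul0r; apply: alt0 => A LA AS; apply: (alt_toggle (x := p)) => //.
  by rewrite pU py.
by move=> B UB BS _; rewrite -!key // setUA setUid.
Qed.

Lemma kappa_twin S x y p :
  x \notin S -> y \notin S -> x != y -> p \in S -> twin S p x ->
  kapx (x |: S) y =
    (((p < y) == (x < y)) && ((y < p) == (y < x)))%O%:R * kapx S y.
Proof.
move=> xS _ _ pS tw; rewrite kappaU1 // (kappa_up_twin _ pS tw) (kappa_dn_twin _ pS tw).
have xor (u v : P) : ~ ((u < v)%O /\ (v < u)%O).
  by case=> uv vu; have := lt_trans uv vu; rewrite ltxx.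
case xy: (x < y)%O; case yx: (y < x)%O; case py: (p < y)%O; case yp: (y < p)%O;
  rewrite /= ?mul1r ?mul0r ?subr0 ?subrr //;
  first [by case: (xor x y) | by case: (xor p y)].
Qed.

(** If [L < U] fails, every term is 0. A point that closure would force into [L] or [U] can be
    toggled without changing any interval. *)
Lemma kappa_noncut S L U : ~~ is_cut S L U -> L \subset S -> U \subset S ->
  kappa S L U = 0.
Proof.
move=> ncut LS US; case: (boolP (lts L U)) => [/ltsP LU|nLU]; last first.
  apply: alt0 => A LA _; apply: alt0 => B UB _; case: ltsP => // AB.
  case/negP: nLU; apply/ltsP => a b aL bU; apply: AB; [exact: (subsetP LA)|exact: (subsetP UB)].
case: (boolP [exists a in S, exists b in L, (a <= b)%O && (a \notin L)]) => [|dL].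
  case/exists_inP => a aS /exists_inP[b bL /andP[ab aL]].
  apply: (alt_toggle (x := a)) => // A LA AS _; apply: eq_alt => B _ _.
  congr (_%:R); congr (nat_of_bool _); apply/ltsP/ltsP => h u v uA vB.
    by apply: h; rewrite // inE uA orbT.
  case/setU1P: uA => [->|uA]; last exact: h.
  by apply: (le_lt_trans ab); apply: h => //; apply: (subsetP LA).
case: (boolP [exists a in S, exists b in U, (b <= a)%O && (a \notin U)]) => [|uU].
  case/exists_inP => a aS /exists_inP[b bU /andP[ba aU]].
  apply: alt0 => A _ _; apply: (alt_toggle (x := a)) => // B UB BS _.
  congr (_%:R); congr (nat_of_bool _); apply/ltsP/ltsP => h u v uA vB.
    by apply: h; rewrite // inE vB orbT.
  case/setU1P: vB => [->|vB]; last exact: h.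
  by apply: lt_le_trans ba; apply: h => //; apply: (subsetP UB).
case/negP: ncut; apply/is_cutP; split=> //.
- move=> a b aS bL ab; apply: contraNT dL => aL.
  by apply/exists_inP; exists a => //; apply/exists_inP; exists b; rewrite ?ab.
- move=> a b aS bU ba; apply: contraNT uU => aU.
  by apply/exists_inP; exists a => //; apply/exists_inP; exists b; rewrite ?ba.
Qed.

Lemma kappa_refine S L U : is_cut S L U ->
  kappa S L U = \sum_(C : {set P} * {set P} | is_cut setT C.1 C.2
       && ((C.1 :&: S == L) && (C.2 :&: S == U))) kappa setT C.1 C.2.
Proof.
move=> /is_cutP[LS US _ _ _].
(* Pairs that are not cuts have value 0; including them lets the two coordinates be summed
   independently. *)
transitivity (\sum_(C : {set P} * {set P} | (C.1 :&: S == L) && (C.2 :&: S == U))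
    kappa setT C.1 C.2); last first.
  rewrite (bigID (fun C : {set P} * {set P} => is_cut setT C.1 C.2)) /= addrC big1 ?add0r.
    by apply: eq_bigl => C; rewrite andbC.
  by move=> C /andP[_ nc]; rewrite kappa_noncut ?subsetT.
rewrite -(pair_big (fun L' => L' :&: S == L) (fun U' => U' :&: S == U)
  (fun L' U' => kappa setT L' U')) /=.
under eq_bigr => L' _.
  rewrite /kappa; under eq_bigr => U' _ do rewrite alt_exchange.
  rewrite (sum_alt (fun B => alt setT L' (fun A => (lts A B)%:R)) US) alt_exchange.
  over.
by rewrite (sum_alt (fun A => alt S U (fun B => (lts A B)%:R)) LS).
Qed.

End Kappa.

Section WeakMass.
Variables (k : fieldType) (c : k).
Local Open Scope ring_scope.

Definition scaled_kappa (P : finPoset) (S L U : {set P}) : k := c * kappa k S L U.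

Lemma scaled_kappa_mono (P Q : finPoset) (f : P -> Q) : le_mono f ->
  forall S L U : {set P},
  scaled_kappa (f @: S) (f @: L) (f @: U) = scaled_kappa S L U.
Proof.
move=> fm S L U; have fi : injective f := inc_inj fm.
have flt : {mono f : x y / (x < y)%O} := leW_mono fm.
congr (_ * _); rewrite /kappa alt_imset //; apply: eq_alt => A _ _.
rewrite alt_imset //; apply: eq_alt => B _ _; congr (_%:R); congr (nat_of_bool _).
apply/ltsP/ltsP => h a b; first by move=> aA bB; rewrite -flt; apply: h; apply: imset_f.
by case/imsetP => u uA -> /imsetP[v vB ->]; rewrite flt; apply: h.
Qed.

Lemma scaled_kappa_swap (P : finPoset) (S : {set P}) x y :
  x \notin S -> y \notin S -> x != y ->
  scaled_kappa S (below S x) (above S x) *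
    scaled_kappa (x |: S) (below (x |: S) y) (above (x |: S) y) =
  scaled_kappa S (below S y) (above S y) *
    scaled_kappa (y |: S) (below (y |: S) x) (above (y |: S) x).
Proof.
move=> xS yS xy; rewrite /scaled_kappa mulrACA kappa_swap // mulrACA.
by rewrite mulrACA.
Qed.

Lemma scaled_kappa_twin (P : finPoset) (S : {set P}) x y p :
  x \notin S -> y \notin S -> x != y -> p \in S -> twin S p x ->
  scaled_kappa (x |: S) (below (x |: S) y) (above (x |: S) y) =
    (((p < y) == (x < y)) && ((y < p) == (y < x)))%O%:R *
    scaled_kappa S (below S y) (above S y).
Proof.
by move=> xS yS xy pS tw; rewrite /scaled_kappa (kappa_twin _ xS yS xy pS tw) mulrCA.
Qed.

Lemma scaled_kappa_refine (P : finPoset) (S L U : {set P}) : is_cut S L U ->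
  scaled_kappa S L U = \sum_(C : {set P} * {set P} | is_cut setT C.1 C.2
       && ((C.1 :&: S == L) && (C.2 :&: S == U))) scaled_kappa setT C.1 C.2.
Proof. by move=> cut; rewrite /scaled_kappa kappa_refine // mulr_sumr. Qed.

Definition weak_mass : point_mass k :=
  twin_mass scaled_kappa_mono scaled_kappa_swap scaled_kappa_twin
    scaled_kappa_refine.

End WeakMass.

(** * Masses for disjoint unions of chains *)

Section ChainMass.
Variables (k : fieldType) (t : k).

Section Formula.
Variable P : finPoset.
Implicit Types (S L U : {set P}) (x y p q : P).

Definition just_above S p y : bool :=
  (p |: below S p == below S y) && (above S p == above S y).

Lemma just_aboveP S p y : p \in S -> y \notin S ->
  reflect (forall s, s \in S -> (s < y) = (s <= p) /\ (y < s) = (p < s))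
    (just_above S p y).
Proof.
move=> pS yS; apply: (iffP andP) => [[/eqP/setP hb /eqP/setP ha] s sS|h].
  have := hb s; have := ha s; rewrite !inE sS /= => -> <-.
  by rewrite le_eqVlt.
split; apply/eqP/setP => s; rewrite !inE.
  case sS: (s \in S) => /=; last by rewrite orbF; apply: contraFF sS => /eqP ->.
  by have [-> _] := h s sS; rewrite le_eqVlt.
by case sS: (s \in S) => //=; have [_ ->] := h s sS.
Qed.

Definition has_base S L U : bool :=
  [exists p in S, (p |: below S p == L) && (above S p == U)].

Definition bottom_mass S U : k :=
  (\sum_(q in S) ((above S q == U)%:R - (q |: above S q == U)%:R) - t * (U == set0)%:R)%R.

(** The case split suits the swap identity, as a nonempty lower set carries only 0 or -1; refinement
    uses the uniform sum over formal points in [chain_pmE]. *)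
Definition chain_pm S L U : k :=
  if L == set0 then bottom_mass S U else (- (has_base S L U)%:R)%R.

Definition based S y : bool := [exists p in S, just_above S p y].

(** Let [p] be the base of [x]. If [y] is based on [x], both points can be based on [p] in the other
    order. If [y] is based on [p] as well, it lies below [x] and becomes the base of [x]. Otherwise
    the bases do not interact. *)
Lemma basedU1_swap S x y : x \notin S -> y \notin S -> x != y ->
  based S x && based (x |: S) y -> based S y && based (y |: S) x.
Proof.
move=> xS yS xy /andP[/exists_inP[p pS /(just_aboveP pS xS) hp]].
have yxS : y \notin x |: S by rewrite !inE eq_sym negb_or xy.
have xyS : x \notin y |: S by rewrite !inE negb_or xy.
have neq u v : u \in S -> v \notin S -> (u == v) = false.
  by move=> uS vS; apply: contraNF vS => /eqP <-.
case/exists_inP => q qxS /(just_aboveP qxS yxS) hq.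
have hq' s : s \in S -> (s < y) = (s <= q) /\ (y < s) = (q < s).
  by move=> sS; apply: hq (setU1r _ sS).
have [hxy hyx] := hq x (setU11 _ _).
case/setU1P: qxS hq hq' hxy hyx => [->|qS] hq hq' hxy hyx.
  apply/andP; split; apply/exists_inP.
    exists p => //; apply/just_aboveP => // s sS.
    have [-> ->] := hq' s sS; have [<- <-] := hp s sS.
    by rewrite le_eqVlt neq.
  exists p; first by rewrite inE pS orbT.
  apply/just_aboveP; rewrite // ?inE ?pS ?orbT // => s /setU1P[->|/hp //].
  have [e1 e2] := hq' p pS; have [e3 e4] := hp p pS.
  have px : p < x by rewrite e3.
  have py : p < y by rewrite e1 ltW.
  by rewrite hyx hxy lexx ltxx py (lt_geF py).
case: (eqVneq q p) => [qp|qp]; apply/andP; split; apply/exists_inP.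
- by exists q => //; apply/just_aboveP.
- exists y; first exact: setU11.
  apply/just_aboveP; rewrite // ?setU11 // => s /setU1P[->|sS].
    by rewrite hyx hxy qp lexx ltxx le_eqVlt eq_sym neq //; have [-> ->] := hp p pS; rewrite lexx ltxx.
  have [-> ->] := hp s sS; have [e1 ->] := hq' s sS.
  by rewrite [s <= y]le_eqVlt neq //= e1 qp.
- by exists q => //; apply/just_aboveP.
- exists p; first by rewrite inE pS orbT.
  apply/just_aboveP; rewrite // ?inE ?pS ?orbT // => s /setU1P[->|/hp //].
  have [e1 e2] := hq' p pS; have [e3 e4] := hp q qS.
  rewrite hyx hxy e1 e3 ![_ <= _]le_eqVlt e2 e4 (negbTE qp) [p == q]eq_sym (negbTE qp).
  by rewrite [x == q]eq_sym [y == p]eq_sym !neq.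
Qed.

Lemma chain_pm_based S y : below S y != set0 ->
  chain_pm S (below S y) (above S y) = (- (based S y)%:R)%R.
Proof. by rewrite /chain_pm => /negbTE ->. Qed.

Lemma chain_pm_bottom S y : below S y == set0 ->
  chain_pm S (below S y) (above S y) = bottom_mass S (above S y).
Proof. by rewrite /chain_pm => ->. Qed.

Lemma setU1_eq (y : P) (A B : {set P}) : y \notin A -> y \notin B ->
  (y |: A == y |: B) = (A == B).
Proof.
move=> yA yB; apply/eqP/eqP => [/setP E|-> //]; apply/setP => z.
have := E z; rewrite !inE; case: (z =P y) => //= -> _.
by rewrite (negbTE yA) (negbTE yB).
Qed.

Lemma mem_set_neq (y : P) (A B : {set P}) : y \in A -> y \notin B -> (A == B) = false.
Proof. by move=> yA yB; apply: contraNF yB => /eqP <-. Qed.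

Lemma mem_set_neq' (y : P) (A B : {set P}) : y \notin A -> y \in B -> (A == B) = false.
Proof. by move=> yA yB; rewrite eq_sym (mem_set_neq yB yA). Qed.

Lemma notin_above S y : y \notin S -> forall x, y \notin above S x.
Proof. by move=> yS x; rewrite inE (negbTE yS). Qed.

Lemma below0 S x : below S x == set0 -> {in S, forall s, (s < x) = false}.
Proof. by move=> /eqP/setP h s sS; have := h s; rewrite !inE sS. Qed.

Lemma bottom_massU1 S y V : y \notin S ->
  bottom_mass (y |: S) V =
    (((above S y == V)%:R - (y |: above S y == V)%:R)
     + (\sum_(q in S) ((above (y |: S) q == V)%:R - (q |: above (y |: S) q == V)%:R))
     - t * (V == set0)%:R)%R.
Proof. by move=> yS; rewrite /bottom_mass big_setU1 //= aboveU1 ltxx. Qed.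

Lemma based_bottom S x y : x \notin S -> y \notin S -> x != y -> x < y ->
  below S x == set0 -> below S y == set0 ->
  based (x |: S) y = (above S x == above S y).
Proof.
move=> xS yS nxy xy bx by0.
have yxS : y \notin x |: S by rewrite !inE eq_sym negb_or nxy.
rewrite /based; apply/exists_inP/eqP => [[q qxS /(just_aboveP qxS yxS) hq]|/setP E].
  case/setU1P: qxS hq => [-> hq|qS hq].
    apply/setP => s; rewrite !inE; case sS: (s \in S) => //=.
    by have [_ ->] := hq s (setU1r _ sS).
  have [+ _] := hq q (setU1r _ qS).
  by rewrite (below0 by0) // lexx.
exists x; first exact: setU11.
apply/just_aboveP; rewrite ?setU11 // => s /setU1P[->|sS].
  by rewrite xy lexx ltxx (lt_gtF xy).
have := E s; rewrite !inE sS /= => ->; split=> //.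
rewrite (below0 by0) // le_eqVlt (below0 bx) // orbF.
by apply/esym; apply: contraNF xS => /eqP <-.
Qed.

(** The upper set of [x] now contains [y]. Since nothing in [S] is below [y], the only formal
    minimal point under [y] is the negative one just below [y]. *)
Lemma bottom_mass_below S x y : x \notin S -> y \notin S -> x < y ->
  below S x == set0 -> below S y == set0 ->
  chain_pm (y |: S) (below (y |: S) x) (above (y |: S) x) =
    (- (above S x == above S y)%:R)%R.
Proof.
move=> xS yS xy bx by0.
have E : below (y |: S) x = below S x by rewrite belowU1 lt_gtF.
rewrite chain_pm_bottom ?E // aboveU1 xy bottom_massU1 //.
have yU z : y \notin above S z by apply: notin_above.
rewrite (mem_set_neq' (yU y)) ?setU11 // setU1_eq // big1 => [|q qS]; last first.
  rewrite aboveU1 (below0 by0) // (mem_set_neq' (yU q)) ?setU11 //.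
  rewrite (mem_set_neq' (y := y)) ?setU11 ?subrr // !inE negb_or.
  by rewrite (negbTE yS) andbT; apply: contraNneq yS => ->.
rewrite (mem_set_neq (setU11 _ _) (negbT (in_set0 y))) !mulr0n mulr0 subr0 addr0.
by rewrite sub0r eq_sym.
Qed.

(** Of the formal minimal points around [x], the one below [x] cannot share the cut of [y]; the
    positive one does so when the upper sets agree. *)
Lemma bottom_mass_incomparable S x y : x \notin S -> y \notin S ->
  ~~ (x < y) -> ~~ (y < x) -> below S x == set0 -> below S y == set0 ->
  chain_pm (x |: S) (below (x |: S) y) (above (x |: S) y) =
    (bottom_mass S (above S y) + (above S x == above S y)%:R)%R.
Proof.
move=> xS yS /negbTE xy /negbTE yx bx by0.
have E : below (x |: S) y = below S y by rewrite belowU1 xy.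
rewrite chain_pm_bottom ?E // aboveU1 yx bottom_massU1 //.
rewrite (mem_set_neq (y := x) (setU11 _ _)) ?notin_above // subr0.
rewrite /bottom_mass -addrA [RHS]addrC; congr (_ + (_ - _))%R.
by apply: eq_bigr => q qS; rewrite aboveU1 (below0 bx).
Qed.

Lemma basedU1_bottom S x y p : x \notin S -> y \notin S -> x != y ->
  below S x == set0 -> p \in S -> just_above S p y ->
  based (x |: S) y = ((x < y) == (x < p)).
Proof.
move=> xS yS nxy bx pS jp; have hp := just_aboveP pS yS jp.
have yxS : y \notin x |: S by rewrite !inE eq_sym negb_or nxy.
have py : p < y by have [-> _] := hp p pS.
have px : (p < x) = false by apply: (below0 bx).
have yx : (y < x) = false by apply/negbTE/negP => /(lt_trans py); rewrite px.
rewrite /based; apply/exists_inP/eqP => [[q qxS /(just_aboveP qxS yxS) hq]|E].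
  case/setU1P: qxS hq => [-> hq|qS hq].
    have [+ _] := hq p (setU1r _ pS).
    rewrite py le_eqVlt px orbF => /esym/eqP E.
    by move: xS; rewrite -E pS.
  have hq' s : s \in S -> (s < y) = (s <= q) /\ (y < s) = (q < s).
    by move=> sS; apply: hq (setU1r _ sS).
  have -> : p = q.
    apply/le_anti; have [<- _] := hq' p pS; have [<- _] := hp q qS.
    by rewrite py; have [-> _] := hq' q qS; rewrite lexx.
  have [-> _] := hq x (setU11 _ _); rewrite le_eqVlt.
  by case: eqP => // E; move: xS; rewrite E qS.
exists p; first by rewrite inE pS orbT.
apply/just_aboveP; rewrite // ?inE ?pS ?orbT // => s /setU1P[->|/hp //].
rewrite E yx px le_eqVlt; split=> //.
by case: eqP => // xp; move: xS; rewrite xp pS.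
Qed.

(** With [y] inserted just above [p], the negative minimal point of [y] and the positive one of [p]
    fall on the same cut and cancel. The two survivors take over the roles of the points of [p]. *)
Lemma bottom_mass_based S x y p : x \notin S -> y \notin S -> x != y ->
  below S x == set0 -> p \in S -> just_above S p y ->
  chain_pm (y |: S) (below (y |: S) x) (above (y |: S) x) =
    (((x < y)%O == (x < p)%O)%:R * bottom_mass S (above S x))%R.
Proof.
move=> xS yS nxy bx pS jp; have hp := just_aboveP pS yS jp.
have py : p < y by have [-> _] := hp p pS.
have px : (p < x) = false by apply: (below0 bx).
have yx : (y < x) = false by apply/negbTE/negP => /(lt_trans py); rewrite px.
have E : below (y |: S) x = below S x by rewrite belowU1 yx.
have aE : above S y = above S p by case/andP: jp => _ /eqP.
have yU z : y \notin above S z by apply: notin_above.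
have yq q : q \in S -> y != q by move=> qS; apply: contraNneq yS => ->.
have hq q : q \in S :\ p -> [/\ q \in S, (q < y) = (q < p),
     (p \in above S q) = (q < p), (p \in q |: above S q) = (q < p)
     & y \notin q |: above S q].
  rewrite !inE negb_or => /andP[qp qS]; have [-> _] := hp q qS.
  by rewrite le_eqVlt (negbTE qp) pS eq_sym (negbTE qp) yq // (negbTE yS).
have pV : (p \in above S x) = (x < p) by rewrite inE pS.
have pp : p \notin above S p by rewrite inE ltxx andbF.
have ypU : y \notin p |: above S p by rewrite !inE negb_or yq // (negbTE yS).
have y0 : y \notin set0 by rewrite inE.
have p0 : p \notin set0 by rewrite inE.
rewrite chain_pm_bottom ?E // bottom_massU1 // /bottom_mass !(big_setD1 p pS) /=.
rewrite aE [above _ x]aboveU1 [above (_ |: _) p]aboveU1 py [p |: (y |: _)]setUCA.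
(* If [x < y] without [x < p], the upper set contains [y] but not [p], and no mass is left; [x < p]
   without [x < y] is impossible. *)
case xy: (x < y); case xp: (x < p); rewrite /= ?mul1r ?mul0r.
- have pU : p \in above S x by rewrite pV.
  rewrite (mem_set_neq' (yU p) (setU11 _ _)) !setU1_eq //.
  rewrite (mem_set_neq (setU11 _ _) y0) (mem_set_neq' pp pU) (mem_set_neq pU p0).
  rewrite [X in (_ + (_ + X) - _)%R](_ : _ = \sum_(q in S :\ p)
      ((above S q == above S x)%:R - (q |: above S q == above S x)%:R))%R.
    by rewrite !mulr0n; ring.
  apply: eq_bigr => q /hq[qS qy pa pqa yqa]; rewrite aboveU1 qy; case: ifP => qp.
    by rewrite [q |: (y |: _)]setUCA !setU1_eq.
  rewrite (mem_set_neq' (yU q) (setU11 _ _)) (mem_set_neq' yqa (setU11 _ _)).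
  by rewrite (mem_set_neq' _ pU) ?pa ?qp // (mem_set_neq' _ pU) ?pqa ?qp.
- have pU : p \notin above S x by rewrite pV xp.
  have pyU : p \notin y |: above S x by rewrite in_setU1 negb_or eq_sym yq.
  rewrite (mem_set_neq' (yU p) (setU11 _ _)) (mem_set_neq (setU11 _ _) y0).
  rewrite setUCA [X in (_ + (_ + X) - _)%R]big1.
    by rewrite (mem_set_neq (setU11 _ _) pyU) !mulr0n; ring.
  move=> q /hq[qS qy pa pqa yqa]; rewrite aboveU1 qy; case: ifP => qp.
    have pqy (A : {set P}) : p \in A -> (y |: A == y |: above S x) = false.
      by move=> pA; apply: mem_set_neq pyU; rewrite inE pA orbT.
    by rewrite [q |: (y |: _)]setUCA !pqy ?pa ?pqa // subrr.
  by rewrite (mem_set_neq' (yU q) (setU11 _ _)) (mem_set_neq' yqa (setU11 _ _)) subrr.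
- by have := lt_trans xp py; rewrite xy.
- have pU : p \notin above S x by rewrite pV xp.
  rewrite (mem_set_neq (setU11 y _) (yU x)) (mem_set_neq (setU11 y _) (yU x)).
  rewrite [_ |: _ == above S x](mem_set_neq (setU11 _ _) pU).
  rewrite [X in (_ + (_ + X) - _)%R](_ : _ = \sum_(q in S :\ p)
      ((above S q == above S x)%:R - (q |: above S q == above S x)%:R))%R.
    by rewrite !mulr0n; ring.
  apply: eq_bigr => q /hq[qS qy pa pqa yqa]; rewrite aboveU1 qy; case: ifP => qp //.
  rewrite [q |: (y |: _)]setUCA !(mem_set_neq (setU11 y _) (yU x)).
  by rewrite !(mem_set_neq (y := p) _ pU) ?pa ?pqa ?qp.
Qed.

Lemma belowU1_neq0 S x y : below S y != set0 -> below (x |: S) y != set0.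
Proof.
case/set0Pn => s; rewrite inE => /andP[sS sy]; apply/set0Pn; exists s.
by rewrite !inE sS sy orbT.
Qed.

(** For two minimal points the corrections occur only when the upper sets agree, and then so do the
    masses over [S]. For a minimal and a based point, both products carry the factor asking that the
    minimal point relate equally to the based point and to its base. *)
Lemma chain_pm_swap S x y : x \notin S -> y \notin S -> x != y ->
  (chain_pm S (below S x) (above S x) *
    chain_pm (x |: S) (below (x |: S) y) (above (x |: S) y) =
  chain_pm S (below S y) (above S y) *
    chain_pm (y |: S) (below (y |: S) x) (above (y |: S) x))%R.
Proof.
have mixed u v : u \notin S -> v \notin S -> u != v ->
    below S u == set0 -> below S v != set0 ->
    (chain_pm S (below S u) (above S u) *
      chain_pm (u |: S) (below (u |: S) v) (above (u |: S) v) =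
    chain_pm S (below S v) (above S v) *
      chain_pm (v |: S) (below (v |: S) u) (above (v |: S) u))%R.
  move=> uS vS uv u0 v0; rewrite (chain_pm_based v0) (chain_pm_based (belowU1_neq0 _ v0)).
  rewrite (chain_pm_bottom u0); case: (boolP (based S v)) => [/exists_inP[p pS jp]|nv].
    rewrite (bottom_mass_based uS vS uv u0 pS jp).
    by rewrite (basedU1_bottom uS vS uv u0 pS jp) mulr1n; ring.
  have /negbTE -> : ~~ based (u |: S) v; last by rewrite !mulr0n; ring.
  apply: contra nv => /exists_inP[q quS].
  have vuS : v \notin u |: S by rewrite in_setU1 negb_or eq_sym uv.
  move/(just_aboveP quS vuS) => hq; case/setU1P: quS hq => [-> hq|qS hq].
    case/set0Pn: v0 => s; rewrite inE => /andP[sS sv].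
    have [+ _] := hq s (setU1r _ sS); rewrite sv le_eqVlt (below0 u0) // orbF.
    by move=> /esym/eqP E; move: uS; rewrite -E sS.
  apply/exists_inP; exists q => //; apply/just_aboveP => // s sS.
  exact: hq (setU1r _ sS).
have below_case u v : u \notin S -> v \notin S -> u != v -> u < v ->
    below S u == set0 -> below S v == set0 ->
    (chain_pm S (below S u) (above S u) *
      chain_pm (u |: S) (below (u |: S) v) (above (u |: S) v) =
    chain_pm S (below S v) (above S v) *
      chain_pm (v |: S) (below (v |: S) u) (above (v |: S) u))%R.
  move=> uS vS nuv uv u0 v0; rewrite (bottom_mass_below uS vS uv u0 v0).
  have nv0 : below (u |: S) v != set0.
    by apply/set0Pn; exists u; rewrite !inE eqxx uv.
  rewrite (chain_pm_based nv0) (based_bottom uS vS nuv uv u0 v0).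
  rewrite !chain_pm_bottom //; case: eqP => [-> //|_]; by rewrite !mulr0n; ring.
move=> xS yS xy; have yx : y != x by rewrite eq_sym.
case: (boolP (below S x == set0)) => x0; case: (boolP (below S y == set0)) => y0.
- case: (boolP (x < y)) => lxy; first exact: below_case.
  case: (boolP (y < x)) => lyx; first by apply/esym/below_case.
  rewrite !bottom_mass_incomparable // !chain_pm_bottom //.
  by rewrite [above S y == _]eq_sym; case: eqP => [->|_]; rewrite ?mulr0n; ring.
- exact: mixed.
- by apply/esym/mixed.
- rewrite !chain_pm_based // ?belowU1_neq0 // !mulrNN -!natrM !mulnb.
  by congr (nat_of_bool _)%:R%R; apply/idP/idP; apply: basedU1_swap.
Qed.

(** Used to write the existence of a base as a sum: a base of [L] is its largest element, hence
    unique. *)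
Lemma sum_unique (S : {set P}) (h : pred P) :
  (forall p q, p \in S -> q \in S -> h p -> h q -> p = q) ->
  (\sum_(q in S) (h q)%:R = [exists q in S, h q]%:R :> k)%R.
Proof.
move=> hu; case: exists_inP => [[p pS hp]|nh].
  rewrite (big_setD1 p) //= hp big1 ?addr0 // => q /setD1P[qp qS].
  by case hq: (h q) => //; case/eqP: qp; apply: hu.
by apply: big1 => q qS; case hq: (h q) => //; case: nh; exists q.
Qed.

(* The formal points around [q], written as cuts: a minimal point below all
   strict upper bounds of [q] (positive), a minimal point just below [q] and a
   point just above [q] (both negative). *)
Lemma chain_pmE S L U : chain_pm S L U =
  (\sum_(q in S) (((set0, above S q) == (L, U))%:R
     - ((set0, q |: above S q) == (L, U))%:R
     - ((q |: below S q, above S q) == (L, U))%:R)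
   - t * ((set0, set0) == (L, U))%:R)%R.
Proof.
rewrite /chain_pm; case: ifP => [/eqP ->|L0].
  rewrite xpair_eqE eqxx [set0 == U]eq_sym; congr (_ - _)%R; apply: eq_bigr => q _.
  rewrite !xpair_eqE eqxx /= (mem_set_neq (setU11 _ _) (negbT (in_set0 q))).
  by rewrite mulr0n subr0.
rewrite xpair_eqE eq_sym L0 mulr0 subr0 /has_base -sum_unique.
  rewrite -sumrN; apply: eq_bigr => q _.
  by rewrite !xpair_eqE !(eq_sym set0) L0 !mulr0n subr0 sub0r.
move=> p q pS qS /andP[/eqP <- _] /andP[/eqP E _].
have : p \in q |: below S q by rewrite E setU11.
have : q \in p |: below S p by rewrite -E setU11.
rewrite !in_setU1 !inE pS qS /= -!le_eqVlt => qp pq.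
by apply/le_anti; rewrite pq qp.
Qed.

Lemma cut_up1 (q : P) : is_cut setT (q |: below setT q) (above setT q).
Proof.
apply/is_cutP; split; rewrite ?subsetT // => a b.
- rewrite !inE /= -!le_eqVlt => _ bq ab; exact: le_trans bq.
- by rewrite !inE /= => _ qb /(lt_le_trans qb).
- by rewrite !inE /= -!le_eqVlt => /le_lt_trans; apply.
Qed.

Lemma cut_lo1 (q : P) : is_cut setT set0 (q |: above setT q).
Proof.
apply/is_cutP; split; rewrite ?subsetT // => a b; rewrite !inE //=.
by rewrite ![_ == q]eq_sym -!le_eqVlt => _ qb /(le_trans qb).
Qed.

Lemma cut_lo0 (q : P) : is_cut setT set0 (above setT q).
Proof.
apply/is_cutP; split; rewrite ?subsetT // => a b; rewrite !inE //=.
by move=> _ qb /(lt_le_trans qb).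
Qed.

Lemma cut_00 : is_cut (setT : {set P}) set0 set0.
Proof. by apply/is_cutP; split; rewrite ?sub0set // => a b; rewrite !inE. Qed.

Lemma sum_cut_indicator S L U (C0 : {set P} * {set P}) :
  is_cut setT C0.1 C0.2 ->
  (\sum_(C : {set P} * {set P} | is_cut setT C.1 C.2
      && ((C.1 :&: S == L) && (C.2 :&: S == U))) (C0 == (C.1, C.2))%:R
   = ((C0.1 :&: S, C0.2 :&: S) == (L, U))%:R :> k)%R.
Proof.
move=> cut; rewrite xpair_eqE; under eq_bigr => C _ do rewrite -surjective_pairing.
case h: (_ && _).
  rewrite (bigD1 C0) /= ?cut // eqxx big1 ?addr0 // => C /andP[_].
  by rewrite eq_sym => /negbTE ->.
apply: big1 => C /andP[_ hC]; case: eqP => // E; move: hC.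
by rewrite -E h.
Qed.

(** For [q] in [S] the formal points restrict to those over [S]. For [q] outside, the two minimal
    ones restrict to one cut and cancel, while the point just above [q] restricts to the cut of [q]
    and cancels its unit in the counting term. *)
Lemma chain_pm_refine S L U : is_cut S L U ->
  (chain_pm S L U =
    #|[set y in ~: S | (below S y == L) && (above S y == U)]|%:R
    + \sum_(C : {set P} * {set P} | is_cut setT C.1 C.2
             && ((C.1 :&: S == L) && (C.2 :&: S == U)))
        chain_pm setT C.1 C.2)%R.
Proof.
move=> _; under eq_bigr => C _ do rewrite chain_pmE.
rewrite sumrB exchange_big /= -mulr_sumr (@sum_cut_indicator S L U (set0, set0) cut_00) /= !set0I.
under eq_bigr => q _.
  rewrite !sumrB (@sum_cut_indicator S L U (set0, above setT q) (cut_lo0 q)) /=.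
  rewrite (@sum_cut_indicator S L U (set0, q |: above setT q) (cut_lo1 q)).
  rewrite (@sum_cut_indicator S L U (q |: below setT q, above setT q) (cut_up1 q)) /=.
  rewrite set0I !setIUl.
  over.
have bT (q : P) : below setT q :&: S = below S q.
  by apply/setP => s; rewrite !inE andbC.
have aT (q : P) : above setT q :&: S = above S q.
  by apply/setP => s; rewrite !inE andbC.
rewrite chain_pmE addrA; congr (_ - _)%R.
rewrite [X in (_ + X)%R](bigID (mem S)) /= addrCA sum_indicator.
rewrite -[LHS]addr0; congr (_ + _)%R.
  apply: eq_big => [q|q qS]; first by rewrite inE.
  have qE : [set q] :&: S = [set q] by apply/setIidPl; rewrite sub1set.
  by rewrite bT aT qE.
rewrite [X in (_ + X)%R](eq_bigl (mem (~: S))); last by move=> q; rewrite !inE.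
rewrite -big_split big1 //= => q; rewrite inE => qS.
have qE : [set q] :&: S = set0.
  by apply/disjoint_setI0; rewrite disjoints1.
by rewrite qE !set0U bT aT xpair_eqE; ring.
Qed.

End Formula.

Lemma chain_pm_mono (P Q : finPoset) (f : P -> Q) : le_mono f ->
  forall S L U : {set P}, chain_pm (f @: S) (f @: L) (f @: U) = chain_pm S L U.
Proof.
move=> fm S L U; have fi : injective f := inc_inj fm; have sfi := imset_inj fi.
rewrite !chain_pmE big_imset /=; last by move=> p q _ _; apply: fi.
rewrite -(imset0 f) !xpair_eqE !(inj_eq sfi); congr (_ - _)%R.
apply: eq_bigr => q _; rewrite below_mono // above_mono // -!imsetU1.
by rewrite !xpair_eqE !(inj_eq sfi).
Qed.

Definition chain_mass : point_mass k :=
  PointMass chain_pm_mono chain_pm_swap chain_pm_refine.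

End ChainMass.

(** * Supports *)

Definition no_V (P : finPoset) := forall a b c : P, a < b -> a < c -> b >< c -> False.
Definition no_Lambda (P : finPoset) := forall a b c : P, b < a -> c < a -> b >< c -> False.
Definition no_21 (P : finPoset) := forall a b c : P, a < b -> c >< a -> c >< b -> False.

Definition antichain (P : finPoset) (S : {set P}) : Prop :=
  {in S &, forall x y, ~~ (x < y)}.

(** The size bound as it arises from the masses: building an antichain point by point produces the
    factors [t - j] up to sign. *)
Definition antichains_avoid (k : fieldType) (t : k) (P : finPoset) : Prop :=
  forall S : {set P}, antichain S -> forall j, (j < #|S|)%N -> t <> (j%:R)%R.

Lemma incompP (P : finPoset) (x y : P) : x != y -> ~~ (x < y) -> ~~ (y < x) -> x >< y.
Proof. by case: comparableP. Qed.

Lemma incomp_neq (P : finPoset) (x y : P) : x >< y -> (x == y) = false.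
Proof. by apply: contraNF => /eqP ->; rewrite comparablexx. Qed.

Lemma incomp_lt (P : finPoset) (x y : P) : x >< y -> ~~ (x < y) /\ ~~ (y < x).
Proof. by case: comparableP. Qed.

Lemma incomp_le (P : finPoset) (x y : P) : x >< y ->
  (x <= y) = false /\ (y <= x) = false.
Proof. by case: comparableP. Qed.

Lemma ex_maximal (P : finPoset) (A : {set P}) : A != set0 ->
  exists2 p, p \in A & {in A, forall s, ~~ (p < s)}.
Proof.
case/set0Pn => p0 p0A.
case: (@arg_maxnP _ p0 (mem A) (fun p => #|[set z | z <= p]|) p0A) => p pA hp.
exists p => // s sA; apply/negP => ps; move: (hp s sA); apply/negP; rewrite -ltnNge.
apply: proper_card; apply/properP; split.
  by apply/subsetP => z; rewrite !inE => /le_trans; apply; apply: ltW.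
by exists s; rewrite !inE ?lexx //; rewrite lt_geF.
Qed.

Lemma ex_minimal (P : finPoset) (A : {set P}) : A != set0 ->
  exists2 p, p \in A & {in A, forall s, ~~ (s < p)}.
Proof.
case/set0Pn => p0 p0A.
case: (@arg_maxnP _ p0 (mem A) (fun p => #|[set z | p <= z]|) p0A) => p pA hp.
exists p => // s sA; apply/negP => ps; move: (hp s sA); apply/negP; rewrite -ltnNge.
apply: proper_card; apply/properP; split.
  by apply/subsetP => z; rewrite !inE; apply: le_trans; apply: ltW.
by exists s; rewrite !inE ?lexx //; rewrite lt_geF.
Qed.

Lemma subset_of_card (T : finType) (S : {set T}) j : (j < #|S|)%N ->
  exists (S0 : {set T}) x, [/\ S0 \subset S, x \in S, x \notin S0 & #|S0| = j].
Proof.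
elim: j => [|j IH] h.
  have /set0Pn[x xS] : S != set0 by rewrite -card_gt0.
  by exists set0, x; rewrite sub0set inE cards0.
have [S0 [x [S0S xS xS0 c]]] := IH (ltnW h).
have c1 : #|x |: S0| = j.+1 by rewrite cardsU1 xS0 c.
have S1S : x |: S0 \subset S by rewrite subUset sub1set xS.
have /subsetPn[y yS yS1] : ~~ (S \subset x |: S0).
  by apply/negP => /subset_leq_card; rewrite c1 leqNgt h.
by exists (x |: S0), y.
Qed.

Lemma antichain_sub (P : finPoset) (S S' : {set P}) :
  S' \subset S -> antichain S -> antichain S'.
Proof. by move=> /subsetP s a x y /s xS /s yS; apply: a. Qed.

Lemma antichain_isolated (P : finPoset) (S S0 : {set P}) x :
  antichain S -> S0 \subset S -> x \in S -> isolated S0 x.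
Proof.
move=> a /subsetP s xS; apply/isolatedP => y /s yS; by rewrite !a.
Qed.

Lemma isolated0 (P : finPoset) (S : {set P}) x :
  isolated S x -> below S x = set0 /\ above S x = set0.
Proof. by case/andP => /eqP -> /eqP ->. Qed.

Lemma empty_nu_antichain (k : fieldType) (m : point_mass k) (t : k) (P : finPoset) :
  (forall (S : {set P}) x, antichain (x |: S) -> x \notin S -> t = (#|S|%:R)%R ->
     mass m S x = 0%R) ->
  nu m (empty_embedding P) <> 0%R -> antichains_avoid t P.
Proof.
move=> h nz S aS j /subset_of_card[S0 [x [S0S xS xS0 cj]]] tj; apply: nz.
apply: empty_nu_eq0 xS0 (h _ _ _ xS0 _); last by rewrite cj.
by apply: antichain_sub aS; rewrite subUset sub1set xS.
Qed.

Section AntichainSupport.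
Variables (k : fieldType) (t : k).
Local Open Scope ring_scope.

Lemma antichain_twins (P : finPoset) (S : {set P}) x :
  antichain (x |: S) -> twins S (below S x) (above S x) = S.
Proof.
move=> a; apply/setP => p; rewrite inE andb_idr // => pS; apply/twinP => s sS.
by rewrite !(negbTE (a _ _ _ _)) // !inE ?sS ?pS ?eqxx ?orbT.
Qed.

Lemma antichain_mass_val (P : finPoset) (S : {set P}) x :
  antichain (x |: S) -> mass (antichain_mass t) S x = t - #|S|%:R.
Proof.
move=> a; rewrite /mass /= /twin_pm antichain_twins // /isolated_mass.
by rewrite -/(isolated S x) (antichain_isolated a (subsetUr _ _) (setU11 _ _)) mulr1.
Qed.

Lemma antichain_support (P : finPoset) :
  measure_support (measure_of_masses (antichain_mass t)) P <->
  antichain (setT : {set P}) /\ antichains_avoid t P.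
Proof.
split=> [nz|[aP av]].
  split; last first.
    apply: empty_nu_antichain nz => S x a xS tS.
    by rewrite antichain_mass_val // tS subrr.
  (* Over [[set x]] the point [y] is not isolated and [x] is not its twin, so its mass is 0. *)
  move=> x y _ _; apply/negP => xy; apply: nz.
  have yx : y \notin [set x] by rewrite inE eq_sym lt_eqF.
  apply: (empty_nu_eq0 yx); rewrite /mass /= /twin_pm /isolated_mass.
  have -> : below [set x] y = [set x].
    by apply/setP => z; rewrite !inE andb_idr // => /eqP ->.
  rewrite (_ : ([set x] == set0) = false) ?mulr0 ?sub0r; last first.
    by apply/negbTE/set0Pn; exists x; rewrite inE.
  rewrite (_ : twins _ _ _ = set0) ?cards0 ?oppr0 //.
  apply/setP => p; rewrite !inE; apply/negbTE/negP => /and3P[/eqP -> /eqP/setP/(_ x)].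
  by rewrite !inE eqxx ltxx.
apply/eqP; apply: empty_nu_neq0 => S x xS.
have a : antichain (x |: S) := antichain_sub (subsetT _) aP.
rewrite antichain_mass_val // subr_eq0; apply/eqP; apply: av a _ _.
by rewrite cardsU1 xS.
Qed.

End AntichainSupport.

Section WeakSupport.
Variables (k : fieldType) (t : k).
Local Open Scope ring_scope.

(** [lts A B] makes [A] and [B] disjoint, so only [A = L], [B = U] survives. *)
Lemma kappa_total (P : finPoset) (S L U : {set P}) :
  S = L :|: U -> lts L U -> kappa k S L U = 1.
Proof.
move=> -> LU; have irr (A B : {set P}) (x : P) : x \in A -> x \in B -> lts A B = false.
  by move=> xA xB; apply/negbTE/ltsP => /(_ x x xA xB); rewrite ltxx.
rewrite /kappa (alt_shrink (S' := L)) ?subsetUl // => [|A LA AS /subsetPn[x xA xL]].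
  rewrite alt_self (alt_shrink (S' := U)) ?subsetUr // ?alt_self ?LU // => B UB BS.
  case/subsetPn => x xB xU; rewrite (irr _ _ x) //.
  by have := subsetP BS x xB; rewrite inE (negbTE xU) orbF.
apply: alt0 => B UB BS; rewrite (irr _ _ x) //; apply: (subsetP UB).
by have := subsetP AS x xA; rewrite inE (negbTE xL).
Qed.

(** The surviving pairs are [L :|: A'] and [U :|: B'] with [A'], [B'] inside [T] and one of them
    empty, because [T] is an antichain. Each of the two families sums to 0, and the pair common to
    both was counted twice: 0 + 0 - 1. *)
Lemma kappa_gap (P : finPoset) (S L U T : {set P}) :
  S = L :|: U :|: T -> [disjoint L & T] -> [disjoint U & T] -> T != set0 -> antichain T ->
  lts L U -> lts L T -> lts T U -> kappa k S L U = -1.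
Proof.
move=> -> dLT dUT /set0Pn[z zT] aT LU LT TU.
have irr (A B : {set P}) (x : P) : x \in A -> x \in B -> lts A B = false.
  by move=> xA xB; apply/negbTE/ltsP => /(_ x x xA xB); rewrite ltxx.
have zL : z \notin L by rewrite (disjointFl dLT).
have zU : z \notin U by rewrite (disjointFl dUT).
have LTs : L :|: T \subset L :|: U :|: T by apply: setSU; apply: subsetUl.
have UTs : U :|: T \subset L :|: U :|: T by apply: setSU; apply: subsetUr.
rewrite /kappa (alt_shrink (S' := L :|: T)) ?subsetUl //; last first.
  move=> A LA AS /subsetPn[x xA]; rewrite inE => /norP[xL xT].
  apply: alt0 => B UB BS; rewrite (irr _ _ x) //; apply: (subsetP UB).
  by have := subsetP AS x xA; rewrite !inE (negbTE xL) (negbTE xT) orbF.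
rewrite (eq_alt (h := fun A : {set P} => 1 - (A == L)%:R)); last first.
  move=> A LA AS; case: eqP => [->|AL].
    rewrite subrr (alt_shrink (S' := U :|: T)) ?subsetUl //; last first.
      move=> B UB BS /subsetPn[x xB]; rewrite inE => /norP[xU xT].
      rewrite (irr _ _ x) //.
      by have := subsetP BS x xB; rewrite !inE (negbTE xU) (negbTE xT) !orbF.
    apply: (alt_toggle (x := z)); rewrite // ?inE ?zT ?orbT // => B UB BS zB.
    have LUT : lts L (U :|: T) by rewrite lts_setU LU.
    have lB (B' : {set P}) : B' \subset U :|: T -> lts L B'.
      move=> /subsetP s; apply/ltsP => a b aL /s bUT; exact: (ltsP _ _ LUT).
    by rewrite !lB // subUset sub1set BS !inE zT orbT.
  have [x xA xT] : exists2 x, x \in A & x \in T.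
    have /subsetPn[x xA xL] : ~~ (A \subset L).
      by apply/negP => AL'; apply: AL; apply/eqP; rewrite eqEsubset AL'.
    by exists x => //; have := subsetP AS x xA; rewrite inE (negbTE xL).
  rewrite subr0 (alt_shrink (S' := U)) ?alt_self //.
  - have -> // : lts A U; apply/ltsP => a b aA bU.
    by have /setUP[aL|aT'] := subsetP AS a aA; [exact: (ltsP _ _ LU)|exact: (ltsP _ _ TU)].
  - by rewrite -setUA setUCA subsetUl.
  move=> B UB BS /subsetPn[y yB yU].
  suff -> : lts A B = false by [].
  apply/negbTE/ltsP => /(_ x y xA yB) xy.
  have := subsetP BS y yB; rewrite !inE (negbTE yU) orbF => /orP[yL|yT].
    by have := ltsP _ _ LT y x yL xT; rewrite lt_gtF.
  by have := aT x y xT yT; rewrite xy.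
rewrite altB (alt_toggle (x := z)) ?inE ?zT ?orbT // sub0r; congr (- _).
rewrite (alt_shrink (S' := L)) ?subsetUl // ?alt_self ?eqxx // => A LA AS nAL.
by case: eqP => // E; rewrite E subxx in nAL.
Qed.

(** The scale is [- t] because [kappa] is -1 across a nonempty antichain. Over the empty set [kappa]
    is 1, whence the exceptional value, which vanishes exactly when [t] does. *)
Lemma weak_mass_antichain (P : finPoset) (S : {set P}) x :
  antichain (x |: S) -> x \notin S -> mass (weak_mass (- t)) S x = t - #|S|%:R
    \/ S = set0 /\ mass (weak_mass (- t)) S x = - t.
Proof.
move=> a xS; have [b0 a0] := isolated0 (antichain_isolated a (subsetUr _ _) (setU11 _ _)).
rewrite /mass /= /twin_pm antichain_twins // /scaled_kappa b0 a0.
have [->|S0] := eqVneq S set0.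
  right; split=> //; rewrite kappa_total ?setU0 ?cards0 ?subr0 ?mulr1 //.
  by apply/ltsP => u v; rewrite inE.
left; rewrite (kappa_gap (T := S)) ?set0U ?mulrNN ?mulr1 //.
- by rewrite -setI_eq0 set0I.
- by rewrite -setI_eq0 set0I.
- exact: antichain_sub (subsetUr _ _) a.
- by apply/ltsP => u v; rewrite inE.
- by apply/ltsP => u v; rewrite inE.
- by apply/ltsP => u v _; rewrite inE.
Qed.

Lemma weak_support (P : finPoset) :
  measure_support (measure_of_masses (weak_mass (- t))) P <->
  no_21 P /\ antichains_avoid t P.
Proof.
split=> [nz|[n21 av]].
  split; last first.
    apply: empty_nu_antichain nz => S x a xS tS.
    case: (weak_mass_antichain a xS) => [->|[S0 ->]]; first by rewrite tS subrr.
    by rewrite tS S0 cards0 oppr0.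
  (* Over [[set c]] the point [a] is a twin of [c], so [kappa] gives nothing to [b], which is above
     [a] only; nor does [b] have a twin. *)
  move=> a b c ab ca cb; apply: nz.
  have ac : a \notin [set c] by rewrite inE; apply: contraTneq ca => ->; rewrite comparablexx.
  have bc : b \notin [set c] by rewrite inE; apply: contraTneq cb => ->; rewrite comparablexx.
  have nab : a != b by rewrite lt_eqF.
  have bS : b \notin a |: [set c] by rewrite inE negb_or bc inE eq_sym nab.
  have nca : (c < a)%O = false by rewrite incomparable_ltF.
  have nac : (a < c)%O = false by rewrite incomparable_ltF // comparable_sym.
  have ncb : (c < b)%O = false by rewrite incomparable_ltF.
  apply: (empty_nu_eq0 bS); rewrite /mass /= /twin_pm /scaled_kappa.
  have tw : twin [set c] c a.
    by apply/twinP => s; rewrite inE => /eqP ->; rewrite ltxx nca nac.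
  rewrite (kappa_twin k ac bc nab (set11 c) tw) ab ncb mul0r mulr0 sub0r.
  rewrite (_ : twins _ _ _ = set0) ?cards0 ?oppr0 //.
  apply/setP => p; rewrite [RHS]in_set0 inE; apply/negbTE/negP => /andP[pS].
  case/andP=> /eqP/setP/(_ a); rewrite !inE eqxx ab /=.
  by case/setU1P: pS => [->|/set1P ->]; rewrite ?ltxx ?nac.
apply/eqP; apply: empty_nu_neq0 => S x xS.
(* Without 2+1 the points incomparable to [x] form an antichain between [L] and [U] and are
   precisely its twins, so the mass is [t - #|T|], or [- t] if [T] is empty. *)
set L := below S x; set U := above S x; pose T := S :\: (L :|: U).
have TP y : y \in T -> y \in S /\ (x >< y)%O.
  rewrite !inE negb_or => /andP[/andP[+ +] yS]; rewrite yS /= => yx xy; split=> //.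
  apply: incompP => //; first by apply: contraNneq xS => ->.
have aT : antichain T.
  move=> u v /TP[_ xu] /TP[_ xv]; apply/negP => uv; exact: n21 uv xu xv.
have aTx : antichain (x |: T).
  move=> u v /setU1P[->|uT] /setU1P[->|vT]; rewrite ?ltxx //.
  - by have [_ xv] := TP v vT; rewrite incomparable_ltF.
  - by have [_ xu] := TP u uT; rewrite incomparable_ltF // comparable_sym.
  - exact: aT.
have xT : x \notin T by rewrite inE negb_and xS orbT.
have avT j : (j <= #|T|)%N -> t != j%:R.
  by move=> jT; apply/eqP; apply: av aTx _ _; rewrite cardsU1 xT.
have LP y : y \in L -> y \in S /\ (y < x)%O by rewrite inE => /andP.
have UP y : y \in U -> y \in S /\ (x < y)%O by rewrite inE => /andP.
have LU : lts L U.
  by apply/ltsP => u v /LP[_ ux] /UP[_ xv]; apply: lt_trans xv.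
have LT : lts L T.
  apply/ltsP => u v /LP[_ ux] /TP[_ xv]; case: (comparableP u v) => // h.
  - by have := lt_trans h ux; rewrite incomparable_ltF // comparable_sym.
  - by case: (n21 u x v ux); rewrite comparable_sym.
  - by move: xv; rewrite -h /Order.comparable (ltW ux) orbT.
have TU : lts T U.
  apply/ltsP => v u /TP[_ xv] /UP[_ xu]; case: (comparableP v u) => // h.
  - by have := lt_trans xu h; rewrite incomparable_ltF.
  - by case: (n21 x u v xu); rewrite // comparable_sym.
  - by move: xv; rewrite h /Order.comparable (ltW xu).
have ST : S = L :|: U :|: T.
  apply/setP => z; rewrite !inE; case: (z \in S); rewrite ?andbF //=.
  by case: (z < x)%O => //; case: (x < z)%O.
have tT : twins S L U = T.
  apply/setP => p; rewrite inE; apply/andP/idP => [[pS /andP[/eqP pL /eqP pU]]|pT].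
    rewrite !inE pS !andbT /=.
    have : p \notin below S p by rewrite inE ltxx andbF.
    have : p \notin above S p by rewrite inE ltxx andbF.
    by rewrite pL pU !inE pS /= => /negbTE -> /negbTE ->.
  have [pS xp] := TP p pT; split=> //; apply/twinP => s sS.
  move: (sS); rewrite ST !in_setU -orbA => /or3P[sL|sU|sT].
  - have [_ sx] := LP s sL; have sp := ltsP _ _ LT s p sL pT.
    by rewrite sx sp (lt_gtF sx) (lt_gtF sp).
  - have [_ xs] := UP s sU; have ps := ltsP _ _ TU p s pT sU.
    by rewrite xs ps (lt_gtF xs) (lt_gtF ps).
  - have [_ /incomp_lt[/negbTE -> /negbTE ->]] := TP s sT.
    by rewrite (negbTE (aT s p sT pT)) (negbTE (aT p s pT sT)).
rewrite /mass /= /twin_pm -/L -/U tT /scaled_kappa.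
have [T0|T0] := eqVneq T set0.
  rewrite kappa_total // ?mulr1 ?T0 ?cards0 ?subr0 ?oppr_eq0; first exact: avT 0%N _.
  by rewrite {1}ST T0 setU0.
have dis (A : {set P}) : {in A, forall y, ~~ (x >< y)%O} -> [disjoint A & T].
  move=> h; rewrite -setI_eq0; apply/eqP/setP => y; rewrite inE in_set0.
  by apply/negbTE/negP => /andP[/h/negP nxy /TP[_]].
have dL : [disjoint L & T].
  by apply: dis => y /LP[_ yx]; rewrite /Order.comparable (ltW yx) orbT.
have dU : [disjoint U & T].
  by apply: dis => y /UP[_ xy]; rewrite /Order.comparable (ltW xy).
by rewrite (kappa_gap ST) // mulrNN mulr1 subr_eq0 avT.
Qed.

End WeakSupport.

Section ChainSupport.
Variables (k : fieldType) (t : k).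
Local Open Scope ring_scope.

(** Nothing lies above a maximal point of [S], so its positive formal point is isolated; apart from
    the term [- t], no other formal point is. *)
Lemma bottom_mass_isolated (P : finPoset) (S : {set P}) x :
  isolated S x -> mass (chain_mass t) S x = #|[set q in S | above S q == set0]|%:R - t.
Proof.
move=> /isolated0[b0 a0]; rewrite /mass /= chain_pm_bottom ?b0 //.
rewrite /bottom_mass a0 eqxx mulr1 sum_indicator; congr (_ - _).
apply: eq_bigr => q qS; rewrite (mem_set_neq (setU11 _ _) (negbT (in_set0 q))).
by rewrite subr0.
Qed.

Lemma chain_support (P : finPoset) :
  measure_support (measure_of_masses (chain_mass t)) P <->
  [/\ no_V P, no_Lambda P & antichains_avoid t P].
Proof.
split=> [nz|[nV nL av]].
  split; last first.
  - apply: empty_nu_antichain nz => S x a xS tS.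
    rewrite bottom_mass_isolated.
      rewrite tS (_ : [set q in S | _] = S) ?subrr //.
      apply/setP => q; rewrite inE andb_idr // => qS.
      have [_ ->] := isolated0 (antichain_isolated a (subsetUr _ _) (setU1r x qS)).
      exact: eqxx.
    exact: antichain_isolated a (subsetUr _ _) (setU11 _ _).
  - move=> a b c ba ca bc; apply: nz.
    have aS : a \notin [set b; c] by rewrite !inE negb_or !gt_eqF.
    apply: (empty_nu_eq0 aS); rewrite /mass /=.
    have E : below [set b; c] a = [set b; c].
      by apply/setP => z; rewrite !inE andb_idr // => /orP[] /eqP ->.
    rewrite chain_pm_based ?E; last by apply/set0Pn; exists b; rewrite !inE eqxx.
    rewrite (_ : based _ _ = false) ?oppr0 //; apply/negbTE/negP => /exists_inP[p pS].
    move/(just_aboveP pS aS) => hp.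
    have [hb _] := hp b (set21 _ _); have [hc _] := hp c (set22 _ _).
    have [bc1 bc2] := incomp_le bc; move: hb hc; rewrite ba ca.
    by case/set2P: pS => ->; rewrite ?bc1 ?bc2.
  - move=> a b c ab ac bc; apply: nz.
    have aS : a \notin [set b; c] by rewrite !inE negb_or !lt_eqF.
    apply: (empty_nu_eq0 aS); rewrite /mass /=.
    have b0 : below [set b; c] a == set0.
      apply/eqP/setP => z; rewrite !inE; apply/negbTE/negP.
      by case/andP => /orP[] /eqP ->; rewrite lt_gtF.
    have E : above [set b; c] a = [set b; c].
      by apply/setP => z; rewrite !inE andb_idr // => /orP[] /eqP ->.
    have bN : b != c by apply: contraNneq bc => ->; rewrite comparablexx.
    have cb : (c >< b)%O by rewrite comparable_sym.
    rewrite chain_pm_bottom // E /bottom_mass big1 => [|q qS].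
      rewrite (mem_set_neq (set21 b c) (negbT (in_set0 b))).
      by rewrite mulr0 subr0.
    rewrite (mem_set_neq' _ qS) ?inE ?ltxx ?andbF // sub0r.
    case/set2P: qS => ->.
      rewrite (mem_set_neq' _ (set22 b c)) ?oppr0 // !inE negb_or eq_sym bN.
      by rewrite (incomparable_ltF bc) andbF.
    rewrite (mem_set_neq' _ (set21 b c)) ?oppr0 // !inE negb_or bN.
    by rewrite (incomparable_ltF cb) andbF.
apply/eqP; apply: empty_nu_neq0 => S x xS.
case: (boolP (below S x == set0)) => [b0|b0]; last first.
  (* The point [p] is a base: without Lambda it is comparable to everything below [x], and without V
     everything above [p] is comparable to [x]. The mass is -1. *)
  have [p] := ex_maximal b0; rewrite inE => /andP[pS px] hp.
  rewrite /mass /= chain_pm_based // oppr_eq0.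
  suff -> : based S x by rewrite oner_neq0.
  apply/exists_inP; exists p => //; apply/just_aboveP => // s sS; split.
    apply/idP/idP => [sx|/le_lt_trans]; last exact.
    have := hp s; rewrite inE sS sx => /(_ isT).
    by case: (comparableP s p) => // h _; case: (nL x s p).
  apply/idP/idP => [|ps]; first exact: lt_trans px.
  case: (comparableP x s) => // h.
  - by have := hp s; rewrite inE sS h ps => /(_ isT).
  - by case: (nV p x s).
  - by move: xS; rewrite h sS.
have bS := below0 b0.
case: (boolP (above S x == set0)) => [a0|a0].
  have ix : isolated S x by rewrite /isolated b0 a0.
  rewrite bottom_mass_isolated // subr_eq0 eq_sym; set M := [set q in S | _].
  have MP q : q \in M -> q \in S /\ above S q = set0 by rewrite inE => /andP[? /eqP].
  have xM : x \notin M by rewrite inE negb_and xS.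
  have aM : antichain (x |: M).
    move=> u v /setU1P[->|/MP[uS u0]] /setU1P[->|/MP[vS _]]; rewrite ?ltxx //.
    - by have [] := isolatedP _ _ ix v vS.
    - by have [] := isolatedP _ _ ix u uS.
    - by have /setP/(_ v) := u0; rewrite !inE vS /= => ->.
  by apply/eqP; apply: av aM _ _; rewrite cardsU1 xM.
(* The mass is -1, from the formal point just below [p]. A positive point on this cut would need
   some [q] in [S] with the upper set of [x]; then [q < p], and comparing [q] with [x] gives a
   contradiction. *)
have [p] := ex_minimal a0; rewrite inE => /andP[pS xp] hp.
have Ep : above S x = p |: above S p.
  apply/setP => s; rewrite !inE; case: (eqVneq s p) => [->|sp] /=; first by rewrite pS.
  case sS: (s \in S) => //=; apply/idP/idP => [xs|]; last exact: lt_trans xp.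
  have := hp s; rewrite inE sS xs => /(_ isT).
  case: (comparableP s p) sp => // h _ _.
  by case: (nV x s p).
rewrite /mass /= chain_pm_bottom // /bottom_mass (negbTE a0) mulr0 subr0.
have noabove q : q \in S -> (above S q == above S x) = false.
  move=> qS; apply/negbTE/negP => /eqP E.
  have qp : (q < p)%O by have /setP/(_ p) := E; rewrite !inE pS xp.
  case: (comparableP x q) => h.
  - by have /setP/(_ q) := E; rewrite !inE qS h ltxx.
  - by have := bS q qS; rewrite h.
  - by case: (nL p x q).
  - by move: xS; rewrite h qS.
rewrite (big_setD1 p) //= noabove // -Ep eqxx big1 ?addr0 => [|q /setD1P[qp qS]].
  by rewrite sub0r oppr_eq0 oner_neq0.
rewrite noabove // sub0r Ep; case: eqP => [E|_]; last by rewrite oppr0.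
have : p \in q |: above S q by rewrite E setU11.
have : q \in p |: above S p by rewrite -E setU11.
rewrite !in_setU1 !inE pS qS /= ![_ == q]eq_sym (negbTE qp) /=.
by move=> h1 h2; have := lt_trans h1 h2; rewrite ltxx.
Qed.

End ChainSupport.

(** * Classification of amalgamation classes *)

Record amalgamation_class (F : finPoset -> Prop) : Prop := AmalgamationClass {
  class_nonempty : exists P : finPoset, F P;
  class_hereditary : forall (P Q : finPoset) (f : P -> Q), le_mono f -> F Q -> F P;
  class_amalgamation : forall (P Q P' : finPoset) (a : P -> Q) (b : P -> P'),
    le_mono a -> le_mono b -> F Q -> F P' ->
    exists (R : finPoset) (f : Q -> R) (g : P' -> R),
      [/\ F R, le_mono f, le_mono g & forall x, f (a x) = g (b x)]
}.

Lemma fraisse_class (F : finPoset -> Prop) : fraisse_subclass F -> amalgamation_class F.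
Proof.
case=> ne her am; have her' (P Q : finPoset) (f : P -> Q) : le_mono f -> F Q -> F P.
  by move=> fm; apply: her (mono_embedding fm).
split=> // P Q P' a b ma mb FQ FP'.
have [A FA] := am _ _ _ (mono_embedding ma) (mono_embedding mb) (her' _ _ _ ma FQ) FQ FP'.
exists (am_poset A), (am_b A), (am_a A); split=> //; [exact: emb_mono|exact: emb_mono|].
by move=> x; have := am_comm A x; rewrite !mono_embeddingE.
Qed.

Section Dual.
Variable P : finPoset.

Lemma dual_refl : reflexive (fun x y : P => y <= x).
Proof. exact: lexx. Qed.

Lemma dual_anti : antisymmetric (fun x y : P => y <= x).
Proof. by move=> x y; rewrite andbC => /le_anti. Qed.

Lemma dual_trans : transitive (fun x y : P => y <= x).
Proof. by move=> y x z xy yz; apply: le_trans yz xy. Qed.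

Definition dual_poset : finPoset := rel_poset dual_refl dual_anti dual_trans.

Definition to_dual (x : P) : dual_poset := x.
Definition of_dual (x : dual_poset) : P := x.

Lemma dual_le x y : (to_dual x <= to_dual y) = (y <= x).
Proof. by []. Qed.

Lemma dual_lt x y : (to_dual x < to_dual y) = (y < x).
Proof. by rewrite !lt_neqAle dual_le eq_sym. Qed.

Lemma dual_incomp x y : (to_dual x >< to_dual y) = (x >< y).
Proof. by rewrite /Order.comparable !dual_le orbC. Qed.

End Dual.

Lemma dual_class (F : finPoset -> Prop) :
  amalgamation_class F -> amalgamation_class (fun P => F (dual_poset P)).
Proof.
move=> CF; have her := class_hereditary CF; split.
- have [P FP] := class_nonempty CF; exists (dual_poset P).
  exact: (her _ P (fun x => of_dual (of_dual x))).
- move=> P Q f fm; apply: (her _ _ (fun x => to_dual (f (of_dual x)))) => x y.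
  exact: fm.
- move=> P Q P' a b ma mb FQ FP'.
  have [||||R [f [g [FR fm gm fg]]]] := class_amalgamation CF
    (P := dual_poset P) (Q := dual_poset Q) (P' := dual_poset P')
    (a := fun x => to_dual (a (of_dual x))) (b := fun x => to_dual (b (of_dual x))).
  + by move=> x y; exact: ma.
  + by move=> x y; exact: mb.
  + exact: FQ.
  + exact: FP'.
  exists (dual_poset R), (fun x => to_dual (f (to_dual x))), (fun x => to_dual (g (to_dual x))).
  split.
  + exact: (her _ R (fun x => of_dual (of_dual x))).
  + by move=> x y; exact: fm.
  + by move=> x y; exact: gm.
  + by move=> x; congr to_dual; exact: fg.
Qed.

Section Extension.
Variables (R T : finPoset) (S : {set R}) (g : sub_poset S -> T) (t : T).

Definition ext_fun (y : R) : T :=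
  oapp (fun z : {x | x \in S} => g z) t (insub y).

Lemma ext_in y (h : y \in S) : ext_fun y = g (sub_elt h).
Proof.
by rewrite /ext_fun (insubT (fun x => x \in S) h).
Qed.

Lemma ext_out y : y \notin S -> ext_fun y = t.
Proof. by move=> h; rewrite /ext_fun insubN. Qed.

End Extension.

Section Class.
Variables (F : finPoset -> Prop) (CF : amalgamation_class F).

Lemma class_sub (P : finPoset) (S : {set P}) : F P -> F (sub_poset S).
Proof. exact: class_hereditary (@sub_val_mono P S). Qed.

Lemma class_pattern (R Q : finPoset) (S : {set R}) (f : R -> Q) :
  {in S &, le_mono f} -> F Q -> F (sub_poset S).
Proof.
move=> fm; apply: (class_hereditary CF (f := fun z => f (sub_val z))) => x y.
by rewrite fm ?sub_valP.
Qed.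

(** Points of different pieces may become comparable or equal in [Q]; each use must show that the
    class forces the missing relations. *)
Lemma amalgam_cover (R : finPoset) (S1 S2 : {set R}) :
  S1 :|: S2 = setT -> F (sub_poset S1) -> F (sub_poset S2) ->
  exists (Q : finPoset) (f : R -> Q),
    [/\ F Q, {in S1 &, le_mono f} & {in S2 &, le_mono f}].
Proof.
move=> cov F1 F2.
have in1 (z : sub_poset (S1 :&: S2)) : sub_val z \in S1.
  by have := sub_valP z; rewrite inE => /andP[].
have in2 (z : sub_poset (S1 :&: S2)) : sub_val z \in S2.
  by have := sub_valP z; rewrite inE => /andP[].
have [||Q [f [g [FQ fm gm fg]]]] := class_amalgamation CF
  (a := fun z => sub_elt (in1 z)) (b := fun z => sub_elt (in2 z)) _ _ F1 F2.
- by move=> x y; rewrite -sub_val_mono.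
- by move=> x y; rewrite -sub_val_mono.
have /fin_all_exists[h hP] : forall x : R, exists z : Q,
    (forall k : x \in S1, z = f (sub_elt k)) /\ (forall k : x \in S2, z = g (sub_elt k)).
  move=> x; have [x1|x1] : x \in S1 \/ x \notin S1; [exact/orP/orbN| |]; last first.
    have x2 : x \in S2 by have : x \in S1 :|: S2 by [rewrite cov inE]; rewrite inE (negbTE x1).
    exists (g (sub_elt x2)); split=> k; first by case/negP: x1.
    by congr (g (sub_elt _)); apply: bool_irrelevance.
  exists (f (sub_elt x1)); split=> k.
    by congr (f (sub_elt _)); apply: bool_irrelevance.
  have x12 : x \in S1 :&: S2 by rewrite inE x1.
  have := fg (sub_elt x12); rewrite [in1 _](bool_irrelevance _ x1).
  by rewrite [in2 _](bool_irrelevance _ k).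
exists Q, h; split=> // x y xS yS; have [x1 x2] := hP x; have [y1 y2] := hP y.
  by rewrite (x1 xS) (y1 yS) fm -sub_val_mono.
by rewrite (x2 xS) (y2 yS) gm -sub_val_mono.
Qed.

Definition has_chain2 := exists2 Q : finPoset, F Q & exists a b : Q, a < b.
Definition has_V := exists2 Q : finPoset, F Q &
  exists a b c : Q, [/\ a < b, a < c & b >< c].
Definition has_Lambda := exists2 Q : finPoset, F Q &
  exists a b c : Q, [/\ b < a, c < a & b >< c].
Definition has_21 := exists2 Q : finPoset, F Q &
  exists a b c : Q, [/\ a < b, c >< a & c >< b].

Section Upper.
Hypotheses (C2 : has_chain2) (HL : has_Lambda).

Lemma above_point (Q : finPoset) (w : Q) : F Q ->
  exists (R : finPoset) (g : Q -> R) (t : R), [/\ F R, le_mono g & g w < t].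
Proof.
move=> FQ; have [Q2 F2 [u [v uv]]] := C2.
have [||R [f [g [FR fm gm fg]]]] := class_amalgamation CF (P := sub_poset [set w])
  (a := @sub_val _ _) (b := fun=> u) _ _ FQ F2.
- exact: sub_val_mono.
- move=> x y; rewrite -sub_val_mono.
  by have /set1P -> := sub_valP x; have /set1P -> := sub_valP y; rewrite !lexx.
exists R, f, (g v); split=> //.
by rewrite -[w]/(sub_val (sub_elt (set11 w))) fg (leW_mono gm).
Qed.

(** Incomparable points are glued to the feet of a Lambda; if they are comparable, a point above the
    larger one is enough. *)
Lemma above_two (Q : finPoset) (u v : Q) : F Q ->
  exists (R : finPoset) (g : Q -> R) (t : R),
    [/\ F R, le_mono g, g u < t & g v < t].
Proof.
move=> FQ; case: (boolP (u >=< v)) => [|uv].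
  case/orP=> uv; [have [R [g [t [FR gm h]]]] := above_point v FQ|
    have [R [g [t [FR gm h]]]] := above_point u FQ]; exists R, g, t; split=> //;
    by apply: le_lt_trans h; rewrite gm.
have [Q3 F3 [a [b [c [ba ca bc]]]]] := HL.
pose f0 (z : Q) := if z == u then b else c.
have f0u : f0 u = b by rewrite /f0 eqxx.
have f0v : f0 v = c by rewrite /f0 eq_sym (incomp_neq uv).
have [uv1 uv2] := incomp_le uv; have [bc1 bc2] := incomp_le bc.
have [||R [f [g [FR fm gm fg]]]] := class_amalgamation CF (P := sub_poset [set u; v])
  (a := @sub_val _ _) (b := fun z => f0 (sub_val z)) _ _ FQ F3.
- exact: sub_val_mono.
- move=> x y; rewrite -sub_val_mono.
  by have /set2P[->|->] := sub_valP x; have /set2P[->|->] := sub_valP y;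
    rewrite ?f0u ?f0v ?lexx ?uv1 ?uv2 ?bc1 ?bc2.
exists R, f, (g a); split=> //.
- by rewrite -[u]/(sub_val (sub_elt (set21 u v))) fg f0u (leW_mono gm).
- by rewrite -[v]/(sub_val (sub_elt (set22 u v))) fg f0v (leW_mono gm).
Qed.

Lemma above_all (Q : finPoset) (s : seq Q) : F Q ->
  exists (R : finPoset) (g : Q -> R) (t : R),
    [/\ F R, le_mono g & {in s, forall m, g m < t}].
Proof.
move=> FQ; elim: s => [|m s [R [g [t [FR gm gt]]]]].
  (* Even for the empty list some [t] must exist; amalgamation over the empty poset provides it. *)
  have [Q2 F2 [u _]] := C2.
  have [||R [f [g [FR fm gm _]]]] := class_amalgamation CF (P := sub_poset (set0 : {set Q}))
    (a := @sub_val _ _) (b := fun=> u) _ _ FQ F2.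
  - exact: sub_val_mono.
  - by move=> x; have := sub_valP x; rewrite inE.
  by exists R, f, (g u).
have [R' [g' [t' [FR' gm' mt tt']]]] := above_two (g m) t FR.
exists R', (g' \o g), t'; split=> //; first by move=> x y /=; rewrite gm' gm.
move=> x; rewrite inE => /orP[/eqP -> //|/gt xt] /=.
by apply: lt_trans tt'; rewrite (leW_mono gm').
Qed.

Lemma class_top (R : finPoset) (x : R) : (forall y, y != x -> y < x) ->
  F (sub_poset [set~ x]) -> F R.
Proof.
move=> top FS; have [R' [g [t [FR' gm gt]]]] := above_all (enum (sub_poset [set~ x])) FS.
have {}gt z : g z < t by apply: gt; rewrite mem_enum.
apply: (class_hereditary CF (f := ext_fun g t)) FR' => y z.
case: (boolP (y \in [set~ x])) => [yx|]; last first.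
  rewrite inE negbK => /set1P ->; rewrite (ext_out g t (y := x)) ?inE ?eqxx //.
  case: (boolP (z \in [set~ x])) => [zx|].
    rewrite (ext_in g t zx) (lt_geF (gt _)) lt_geF // top //.
    by move: zx; rewrite !inE.
  by rewrite inE negbK => /set1P ->; rewrite ext_out ?inE ?eqxx // !lexx.
rewrite (ext_in g t yx); case: (boolP (z \in [set~ x])) => [zx|].
  by rewrite (ext_in g t zx) gm -sub_val_mono.
rewrite inE negbK => /set1P ->; rewrite ext_out ?inE ?eqxx // (ltW (gt _)) ltW // top //.
by move: yx; rewrite !inE.
Qed.

End Upper.
End Class.

Lemma card_sub_poset (P : finPoset) (S : {set P}) : #|sub_poset S| = #|S|.
Proof.
rewrite -[in RHS](im_sub_incl S) /im card_imset ?cardsT //.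
exact: (@emb_inj _ _ (mono_embedding _)).
Qed.

Section DualPatterns.
Variables (F : finPoset -> Prop) (CF : amalgamation_class F).
Let Fd P := F (dual_poset P).

Lemma class_undual (P : finPoset) : F P -> Fd (dual_poset P).
Proof. exact: (class_hereditary CF (f := fun x => of_dual (of_dual x))). Qed.

Lemma dual_chain2 : has_chain2 F -> has_chain2 Fd.
Proof.
case=> Q FQ [a [b ab]]; exists (dual_poset Q); first exact: class_undual.
by exists (to_dual b), (to_dual a); rewrite dual_lt.
Qed.

Lemma dual_V : has_V F -> has_Lambda Fd.
Proof.
case=> Q FQ [a [b [c [ab ac bc]]]]; exists (dual_poset Q); first exact: class_undual.
by exists (to_dual a), (to_dual b), (to_dual c); rewrite !dual_lt dual_incomp.
Qed.

Lemma dual_Lambda : has_Lambda F -> has_V Fd.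
Proof.
case=> Q FQ [a [b [c [ab ac bc]]]]; exists (dual_poset Q); first exact: class_undual.
by exists (to_dual a), (to_dual b), (to_dual c); rewrite !dual_lt dual_incomp.
Qed.

Lemma class_bottom (R : finPoset) (x : R) : has_chain2 F -> has_V F ->
  (forall y, y != x -> x < y) -> F (sub_poset [set~ x]) -> F R.
Proof.
move=> C2 HV bot FS.
apply: (class_hereditary CF (f := fun y => to_dual (to_dual y))) (_ : Fd (dual_poset R)) => //.
apply: (class_top (dual_class CF) (dual_chain2 C2) (dual_V HV) (x := to_dual x)).
  by move=> y yx; rewrite -[y]/(to_dual (of_dual y)) dual_lt; apply: bot.
have h (z : sub_poset [set~ to_dual x]) : of_dual (sub_val z) \in [set~ x].
  exact: (sub_valP z).
apply: (class_hereditary CF (f := fun z => sub_elt (h (of_dual z)))) FS => y z.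
by [].
Qed.

End DualPatterns.

Section AllPosets.
Variables (F : finPoset -> Prop) (CF : amalgamation_class F).
Hypotheses (HV : has_V F) (HL : has_Lambda F) (H21 : has_21 F).

Lemma has_21_chain2 : has_chain2 F.
Proof. by case: H21 => Q FQ [a [b [c [ab _ _]]]]; exists Q => //; exists a, b. Qed.

(* Add a bottom and a top to the rest of [R]; a point incomparable to both is
   then forced to be incomparable to everything. *)
Lemma class_disjoint (R : finPoset) (u : R) :
  (forall y, y != u -> y >< u) -> F (sub_poset [set~ u]) -> F R.
Proof.
move=> dis FS; pose Q := sub_poset [set~ u]; have C2 := has_21_chain2.
have cutQ : is_cut (setT : {set Q}) setT set0.
  by apply/is_cutP; split; rewrite ?sub0set // => x y; rewrite !inE.
pose Q1 := cut_poset cutQ.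
have hsome (P : finPoset) (L U : {set P}) (h : is_cut setT L U)
    (z : sub_poset [set~ cut_new h]) : exists y, sub_val z = cut_some h y.
  have := sub_valP z; case: (sub_val z) => [y _|]; first by exists y.
  by rewrite !inE.
have Fsome (P : finPoset) (L U : {set P}) (h : is_cut setT L U) :
    F P -> F (sub_poset [set~ cut_new h]).
  move=> FP; have /fin_all_exists[f fP] := hsome _ _ _ h.
  by apply: (class_hereditary CF (f := f)) FP => x y; rewrite -sub_val_mono !fP.
have FQ1 : F Q1.
  apply: (class_top CF C2 HL (x := cut_new cutQ)); last exact: Fsome.
  case=> [y|]; last by rewrite eqxx.
  by move=> _; rewrite -[Some y]/(cut_some cutQ y) cut_some_lt inE.
have cutQ1 : is_cut (setT : {set Q1}) set0 setT.
  by apply/is_cutP; split; rewrite ?sub0set // => x y; rewrite !inE.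
pose Q2 := cut_poset cutQ1.
have FQ2 : F Q2.
  apply: (class_bottom CF (x := cut_new cutQ1)) => //; last exact: Fsome.
  case=> [y|]; last by rewrite eqxx.
  by move=> _; rewrite -[Some y]/(cut_some cutQ1 y) cut_new_lt inE.
pose i (z : Q) : Q2 := cut_some cutQ1 (cut_some cutQ z).
pose bot : Q2 := cut_new cutQ1; pose top : Q2 := cut_some cutQ1 (cut_new cutQ).
have bi z : bot < i z by rewrite cut_new_lt inE.
have it z : i z < top.
  by rewrite (leW_mono (@cut_some_mono _ _ _ _)) cut_some_lt inE.
have bt : bot < top by rewrite cut_new_lt inE.
have [Q3 F3 [a [b [c [ab ca cb]]]]] := H21.
pose j (z : Q3) : Q2 := if z == a then bot else top.
have ja : j a = bot by rewrite /j eqxx.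
have jb : j b = top by rewrite /j gt_eqF.
have [||T [f [g [FT fm gm fg]]]] := class_amalgamation CF (P := sub_poset [set a; b])
  (a := fun z => j (sub_val z)) (b := @sub_val _ _) _ _ FQ2 F3.
- move=> x y; rewrite -sub_val_mono.
  by have /set2P[->|->] := sub_valP x; have /set2P[->|->] := sub_valP y;
    rewrite ?ja ?jb ?lexx ?(ltW bt) ?(ltW ab) ?(lt_geF bt) ?(lt_geF ab).
- exact: sub_val_mono.
have fa : f bot = g a by rewrite -ja -[a]/(sub_val (sub_elt (set21 a b))) -fg.
have fb : f top = g b by rewrite -jb -[b]/(sub_val (sub_elt (set22 a b))) -fg.
have flt := leW_mono fm; have [ca1 ca2] := incomp_le ca; have [cb1 cb2] := incomp_le cb.
have ci z : (g c <= f (i z)) = false /\ (f (i z) <= g c) = false.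
  split; apply/negbTE/negP => h.
    by move: cb1; rewrite -gm -fb (le_trans h) // fm ltW.
  by move: ca2; rewrite -gm -fa (le_trans _ h) // fm ltW.
apply: (class_hereditary CF (f := ext_fun (fun z => f (i z)) (g c))) FT => y z.
case: (boolP (y \in [set~ u])) => [yu|]; last first.
  rewrite inE negbK => /set1P ->; rewrite (ext_out _ _ (y := u)) ?inE ?eqxx //.
  case: (boolP (z \in [set~ u])) => [zu|].
    rewrite (ext_in _ _ zu); have [-> _] := ci (sub_elt zu).
    by have [] := incomp_le (dis z _); first by move: zu; rewrite !inE.
  by rewrite inE negbK => /set1P ->; rewrite ext_out ?inE ?eqxx // !lexx.
rewrite (ext_in _ _ yu); case: (boolP (z \in [set~ u])) => [zu|].
  by rewrite (ext_in _ _ zu) fm.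
rewrite inE negbK => /set1P ->; rewrite ext_out ?inE ?eqxx //.
have [_ ->] := ci (sub_elt yu).
by have [] := incomp_le (dis y _); first by move: yu; rewrite !inE.
Qed.

(* Two incomparable points separated by minimal elements stay incomparable in
   any amalgam, so one is reduced to a chain with minimal elements attached;
   such a poset is built by adding top elements and isolated points. *)
Lemma class_separated (R : finPoset) (W : {set R}) :
  {in W, forall w y, ~~ (y < w)} ->
  (forall x y, x \notin W -> y \notin W -> x >< y ->
    exists2 w, w \in W & (w < x) && ~~ (w < y)) -> F R.
Proof.
have [n] := ubnP #|R|; elim: n R W => // n IH R W cR minW sepW.
have C2 := has_21_chain2.
pose W' (u : R) : {set sub_poset [set~ u]} := [set z | sub_val z \in W].
have cS (u : R) : (#|sub_poset [set~ u]| < n)%N.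
  have R0 : (0 < #|R|)%N by apply/card_gt0P; exists u.
  by rewrite card_sub_poset cardsC1 -ltnS prednK.
have minS (u : R) : {in W' u, forall w y, ~~ (y < w)}.
  by move=> w; rewrite inE => wW y; rewrite -(leW_mono (@sub_val_mono _ _)) minW.
case: (boolP [exists x in ~: W, exists y in ~: W, x >< y]).
  case/exists_inP => x; rewrite inE => xW /exists_inP[y]; rewrite inE => yW xy.
  have FS (u : R) : u \notin W -> F (sub_poset [set~ u]).
    move=> uW; apply: (IH _ (W' u)) => // p q; rewrite !inE => pW qW.
    rewrite /Order.comparable -!sub_val_mono => pq.
    have [w wW h] := sepW _ _ pW qW pq.
    have wu : w \in [set~ u] by rewrite !inE; apply: contraNneq uW => <-.
    by exists (sub_elt wu); rewrite ?inE // -!(leW_mono (@sub_val_mono _ _)).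
  have xney : x != y by rewrite incomp_neq.
  have cov : [set~ x] :|: [set~ y] = setT.
    by rewrite -setCI (_ : _ :&: _ = set0) ?setC0 //; apply/disjoint_setI0; rewrite disjoints1 inE.
  have [Q [f [FQ f1 f2]]] := amalgam_cover CF cov (FS x xW) (FS y yW).
  have [yx1 yx2] := incomp_le xy.
  (* The witness [w] of [u] against [v] lies in both pieces, so [f u <= f v] would give [w < v]. *)
  have key (u v : R) : u \notin W -> v \notin W -> u >< v ->
      {in [set~ u] &, le_mono f} -> {in [set~ v] &, le_mono f} -> (f u <= f v) = false.
    move=> uW vW uv g1 g2; have [w wW /andP[wu wv]] := sepW _ _ uW vW uv.
    have nuv : u != v by rewrite incomp_neq.
    have wnu : w \in [set~ u] by rewrite !inE lt_eqF.
    have wnv : w \in [set~ v] by rewrite !inE; apply: contraNneq vW => <-.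
    have unv : u \in [set~ v] by rewrite !inE.
    have vnu : v \in [set~ u] by rewrite !inE eq_sym.
    apply/negbTE; apply: contra wv => h; rewrite lt_neqAle -(g1 w v) //.
    rewrite (le_trans _ h) ?g2 ?(ltW wu) ?andbT //.
    by move: wnv; rewrite !inE.
  apply: (class_hereditary CF (f := f)) FQ => p q.
  case: (eqVneq p x) => [->|px]; case: (eqVneq q x) => [->|qx].
  - by rewrite !lexx.
  - case: (eqVneq q y) => [->|qy]; first by rewrite key // yx1.
    by rewrite f2 // !inE.
  - case: (eqVneq p y) => [->|py].
      by rewrite key // ?yx2 // comparable_sym.
    by rewrite f2 // !inE.
  - by rewrite f1 // !inE.
(* The points outside [W] now form a chain. Its largest element is a top of [R], unless some [w] in
   [W] is not below it; such a [w] is isolated. *)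
move=> noinc; have chain (x y : R) : x \notin W -> y \notin W -> x >=< y.
  move=> xW yW; apply: contraNT noinc => xy.
  by apply/exists_inP; exists x; rewrite ?inE //; apply/exists_inP; exists y; rewrite ?inE.
have FS (u : R) : F (sub_poset [set~ u]).
  apply: (IH _ (W' u)) => // p q; rewrite !inE => pW qW.
  by rewrite /Order.comparable -!sub_val_mono => /negP[]; apply: chain.
have FW (w : R) : w \in W -> (forall y, ~~ (w < y)) -> F R.
  move=> wW wmax; apply: (class_disjoint (u := w)) => // y yw.
  by apply: incompP => //; apply: minW.
case: (eqVneq (~: W) set0) => [W0|/ex_maximal[c]].
  have WT (y : R) : y \in W by have /setP/(_ y) := W0; rewrite !inE => /negbFE.
  case: (pickP (mem (setT : {set R}))) => [u _|R0].
    by apply: (FW u (WT u)) => y; apply: (minW y (WT y)).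
  have [P FP] := class_nonempty CF.
  have h (z : R) : exists p : P, false by have := R0 z; rewrite /= inE.
  have /fin_all_exists[f fP] := h.
  by apply: (class_hereditary CF (f := f)) FP => z; have := fP z.
rewrite inE => cW cmax.
have ctop (y : R) : y \notin W -> y <= c.
  move=> yW; have /orP[//|cy] := chain y c yW cW.
  by have := cmax y; rewrite inE yW lt_neqAle cy andbT negbK => /(_ isT)/eqP <-.
case: (boolP [exists w in W, ~~ (w < c)]) => [/exists_inP[w wW wc]|].
  apply: (FW w) => // y; apply/negP => wy; case: (boolP (y \in W)) => yW.
    by have := minW y yW w; rewrite wy.
  by case/negP: wc; apply: lt_le_trans wy (ctop y yW).
rewrite negb_exists_in => /forall_inP wc.
apply: (class_top CF C2 HL (x := c)) => // y yc; case: (boolP (y \in W)) => yW.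
  by have := wc y yW; rewrite negbK.
by rewrite lt_neqAle yc ctop.
Qed.

Section Witnesses.
Variable P : finPoset.

(* Below every point [inl x] a private minimal witness [inr x]. *)
Definition witness_le (u v : P + P) : bool :=
  match u, v with
  | inl x, inl y => x <= y
  | inr x, inl y => x <= y
  | inr x, inr y => x == y
  | inl _, inr _ => false
  end.

Lemma witness_refl : reflexive witness_le.
Proof. by case=> x /=. Qed.

Lemma witness_anti : antisymmetric witness_le.
Proof. case=> x [] y //=.
- by move=> h; congr inl; apply/le_anti.
- by rewrite andbF.
- by case/andP => /eqP ->. Qed.

Lemma witness_trans : transitive witness_le.
Proof.
case=> y [] x [] z //=; try exact: le_trans.
- by move=> /eqP ->.
- by move=> /eqP ->.
Qed.

Definition witness_poset : finPoset := rel_poset witness_refl witness_anti witness_trans.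

Lemma class_all : F P.
Proof.
pose l (x : P) : witness_poset := inl x; pose r (x : P) : witness_poset := inr x.
apply: (class_hereditary CF (f := l)) (_ : F witness_poset) => //.
apply: (class_separated (W := [set r x | x in setT])).
  move=> _ /imsetP[x _ ->] y; rewrite lt_neqAle; apply/negP => /andP[yx].
  by case: y yx => // y /eqP yx /eqP E; apply: yx; rewrite E.
move=> [x|x] [y|y]; rewrite ?(imset_f r) ?inE // => _ _ xy.
exists (r x); first exact: imset_f.
have rl u v : (r u < l v) = (u <= v) by rewrite lt_neqAle.
by rewrite !rl lexx; apply: contra xy => h; apply/orP; left.
Qed.

End Witnesses.

End AllPosets.

(** * Antichain sizes and identification of the classes *)

Section AntichainPoset.
Variable n : nat.

Lemma eq_anti : antisymmetric (fun i j : 'I_n => i == j).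
Proof. by move=> i j /andP[/eqP]. Qed.

Lemma eq_transitive : transitive (fun i j : 'I_n => i == j).
Proof. by move=> j i k /eqP ->. Qed.

Definition antichain_poset : finPoset :=
  rel_poset (fun i : 'I_n => eqxx i) eq_anti eq_transitive.

End AntichainPoset.

Section Classification.
Variables (F : finPoset -> Prop) (CF : amalgamation_class F).

Definition antichain_size (n : nat) := F (antichain_poset n).

Lemma antichain_le (P : finPoset) (S : {set P}) :
  antichain S -> {in S &, forall x y, (x <= y) = (x == y)}.
Proof. by move=> a x y xS yS; rewrite le_eqVlt (negbTE (a x y xS yS)) orbF. Qed.

Lemma antichain_sizeP (P : finPoset) (S : {set P}) :
  antichain S -> antichain_size #|S| <-> F (sub_poset S).
Proof.
move=> a; have le x y : (x <= y :> sub_poset S) = (x == y).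
  by rewrite -sub_val_mono (antichain_le a) ?sub_valP // (inj_eq (@sub_val_inj _ _)).
have c := card_sub_poset S; split.
  pose f (x : sub_poset S) : antichain_poset #|S| := cast_ord c (enum_rank x).
  apply: (class_hereditary CF (f := f)) => x y.
  by rewrite le [LHS](inj_eq (@cast_ord_inj _ _ _)) (inj_eq enum_rank_inj).
pose f (i : antichain_poset #|S|) : sub_poset S := enum_val (cast_ord (esym c) i).
apply: (class_hereditary CF (f := f)) => i j.
by rewrite le (inj_eq enum_val_inj) (inj_eq (@cast_ord_inj _ _ _)).
Qed.

Lemma antichain_size_le m n : (m <= n)%N -> antichain_size n -> antichain_size m.
Proof.
move=> mn; pose f (i : antichain_poset m) : antichain_poset n := widen_ord mn i.
exact: (class_hereditary CF (f := f)).
Qed.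

Lemma antichain_size0 : antichain_size 0.
Proof.
have [P FP] := class_nonempty CF.
have h (i : antichain_poset 0) : exists p : P, false by case: i.
have /fin_all_exists[f fP] := h.
by apply: (class_hereditary CF (f := f)) FP => -[].
Qed.

(* [n], or [-1] when the antichains of [F] are unbounded. *)
Lemma antichain_parameter : exists t : rat, forall m,
  antichain_size m <-> forall j, (j < m)%N -> t <> (j%:R)%R.
Proof.
have [all|/not_all_ex_not[m0 nm]] := classic (forall m, antichain_size m).
  exists (-1)%R => m; split=> // _ j _ /eqP.
  by rewrite eq_sym -subr_eq0 opprK natr1 Num.Theory.pnatr_eq0.
have [n [hn hn1]] : exists n, antichain_size n /\ ~ antichain_size n.+1.
  elim: m0 nm => [/(_ antichain_size0) //|m IH nm].
  by have [h|/IH //] := classic (antichain_size m); exists m.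
exists (n%:R)%R => m; split=> [hm j jm /eqP|h].
  rewrite Num.Theory.eqr_nat => /eqP nj; apply: hn1; apply: antichain_size_le hm.
  by rewrite nj.
apply: antichain_size_le hn; rewrite leqNgt; apply/negP => /h.
exact.
Qed.

Definition small_antichains (P : finPoset) :=
  forall S : {set P}, antichain S -> antichain_size #|S|.

Lemma small_antichainsP (t : rat) (P : finPoset) :
  (forall m, antichain_size m <-> forall j, (j < m)%N -> t <> (j%:R)%R) ->
  antichains_avoid t P <-> small_antichains P.
Proof. by move=> ht; split=> h S /h /ht. Qed.

Lemma class_small (P : finPoset) : F P -> small_antichains P.
Proof. by move=> FP S a; apply/(antichain_sizeP a)/(class_sub CF). Qed.

Lemma class_of_setT (P : finPoset) : F (sub_poset (setT : {set P})) -> F P.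
Proof.
by apply: (class_hereditary CF (f := fun x => sub_elt (in_setT x))) => x y;
  rewrite -sub_val_mono.
Qed.

Lemma antichain_class (P : finPoset) :
  antichain (setT : {set P}) -> small_antichains P -> F P.
Proof. by move=> a h; apply/class_of_setT/(antichain_sizeP a)/h. Qed.

Lemma class_pair (R : finPoset) (x y : R) : has_chain2 F -> x < y ->
  F (sub_poset [set x; y]).
Proof.
case=> Q FQ [u [v uv]] xy.
apply: (class_pattern CF (f := fun z => if z == x then u else v)) FQ.
have yx : (y == x) = false by rewrite gt_eqF.
by move=> p q /set2P[]-> /set2P[]->; rewrite ?eqxx ?yx ?lexx ?(ltW xy) ?(ltW uv)
  ?(lt_geF xy) ?(lt_geF uv).
Qed.

Lemma class_antichain1 (R : finPoset) (S : {set R}) :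
  antichain S -> small_antichains R -> F (sub_poset S).
Proof. by move=> a h; apply/(antichain_sizeP a)/h. Qed.

Lemma small_sub (P : finPoset) (S : {set P}) :
  small_antichains P -> small_antichains (sub_poset S).
Proof.
move=> h A a; have <- : #|[set sub_val z | z in A]| = #|A|.
  by rewrite card_imset //; apply: sub_val_inj.
apply: h => _ _ /imsetP[x xA ->] /imsetP[y yA ->].
by rewrite (leW_mono (@sub_val_mono _ _)) a.
Qed.

Lemma mono_incomp (P Q : finPoset) (S : {set P}) (f : P -> Q) x y :
  {in S &, le_mono f} -> x \in S -> y \in S -> (f x >< f y) = (x >< y).
Proof. by move=> fm xS yS; rewrite /Order.comparable !fm. Qed.

Lemma mono_lt (P Q : finPoset) (S : {set P}) (f : P -> Q) x y :
  {in S &, le_mono f} -> x \in S -> y \in S -> (f x < f y) = (x < y).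
Proof. by move=> fm xS yS; rewrite !lt_leAnge !fm. Qed.

Lemma card_remove (P : finPoset) (x : P) n :
  (#|P| < n.+1)%N -> (#|sub_poset [set~ x]| < n)%N.
Proof.
move=> cP; have P0 : (0 < #|P|)%N by apply/card_gt0P; exists x.
by rewrite card_sub_poset cardsC1 -ltnS prednK.
Qed.

Lemma le_mono_remove (P Q : finPoset) (x : P) (f : P -> Q) :
  {in [set~ x] &, le_mono f} ->
  (forall z, z != x -> (f z <= f x) = (z <= x) /\ (f x <= f z) = (x <= z)) ->
  le_mono f.
Proof.
move=> f1 fx p q; have [->|px] := eqVneq p x; have [->|qx] := eqVneq q x.
- by rewrite !lexx.
- by have [] := fx q qx.
- by have [] := fx p px.
- by rewrite f1 // !inE.
Qed.

(** Induction on the size: a maximal point [x] is glued back along the antichain of points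
    incomparable to it or, if there are none, along a 2-chain. The absence of 2+1 in the amalgam
    decides the other relations. *)
Lemma weak_class (P : finPoset) : has_chain2 F -> (forall Q, F Q -> no_21 Q) ->
  no_21 P -> small_antichains P -> F P.
Proof.
move=> C2 F21; have [n] := ubnP #|P|; elim: n P => // n IH P cP n21 sm.
have [P0|/ex_maximal[x _ xmax]] := eqVneq (setT : {set P}) set0.
  apply: antichain_class sm => y z; by rewrite P0 inE.
have {}xmax z : ~~ (x < z) by apply: xmax.
have FS1 : F (sub_poset [set~ x]).
  apply: IH; [exact: card_remove| |exact: small_sub].
  move=> a b c; rewrite -(leW_mono (@sub_val_mono _ _)) /Order.comparable -!sub_val_mono.
  exact: n21.
pose T := [set z | z >< x].
have aTx : antichain (x |: T).
  move=> u v /setU1P[->|]; first by move=> _; apply: xmax.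
  rewrite inE => ux /setU1P[->|]; first by have [] := incomp_lt ux.
  by rewrite inE => vx; apply/negP => uv; apply: (n21 u v x uv); rewrite comparable_sym.
have below_x z : z != x -> z \notin T -> z < x.
  by rewrite inE negbK => zx; case: (comparableP z x) zx (xmax z) => // ->.
have [T0|/set0Pn[y yT]] := eqVneq T set0; last first.
  have cov : [set~ x] :|: (x |: T) = setT.
    by apply/setP => z; rewrite !inE; case: (z == x).
  have [Q [f [FQ f1 f2]]] := amalgam_cover CF cov FS1 (class_antichain1 aTx sm).
  apply: (class_hereditary CF (f := f) _ FQ); apply: (le_mono_remove f1) => z zx.
  have [zT|zT] := boolP (z \in T); first by rewrite !f2 ?setU11 ?(setU1r x zT).
  have zlx := below_x z zx zT.
  (* Since [f z < f y] and [f x] is incomparable to [f y], excluding 2+1 leaves only [f z < f x]. *)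
  have xy : (f x >< f y).
    rewrite (mono_incomp f2) ?setU11 ?(setU1r x yT) // comparable_sym.
    by move: yT; rewrite inE.
  have yx : y != x by move: yT; rewrite inE => /incomp_neq ->.
  have zy : z < y.
    move: (yT); rewrite inE => yx'; case: (comparableP z y) => // h.
    - by have := lt_trans h zlx; rewrite incomparable_ltF.
    - by case: (n21 z x y zlx) => //; rewrite comparable_sym.
    - by move: zlx; rewrite h incomparable_ltF.
  have fzy : f z < f y by rewrite (mono_lt f1) // !inE.
  rewrite (ltW zlx) (lt_geF zlx); case: (comparableP (f z) (f x)) => // h.
  - by have := lt_trans h fzy; rewrite incomparable_ltF.
  - by case: (F21 Q FQ _ _ _ fzy _ xy); rewrite comparable_sym.
  - by move: fzy; rewrite h incomparable_ltF.
have [B0|/ex_maximal[y]] := eqVneq [set z | z < x] set0.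
  apply: antichain_class sm => u v _ _; apply/negP => uv.
  have ux : u != x by apply: contraTneq uv => ->.
  by have /setP/(_ u) := B0; rewrite !inE below_x // T0 inE.
rewrite inE => yx ymax.
have cov : [set~ x] :|: [set y; x] = setT.
  by apply/setP => z; rewrite !inE; case: (z == x); rewrite ?orbT.
have [Q [f [FQ f1 f2]]] := amalgam_cover CF cov FS1 (class_pair C2 yx).
have fyx : f y < f x by rewrite (mono_lt f2) ?set21 ?set22.
apply: (class_hereditary CF (f := f) _ FQ); apply: (le_mono_remove f1) => z zx.
have zlx : z < x by rewrite below_x // T0 inE.
rewrite (ltW zlx) (lt_geF zlx).
have zy : ~~ (f y < f z).
  by rewrite (mono_lt f1) ?inE ?zx ?(lt_eqF yx) //; apply: ymax; rewrite inE.
case: (comparableP (f z) (f x)) => // h.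
- by move: zy; rewrite (lt_trans fyx h).
- case: (comparableP (f z) (f y)) zy => // [h'|h'|h'] _.
  + by have := lt_trans h' fyx; rewrite incomparable_ltF.
  + by case: (F21 Q FQ _ _ _ fyx h').
  + by move: fyx; rewrite -h' incomparable_ltF.
- by move: zy; rewrite h fyx.
Qed.

(** The top [x] of a chain with at least two points is removed and glued back above its predecessor
    [y]. In the amalgam a point below [f x] is comparable to [f y] for lack of Lambda, and a point
    above [f x] would be above [f y]; so no unwanted relation arises. *)
Lemma chain_class (P : finPoset) : has_chain2 F ->
  (forall Q, F Q -> no_V Q) -> (forall Q, F Q -> no_Lambda Q) ->
  no_V P -> no_Lambda P -> small_antichains P -> F P.
Proof.
move=> C2 FV FL; have [n] := ubnP #|P|; elim: n P => // n IH P cP nV nL sm.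
have [A0|/ex_maximal[x]] := eqVneq [set x : P | [exists y, y < x]] set0.
  apply: antichain_class sm => u v _ _; apply/negP => uv.
  have /setP/(_ v) := A0; rewrite !inE => /existsP[]; by exists u.
rewrite inE => /existsP[y0 y0x] xmax.
have xtop z : ~~ (x < z).
  by apply/negP => xz; have := xmax z; rewrite inE xz => /(_ _)/negP; apply=> //; apply/existsP; exists x.
have B0 : [set z | z < x] != set0 by apply/set0Pn; exists y0; rewrite inE.
have [y] := ex_maximal B0; rewrite inE => yx ymax.
have FS1 : F (sub_poset [set~ x]).
  apply: IH; [exact: card_remove| | |exact: small_sub];
    move=> a b c; rewrite -!(leW_mono (@sub_val_mono _ _)) /Order.comparable -!sub_val_mono.
    exact: nV.
  exact: nL.
have cov : [set~ x] :|: [set y; x] = setT.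
  by apply/setP => z; rewrite !inE; case: (z == x); rewrite ?orbT.
have [Q [f [FQ f1 f2]]] := amalgam_cover CF cov FS1 (class_pair C2 yx).
have fyx : f y < f x by rewrite (mono_lt f2) ?set21 ?set22.
have yS : y \in [set~ x] by rewrite !inE lt_eqF.
apply: (class_hereditary CF (f := f) _ FQ); apply: (le_mono_remove f1) => z zx.
have zS : z \in [set~ x] by rewrite !inE.
have zy : z < x -> z <= y.
  move=> zlx; have := ymax z; rewrite inE zlx => /(_ isT).
  by case: (comparableP z y) => // h; case: (nL x z y).
have yz : ~~ (y < z).
  apply/negP => yz; case: (comparableP z x) => h.
  - by have := lt_geF yz; rewrite zy.
  - by have := xtop z; rewrite h.
  - by case: (nV y z x).
  - by rewrite h eqxx in zx.
have fyz : ~~ (f y < f z) by rewrite (mono_lt f1).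
have -> : (f x <= f z) = false.
  by apply: contraNF fyz => /(lt_le_trans fyx).
have -> : (x <= z) = false.
  by apply: contraNF (xtop z) => h; rewrite lt_neqAle h eq_sym zx.
split=> //; apply/idP/idP => [h|h].
  have fzx : f z < f x.
    by rewrite lt_neqAle h andbT; apply: contraNneq fyz => ->.
  case: (comparableP z y) => h'.
  - exact/ltW/(lt_trans h' yx).
  - by rewrite h' in yz.
  - by case: (FL Q FQ _ _ _ fzx fyx); rewrite (mono_incomp f1).
  - by rewrite h' ltW.
have {}h : z < x by rewrite lt_neqAle zx.
by apply: le_trans (ltW fyx); rewrite f1 // zy.
Qed.

(* Given x < y, z and v incomparable to all of x, y, z, amalgamate this poset
   with its image under exchanging y and v over {y, z, v}: the two lower points
   are both below z but each is below a different one of y and v. *)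
Lemma V_Lambda : has_V F -> has_Lambda F.
Proof.
case=> Q FQ [x [y [z [xy xz yz]]]]; apply: NNPP => nL.
have FL R : F R -> no_Lambda R.
  by move=> FR a b c ba ca bc; apply: nL; exists R => //; exists a, b, c.
(* Origin of the fourth point: the bottom of one V is glued to the branch [y] of another. The other
   branch [g z] is incomparable to [f x] and, for lack of Lambda, to [f y] and [f z]. *)
have [||R [f [g [FR fm gm fg]]]] := class_amalgamation CF (P := sub_poset [set x])
  (a := @sub_val _ _) (b := fun=> y) _ _ FQ FQ.
- exact: sub_val_mono.
- move=> p q; rewrite -sub_val_mono.
  by have /set1P -> := sub_valP p; have /set1P -> := sub_valP q; rewrite !lexx.
have fx : f x = g y by rewrite -[x]/(sub_val (sub_elt (set11 x))) fg.
have gi p q : p >< q -> g p >< g q by rewrite /Order.comparable !gm.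
have vx : g z >< f x by rewrite fx comparable_sym; apply: gi.
have vabove w : x < w -> g z >< f w.
  move=> xw; have fxw : f x < f w by rewrite (leW_mono fm).
  case: (comparableP (g z) (f w)) => // h.
  - by case: (FL R FR _ _ _ h fxw).
  - by have := lt_trans fxw h; rewrite incomparable_ltF // comparable_sym.
  - by move: fxw; rewrite -h incomparable_ltF // comparable_sym.
have vy := vabove y xy; have vz := vabove z xz.
have fyz : f y >< f z by rewrite /Order.comparable !fm.
have fxy : f x < f y by rewrite (leW_mono fm).
have fxz : f x < f z by rewrite (leW_mono fm).
move: (f x) (f y) (f z) (g z) vx vy vz fyz fxy fxz => X Y Z V VX VY VZ YZ XY XZ.
have sw (w : R) : w \in [set Y; Z; V] -> [\/ w = Y, w = Z | w = V].
  by rewrite !inE -orbA => /or3P[] /eqP; [constructor 1|constructor 2|constructor 3].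
pose s (w : R) := if w == Y then V else if w == V then Y else Z.
have sY : s Y = V by rewrite /s eqxx.
have sV : s V = Y by rewrite /s eqxx (incomp_neq VY).
have sZ : s Z = Z.
  by rewrite /s eq_sym (incomp_neq YZ) eq_sym (incomp_neq VZ).
have [[vy1 vy2] [vz1 vz2] [yz1 yz2]] :=
  And3 (incomp_le VY) (incomp_le VZ) (incomp_le YZ).
have [||R2 [h1 [h2 [FR2 m1 m2 h12]]]] := class_amalgamation CF
  (P := sub_poset [set Y; Z; V])
  (a := @sub_val _ _) (b := fun w => s (sub_val w)) _ _ FR FR.
- exact: sub_val_mono.
- move=> p q; rewrite -sub_val_mono.
  by case: (sw _ (sub_valP p)) => ->; case: (sw _ (sub_valP q)) => ->;
    rewrite ?sY ?sV ?sZ ?lexx ?vy1 ?vy2 ?vz1 ?vz2 ?yz1 ?yz2.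
have eqh w (wS : w \in [set Y; Z; V]) : h1 w = h2 (s w) by exact: (h12 (sub_elt wS)).
have eY : h1 Y = h2 V by rewrite -sY eqh // !inE eqxx.
have eZ : h1 Z = h2 Z by rewrite -{2}sZ eqh // !inE eqxx orbT.
have eV : h1 V = h2 Y by rewrite -sV eqh // !inE eqxx orbT.
have [vx1 vx2] := incomp_le VX.
(* If comparable, the lower of the two images of [X] would be below the image of [V] under the same
   map; if incomparable, they form a Lambda with [h1 Z]. *)
case: (boolP (h1 X >=< h2 X)) => [/orP[] h|nc].
- by move: vx2; rewrite -m1 eV (le_trans h) // m2 ltW.
- by move: vx2; rewrite -m2 -eY (le_trans h) // m1 ltW.
- apply: (FL R2 FR2 (h1 Z) (h1 X) (h2 X)) nc; first by rewrite (leW_mono m1).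
  by rewrite eZ (leW_mono m2).
Qed.

End Classification.

Lemma Lambda_V (F : finPoset -> Prop) : amalgamation_class F -> has_Lambda F -> has_V F.
Proof.
move=> CF /(dual_Lambda CF)/(V_Lambda (dual_class CF))[Q FQ [a [b [c [ba ca bc]]]]].
exists (dual_poset Q) => //; exists (to_dual a), (to_dual b), (to_dual c).
by rewrite !dual_lt dual_incomp.
Qed.

Theorem corollary8p5 (F : finPoset -> Prop)
    (F_fraisse : fraisse_subclass F) (F_proper : proper_subclass F) :
  exists (k : fieldType) (nu : measure k),
    [pchar k]%R =i pred0 /\ (forall P : finPoset, F P <-> measure_support nu P).
Proof.
have CF := fraisse_class F_fraisse; have [t ht] := antichain_parameter CF.
have small P := small_antichainsP P ht.
suff [m mP] : exists m : point_mass rat,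
    forall P, F P <-> measure_support (measure_of_masses m) P.
  by exists rat, (measure_of_masses m); split=> //; apply: Num.Theory.pchar_num.
have [C2|nC2] := classic (has_chain2 F); last first.
  exists (antichain_mass t) => P.
  split=> [FP|/antichain_support[aP /small sm]]; last exact: (antichain_class CF).
  apply/antichain_support; split; last exact/small/(class_small CF).
  by move=> x y _ _; apply/negP => xy; apply: nC2; exists P => //; exists x, y.
have [H21|n21] := classic (has_21 F); last first.
  have F21 Q : F Q -> no_21 Q.
    by move=> FQ a b c ab ca cb; apply: n21; exists Q => //; exists a, b, c.
  exists (weak_mass (- t)%R) => P.
  split=> [FP|/weak_support[n21P /small sm]]; last exact: (weak_class CF).
  by apply/weak_support; split; [apply: F21|apply/small/(class_small CF)].
have nV : ~ has_V F.
  by move=> HV; apply: F_proper => P; apply: class_all => //; apply: V_Lambda.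
have nL : ~ has_Lambda F by move=> /(Lambda_V CF).
have FV Q : F Q -> no_V Q.
  by move=> FQ a b c ab ac bc; apply: nV; exists Q => //; exists a, b, c.
have FL Q : F Q -> no_Lambda Q.
  by move=> FQ a b c ba ca bc; apply: nL; exists Q => //; exists a, b, c.
exists (chain_mass t) => P.
split=> [FP|/chain_support[nVP nLP /small sm]]; last exact: (chain_class CF).
by apply/chain_support; split; [apply: FV|apply: FL|apply/small/(class_small CF)].
Qed.
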